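(* In the standing setting described in the context, define $\psi\in L^2(\mathbb{R}^d)$ by $$\psi=\sum_{\vec n\in\mathbb{Z}^d}(-1)^{\vec q_A\circ\vec n}\,\overline{h_{\vec\ell_A-\vec n}}\,D_AT_{\vec n}\varphi,$$ i.e. $\psi(\vec t)=\sqrt2\sum_{\vec n\in\mathbb{Z}^d}(-1)^{\vec q_A\circ\vec n}\overline{h_{\vec\ell_A-\vec n}}\,\varphi(A\vec t-\vec n)$. Then $\{D_A^nT_{\vec\ell}\psi: n\in\mathbb{Z},\vec\ell\in\mathbb{Z}^d\}$ is a Parseval's frame (normalized tight frame) for $L^2(\mathbb{R}^d)$, i.e. $\sum_{n\in\mathbb{Z}}\sum_{\vec\ell\in\mathbb{Z}^d}|\langle f,D_A^nT_{\vec\ell}\psi\rangle|^2=\|f\|^2$ for all $f\in L^2(\mathbb{R}^d)$.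
   Context: Notation: $\vec x\circ\vec y=\sum_j x_j\overline{y_j}$ for $\vec x,\vec y\in\mathbb{C}^d$; $A^\tau$ is the transpose; a matrix is expansive if all its eigenvalues have modulus $>1$. $(T_{\vec\ell}f)(\vec t)=f(\vec t-\vec\ell)$ and $(D_Af)(\vec t)=\sqrt2 f(A\vec t)$ on $L^2(\mathbb{R}^d)$, with $\langle f,g\rangle=\int f\overline g$. Fourier transform: $\hat f(\vec s)=(\mathcal F f)(\vec s)=(2\pi)^{-d/2}\int_{\mathbb{R}^d}e^{-i\vec s\circ\vec t}f(\vec t)\,d\vec t$ on $L^1\cap L^2$, extended to a unitary on $L^2(\mathbb{R}^d)$. Standing setting: $A$ is a $d\times d$ expansive integral matrix with $|\det A|=2$ such that $A\mathbb{Z}^d=A^\tau\mathbb{Z}^d$, and $\vec\ell_A,\vec q_A\in\mathbb{Z}^d$ satisfy: $\mathbb{Z}^d=(\vec\ell_A+A\mathbb{Z}^d)\dot\cup A\mathbb{Z}^d$; $\vec q_A\circ A\mathbb{Z}^d\subseteq2\mathbb{Z}$ and $\vec q_A\circ(\vec\ell_A+A\mathbb{Z}^d)\subseteq2\mathbb{Z}+1$; for $\vec m\in A\mathbb{Z}^d$ and $\vec n\in\mathbb{Z}^d$, $\mathbb{Z}^d=(\vec n-A\mathbb{Z}^d)\dot\cup(\vec\ell_A-\vec m-\vec n+A\mathbb{Z}^d)$; for $\vec m\in\vec\ell_A+A\mathbb{Z}^d$ and $\vec n\in\mathbb{Z}^d$, $\vec n-A\mathbb{Z}^d=\vec\ell_A-\vec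 m-\vec n+A\mathbb{Z}^d$. The complex numbers $\{h_{\vec n}\}_{\vec n\in\mathbb{Z}^d}$ satisfy $\sum_{\vec n}h_{\vec n}\overline{h_{\vec n+\vec k}}=\delta_{\vec0,\vec k}$ for all $\vec k\in A\mathbb{Z}^d$ and $\sum_{\vec n}h_{\vec n}=\sqrt2$, and $h_{\vec n}=0$ for $\vec n\notin\Lambda_0=\mathbb{Z}^d\cap[-N_0,N_0]^d$ for some $N_0\in\mathbb{N}$. Let $m_0(\vec t)=\frac1{\sqrt2}\sum_{\vec n\in\Lambda_0}h_{\vec n}e^{-i\vec n\circ\vec t}$ ($\vec t\in\mathbb{C}^d$), $g(\vec\xi)=(2\pi)^{-d/2}\prod_{j=1}^\infty m_0((A^\tau)^{-j}\vec\xi)$ for $\vec\xi\in\mathbb{R}^d$, and $\varphi=\mathcal F^{-1}g$ (which lies in $L^2(\mathbb{R}^d)$). *)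

(* Defs.v *)
From HB Require Import structures.
From mathcomp Require Import all_boot all_order all_algebra all_field.
From mathcomp Require Import all_classical all_reals all_analysis.
From mathcomp.real_closed Require Import complex.

Set Implicit Arguments.
Unset Strict Implicit.
Unset Printing Implicit Defensive.

Import Order.TTheory GRing.Theory Num.Theory.
Import numFieldNormedType.Exports.
Local Open Scope ring_scope.
Local Open Scope classical_set_scope.
Local Open Scope complex_scope.

Definition latt (d : nat) (M : 'M[int]_d) : set 'cV[int]_d :=
  [set M *m v | v in [set: 'cV[int]_d]].

Definition pcoset (d : nat) (c : 'cV[int]_d) (S : set 'cV[int]_d) :
  set 'cV[int]_d := [set c + x | x in S].
Definition mcoset (d : nat) (c : 'cV[int]_d) (S : set 'cV[int]_d) :
  set 'cV[int]_d := [set c - x | x in S].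

(* x o y for integer vectors (conjugation is trivial) *)
Definition dotZ (d : nat) (x y : 'cV[int]_d) : int := \sum_i x i 0 * y i 0.

Definition inLam0 (d N0 : nat) (n : 'cV[int]_d) : Prop :=
  forall i, (`|n i 0| <= N0%:Z)%R.
Definition Lam0 (d N0 : nat) : seq 'cV[int]_d :=
  [seq \col_i ((f i : nat)%:Z - N0%:Z) | f : {ffun 'I_d -> 'I_(N0.*2.+1)}].

Definition expansive (d : nat) (A : 'M[int]_d) : Prop :=
  forall z : algC, root (char_poly (map_mx intr A)) z -> 1 < `|z|.

Section Analysis.
Variable R : realType.
Local Notation C := R[i].
Definition cRe (z : C) : R := complex.Re z.
Definition cIm (z : C) : R := complex.Im z.

(* points of R^d are d-tuples of reals (product = Borel sigma-algebra) *)
Definition tup2cv (d : nat) (t : d.-tuple R) : 'cV[R]_d := \col_i tnth t i.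
Definition cv2tup (d : nat) (v : 'cV[R]_d) : d.-tuple R := [tuple v i 0 | i < d].
Definition intv (d : nat) (n : 'cV[int]_d) : d.-tuple R :=
  [tuple (n i 0)%:~R | i < d].
Definition subt (d : nat) (t u : d.-tuple R) : d.-tuple R :=
  [tuple tnth t i - tnth u i | i < d].
Definition mxR (d : nat) (A : 'M[int]_d) : 'M[R]_d := map_mx intr A.
Definition actM (d : nat) (M : 'M[R]_d) (t : d.-tuple R) : d.-tuple R :=
  cv2tup (M *m tup2cv t).
Definition dotR (d : nat) (x y : d.-tuple R) : R := \sum_i tnth x i * tnth y i.

(* Lebesgue integral on R^d, as the iterated Lebesgue integral (Fubini-Tonelli) *)
Fixpoint iint (d : nat) : (d.-tuple R -> \bar R) -> \bar R :=
  match d with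
  | 0 => fun F => F [tuple]
  | k.+1 => fun F =>
      (\int[@lebesgue_measure R]_x iint (fun t => F (cons_tuple x t)))%E
  end.

Definition expi (x : R) : C := (cos x) +i* (sin x).
Definition sqmod (z : C) : R := cRe z ^+ 2 + cIm z ^+ 2.

Definition Cint (d : nat) (F : d.-tuple R -> C) : C :=
  (fine (iint (fun t => (cRe (F t))%:E))) +i* (fine (iint (fun t => (cIm (F t))%:E))).

Definition measC (d : nat) (f : d.-tuple R -> C) : Prop :=
  measurable_fun setT (fun t => cRe (f t)) /\ measurable_fun setT (fun t => cIm (f t)).

Definition normsq (d : nat) (f : d.-tuple R -> C) : \bar R :=
  iint (fun t => (sqmod (f t))%:E).

Definition L2 (d : nat) (f : d.-tuple R -> C) : Prop :=
  measC f /\ (normsq f < +oo)%E.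
Definition L1 (d : nat) (f : d.-tuple R -> C) : Prop :=
  measC f /\ (iint (fun t => (Num.sqrt (sqmod (f t)))%:E) < +oo)%E.

Definition ip (d : nat) (f g : d.-tuple R -> C) : C :=
  Cint (fun t => f t * conjc (g t)).

Definition FT (d : nat) (f : d.-tuple R -> C) : d.-tuple R -> C :=
  fun s => ((2 * pi) `^ (- (d%:R / 2)))%:C * Cint (fun t => expi (- dotR s t) * f t).

Definition L2cvg (d : nat) (u : nat -> d.-tuple R -> C) (f : d.-tuple R -> C) : Prop :=
  forall e : R, 0 < e -> exists N, forall k, (N <= k)%N ->
    (normsq (fun t => (u k t - f t)%R) < e%:E)%E.

(* the unitary extension of FT to L^2: FT_L2 f g  means  (F f) = g  in L^2,
   F being the continuous extension of FT from L^1 cap L^2 *)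
Definition FT_L2 (d : nat) (f g : d.-tuple R -> C) : Prop :=
  L2 f /\ L2 g /\
  forall u : nat -> d.-tuple R -> C, (forall k, L1 (u k) /\ L2 (u k)) ->
    L2cvg u f -> L2cvg (fun k => FT (u k)) g.

Definition m0 (d N0 : nat) (h : 'cV[int]_d -> C) (t : d.-tuple R) : C :=
  ((Num.sqrt 2)^-1)%:C * \sum_(n <- Lam0 d N0) h n * expi (- dotR (intv n) t).

Definition ATinv (d : nat) (A : 'M[int]_d) : 'M[R]_d := invmx (mxR A)^T.
Definition gpart (d N0 : nat) (A : 'M[int]_d) (h : 'cV[int]_d -> C)
  (xi : d.-tuple R) (J : nat) : C :=
  \prod_(1 <= j < J.+1) m0 N0 h (actM (ATinv A ^+ j) xi).
Definition limC (u : nat -> C) : C :=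
  (limn (fun J => cRe (u J))) +i* (limn (fun J => cIm (u J))).
Definition gA (d N0 : nat) (A : 'M[int]_d) (h : 'cV[int]_d -> C) :
  d.-tuple R -> C :=
  fun xi => ((2 * pi) `^ (- (d%:R / 2)))%:C * limC (gpart N0 A h xi).

Definition Tr (d : nat) (l : 'cV[int]_d) (f : d.-tuple R -> C) : d.-tuple R -> C :=
  fun t => f (subt t (intv l)).
Definition DA (d : nat) (A : 'M[int]_d) (f : d.-tuple R -> C) : d.-tuple R -> C :=
  fun t => (Num.sqrt 2)%:C * f (actM (mxR A) t).
Definition DAinv (d : nat) (A : 'M[int]_d) (f : d.-tuple R -> C) : d.-tuple R -> C :=
  fun t => ((Num.sqrt 2)^-1)%:C * f (actM (invmx (mxR A)) t).
Definition DApow (d : nat) (A : 'M[int]_d) (n : int) (f : d.-tuple R -> C) :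
  d.-tuple R -> C :=
  match n with
  | Posz k => iter k (DA A) f
  | Negz k => iter k.+1 (DAinv A) f
  end.

(* psi = sum_n (-1)^{q o n} conj(h_{l - n}) D_A T_n phi ;
   only n with l - n in Lambda_0 contribute, i.e. n in l - Lambda_0 *)
Definition psiA (d N0 : nat) (A : 'M[int]_d) (lA qA : 'cV[int]_d)
  (h : 'cV[int]_d -> C) (phi : d.-tuple R -> C) : d.-tuple R -> C :=
  fun t => \sum_(n <- [seq lA - m | m <- Lam0 d N0])
             ((-1) ^ (dotZ qA n)) * conjc (h (lA - n)) * DA A (Tr n phi) t.

Definition frame_sum (d : nat) (A : 'M[int]_d) (psi f : d.-tuple R -> C) : \bar R :=
  esum [set: int * 'cV[int]_d]
    (fun p => (sqmod (ip f (DApow A p.1 (Tr p.2 psi))))%:E).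

End Analysis.

(* Main.v *)
Require Import Defs.
From HB Require Import structures.
From mathcomp Require Import all_boot all_order all_algebra all_field.
From mathcomp Require Import all_classical all_reals all_analysis.
From mathcomp.real_closed Require Import complex.
From mathcomp Require Import measurable_realfun.
From mathcomp Require Import ring lra zify.
Import Order.TTheory GRing.Theory Num.Theory.
Import numFieldNormedType.Exports.
Local Open Scope ring_scope.
Local Open Scope classical_set_scope.
Local Open Scope complex_scope.
Set Implicit Arguments.
Unset Strict Implicit.
Unset Printing Implicit Defensive.

(* Idea. Cascade iterates [casc J], started at the indicator of the unit cube, satisfy the
   refinement equation level by level. For compactly supported [f] the coefficients
   [coef f K J l] = <f, D^K T_l (casc J)> obey a finite filter-bank recursion which, by the
   orthogonality relations of [h] and the coset structure, splits the level [K + 1] energy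
   exactly into the level [K] scaling energy and the level [K] wavelet energy. The transforms
   of the iterates converge pointwise to the infinite product and the iterates are bounded in
   L^1 and L^2, so they converge weakly to [phi] and the splitting passes to the limit.
   Telescoping over the scales leaves the energy at scale [M] minus that at scale [- M]: the
   first tends to |f|^2 when [f] is a step function (the supports of the dilated iterates
   shrink, uniformly in [J]), the second to 0 because A^(-M) contracts a fixed
   compact set to a point. Step functions are dense, which gives every [f] in L^2. *)

(** * Lebesgue measure on tuples *)

Section tuple_measure.
Variable R : realType.
Local Open Scope ereal_scope.
Local Notation RR := (measurableTypeR R).

(** Two obstacles fix the route. The integer translates of [phi] need not be orthonormal, and [phi]
    is given only through its transform: neither its support nor a refinement equation is at hand.
    The iterates have both by construction, and all that is needed about [phi] concerns finitely
    many inner products at a time, so weak convergence is enough. The transform enters only through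
    the multiplication formula (the integral of u times the transform of w equals that of w times
    the transform of u); pairing with explicit w whose transforms are Poisson-smoothed boxes takes
    the place of Plancherel's theorem. A weak limit may lose norm, so the lower bound cannot come
    from the size of [phi]. It comes from large levels: the coefficients of a step function,
    attached to the orthonormal dilated cubes instead of the iterates, rebuild it up to an error
    uniform in [J]. Finally, A^(-1) itself need not contract; only its powers decay, so the
    estimates are made for all powers at once. *)

Definition tcons (k : nat) (p : RR * k.-tuple R) : k.+1.-tuple R :=
  cons_tuple (p.1 : R) p.2.

Lemma measurable_tcons (k : nat) : measurable_fun [set: RR * k.-tuple R] (@tcons k).
Proof.
have h1 : measurable_fun [set: RR * k.-tuple R] (fun p => p.1 : R).
  exact: (@measurable_fst _ _ RR).
have h2 : measurable_fun [set: RR * k.-tuple R] (fun p => p.2 : k.-tuple R).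
  exact: (@measurable_snd _ _ RR).
exact: (measurable_cons h1 h2).
Qed.

Definition tuncons (k : nat) (t : k.+1.-tuple R) : RR * k.-tuple R :=
  (thead t, [tuple of behead t]).

Lemma measurable_tuncons (k : nat) : measurable_fun setT (@tuncons k).
Proof.
apply/measurable_fun_pairP; split.
  exact: measurable_tnth.
exact: measurable_behead.
Qed.

Lemma tconsK (k : nat) : cancel (@tcons k) (@tuncons k).
Proof. by case=> x t; rewrite /tuncons theadE; congr (_, _); exact/val_inj. Qed.

Section mu_step.
Variables (k : nat) (m : {sigma_finite_measure set (k.-tuple R) -> \bar R}).

Definition mu_next : set (k.+1.-tuple R) -> \bar R :=
  pushforward (@lebesgue_measure R \x m) (@tcons k).

Let mu_next0 : mu_next set0 = 0.
Proof. by rewrite /mu_next /pushforward preimage_set0 measure0. Qed.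

Let mu_next_ge0 X : 0 <= mu_next X. Proof. by rewrite /mu_next /pushforward measure_ge0. Qed.

Let mu_next_sigma_additive : semi_sigma_additive mu_next.
Proof.
move=> F mF tF mUF; rewrite /mu_next /pushforward preimage_bigcup.
apply: measure_semi_sigma_additive.
- by move=> n; rewrite -[X in measurable X]setTI; exact: measurable_tcons.
- apply/trivIsetP => i j _ _ ij; rewrite -preimage_setI.
  by move/trivIsetP : tF => /(_ _ _ _ _ ij) ->//; rewrite preimage_set0.
- by rewrite -preimage_bigcup -[X in measurable X]setTI; exact: measurable_tcons.
Qed.

HB.instance Definition _ := isMeasure.Build _ _ _ mu_next
  mu_next0 mu_next_ge0 mu_next_sigma_additive.

Lemma mu_next_sigma_finite : sigma_finite setT mu_next.
Proof.
have /sigma_finiteP[F [UF Fnd Ffin]] := sigma_finiteT (@lebesgue_measure R).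
have /sigma_finiteP[G [UG Gnd Gfin]] := sigma_finiteT m.
exists (fun i => @tuncons k @^-1` (F i `*` G i)).
  apply/esym; rewrite -subTset => t _.
  have [i _ Fi] : (\bigcup_i F i) (tuncons t).1 by rewrite -UF.
  have [j _ Gj] : (\bigcup_i G i) (tuncons t).2 by rewrite -UG.
  exists (maxn i j) => //; split.
    exact: (subsetPset _ _ (Fnd _ _ (leq_maxl i j))).
  exact: (subsetPset _ _ (Gnd _ _ (leq_maxr i j))).
move=> i; have [mFi Fi] := Ffin i; have [mGi Gi] := Gfin i.
have mFG : measurable (F i `*` G i) by exact: measurableX.
split; first by rewrite -[X in measurable X]setTI; exact: measurable_tuncons.
rewrite /mu_next /pushforward (_ : _ @^-1` _ = F i `*` G i).
  by rewrite product_measure1E// lte_mul_pinfty// ge0_fin_numE.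
by apply/seteqP; split=> x; rewrite /preimage /mkset tconsK.
Qed.

HB.instance Definition _ := Measure_isSigmaFinite.Build _ _ _ mu_next mu_next_sigma_finite.

Definition mu_next_sf : {sigma_finite_measure set (k.+1.-tuple R) -> \bar R} :=
  mu_next.
End mu_step.

Definition mu0 : {sigma_finite_measure set (0.-tuple R) -> \bar R} :=
  dirac ([tuple] : 0.-tuple R).

(** The recursion is parallel to that of [iint]: each step pushes a product measure forward to
    tuples, so Fubini and Tonelli identify the iterated integral with an integral against one
    measure, for which the convergence theorems are available. *)
Fixpoint lebT (d : nat) : {sigma_finite_measure set (d.-tuple R) -> \bar R} :=
  match d with 0 => mu0 | k.+1 => mu_next_sf (lebT k) end.

Lemma ge0_integral_mu0 (F : 0.-tuple R -> \bar R) : measurable_fun [set: 0.-tuple R] F ->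
  \int[lebT 0]_t F t = F [tuple].
Proof. by move=> mF; rewrite integral_dirac// diracT mul1e. Qed.

Lemma measurable_tcons2 (k : nat) (F : k.+1.-tuple R -> \bar R) x : measurable_fun setT F ->
  measurable_fun setT (fun t : k.-tuple R => F (cons_tuple x t)).
Proof.
move=> mF; apply: (measurableT_comp mF); apply: measurable_cons => //.
Qed.

Lemma ge0_integral_muS (k : nat) (F : k.+1.-tuple R -> \bar R) :
  measurable_fun setT F -> (forall t, 0 <= F t) ->
  \int[lebT k.+1]_t F t = \int[@lebesgue_measure R]_x \int[lebT k]_t F (cons_tuple x t).
Proof.
move=> mF F0.
rewrite [LHS](@ge0_integral_pushforward _ _ _ _ _ _ (@measurable_tcons k)) //=.
rewrite preimage_setT fubini_tonelli1//.
exact: (measurableT_comp mF (@measurable_tcons k)).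
Qed.

Lemma ge0_integral_muS_swap (k : nat) (F : k.+1.-tuple R -> \bar R) :
  measurable_fun setT F -> (forall t, 0 <= F t) ->
  \int[lebT k.+1]_t F t = \int[lebT k]_t \int[@lebesgue_measure R]_x F (cons_tuple x t).
Proof.
move=> mF F0.
rewrite [LHS](@ge0_integral_pushforward _ _ _ _ _ _ (@measurable_tcons k)) //=.
rewrite preimage_setT fubini_tonelli2//.
exact: (measurableT_comp mF (@measurable_tcons k)).
Qed.

Lemma measurable_ge0_integral_section (k : nat) (F : k.+1.-tuple R -> \bar R) :
  measurable_fun setT F -> (forall t, 0 <= F t) ->
  measurable_fun setT (fun x : RR => \int[lebT k]_t F (cons_tuple x t)).
Proof.
move=> mF F0.
apply: (measurable_fun_fubini_tonelli_F (F \o @tcons k)).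
  exact: (measurableT_comp mF (@measurable_tcons k)).
by move=> x; exact: F0.
Qed.

Lemma integrable_tcons (k : nat) (F : k.+1.-tuple R -> \bar R) :
  (lebT k.+1).-integrable setT F ->
  (@lebesgue_measure R \x lebT k).-integrable setT (F \o @tcons k).
Proof.
move=> iF; have mF := measurable_int _ iF.
apply/integrableP; split; first exact: (measurableT_comp mF (@measurable_tcons k)).
case/integrableP: iF => _.
rewrite (@ge0_integral_pushforward _ _ _ _ _ _ (@measurable_tcons k)) //=.
exact: measurableT_comp.
Qed.

Lemma integral_muS (k : nat) (F : k.+1.-tuple R -> \bar R) :
  (lebT k.+1).-integrable setT F ->
  \int[lebT k.+1]_t F t = \int[@lebesgue_measure R]_x \int[lebT k]_t F (cons_tuple x t).
Proof.
move=> iF.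
have mF := measurable_int _ iF.
have iF' := integrable_tcons iF.
rewrite [LHS](@integral_pushforward _ _ _ _ _ _ (@measurable_tcons k)) //=.
by rewrite preimage_setT -integral12_prod_meas1.
Qed.

(** The parameter space has to vary in the induction, since each step moves one coordinate of the
    tuple into it. The integral of a signed function is by definition a difference of two
    nonnegative ones, each measurable in the parameter by Tonelli. *)
Lemma measurable_iint_param (k : nat) : forall dX (X : measurableType dX)
  (F : X * k.-tuple R -> \bar R), measurable_fun setT F ->
  measurable_fun setT (fun x => iint (fun t => F (x, t))).
Proof.
elim: k => [|k IH] dX X F mF /=.
  apply: (measurableT_comp mF).
  apply/measurable_fun_pairP; split; [exact: measurable_id|exact: measurable_cst].
pose G (p : X * RR) : \bar R := iint (fun t => F (p.1, cons_tuple (p.2 : R) t)).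
have mG : measurable_fun setT G.
  apply: (IH _ _ (fun q : (X * RR) * k.-tuple R =>
      F (q.1.1, cons_tuple (q.1.2 : R) q.2))).
  apply: (measurableT_comp mF); apply/measurable_fun_pairP; split.
    exact: (measurableT_comp measurable_fst measurable_fst).
  apply: measurable_cons; last exact: measurable_snd.
  exact: (measurableT_comp measurable_snd measurable_fst).
rewrite (_ : (fun _ => _) = (fun x => \int[@lebesgue_measure R]_y G^\+ (x, y))
   \- (fun x => \int[@lebesgue_measure R]_y G^\- (x, y))).
  apply: emeasurable_funB.
    by apply: measurable_fun_fubini_tonelli_F => //; exact: measurable_funepos.
  by apply: measurable_fun_fubini_tonelli_F => //; exact: measurable_funeneg.
by apply/funext => x; rewrite [LHS]integralE; congr (_ - _);
  apply: eq_integral => y _; rewrite ?funeposE ?funenegE /G.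
Qed.

Lemma ge0_iintE (k : nat) (F : k.-tuple R -> \bar R) :
  measurable_fun setT F -> (forall t, 0 <= F t) -> iint F = \int[lebT k]_t F t.
Proof.
elim: k F => [|k IH] F mF F0 /=; first by rewrite ge0_integral_mu0.
rewrite ge0_integral_muS//; apply: eq_integral => x _; apply: IH => //.
exact: measurable_tcons2.
Qed.

(** The sections of an integrable function are integrable only for almost every first coordinate, so
    the induction hypothesis gives an almost-everywhere equality of the inner integrals.
    Measurability of [iint] at every parameter then makes the outer integrals equal. *)
Lemma iintE (k : nat) (F : k.-tuple R -> \bar R) :
  (lebT k).-integrable setT F -> iint F = \int[lebT k]_t F t.
Proof.
elim: k F => [|k IH] F iF /=.
  by rewrite ge0_integral_mu0//; exact: (measurable_int _ iF).
have mF := measurable_int _ iF.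
rewrite integral_muS//; apply: ae_eq_integral => //.
- apply: (measurable_iint_param (F := F \o @tcons k)).
  exact: (measurableT_comp mF (@measurable_tcons k)).
- have iF' := integrable_tcons iF.
  exact: (measurable_fubini_F iF').
- have iF' := integrable_tcons iF.
  have := ae_integrable1 iF'; apply: filterS => x ix _.
  exact: IH.
Qed.

End tuple_measure.

(** * Complex-valued integrals *)

Section complex_aux.
Variable R : realType.
Local Notation C := R[i].
Implicit Types x y z : C.

(** The norm of [R[i]] takes its values in [R[i]]; this is the same modulus with values in [R], as
    integration requires. *)
Definition cabs z : R := Num.sqrt (sqmod z).

Lemma complex_ext x y : cRe x = cRe y -> cIm x = cIm y -> x = y.
Proof. by case: x y => a b [c e] /= -> ->. Qed.

Lemma cReD x y : cRe (x + y) = cRe x + cRe y. Proof. by case: x y => a b []. Qed.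
Lemma cImD x y : cIm (x + y) = cIm x + cIm y. Proof. by case: x y => a b []. Qed.
Lemma cReN x : cRe (- x) = - cRe x. Proof. by case: x. Qed.
Lemma cImN x : cIm (- x) = - cIm x. Proof. by case: x. Qed.
Lemma cReB x y : cRe (x - y) = cRe x - cRe y. Proof. by rewrite cReD cReN. Qed.
Lemma cImB x y : cIm (x - y) = cIm x - cIm y. Proof. by rewrite cImD cImN. Qed.
Lemma cReM x y : cRe (x * y) = cRe x * cRe y - cIm x * cIm y.
Proof. by case: x y => a b []. Qed.
Lemma cImM x y : cIm (x * y) = cRe x * cIm y + cIm x * cRe y.
Proof. by case: x y => a b []. Qed.
Lemma cReJ x : cRe (conjc x) = cRe x. Proof. by case: x. Qed.
Lemma cImJ x : cIm (conjc x) = - cIm x. Proof. by case: x. Qed.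
Lemma cReC (a : R) : cRe a%:C = a. Proof. by []. Qed.
Lemma cImC (a : R) : cIm a%:C = 0. Proof. by []. Qed.
Lemma cRe0 : cRe (0 : C) = 0. Proof. by []. Qed.
Lemma cIm0 : cIm (0 : C) = 0. Proof. by []. Qed.
Definition cE := (cReD, cImD, cReN, cImN, cReM, cImM, cReJ, cImJ, cReC, cImC, cRe0, cIm0).

Lemma sqmod_ge0 z : 0 <= sqmod z.
Proof. by rewrite addr_ge0 ?sqr_ge0. Qed.

Lemma sqmodM x y : sqmod (x * y) = sqmod x * sqmod y.
Proof. rewrite /sqmod !cE; ring. Qed.
Lemma sqmodJ x : sqmod (conjc x) = sqmod x.
Proof. rewrite /sqmod !cE; ring. Qed.
Lemma sqmodN x : sqmod (- x) = sqmod x.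
Proof. rewrite /sqmod !cE; ring. Qed.
Lemma sqmodC (a : R) : sqmod a%:C = a ^+ 2.
Proof. rewrite /sqmod !cE; ring. Qed.
Lemma sqmod0 : sqmod (0 : C) = 0. Proof. by rewrite (sqmodC 0) expr0n. Qed.
Lemma mul_conjc z : z * conjc z = (sqmod z)%:C.
Proof. by apply: complex_ext; rewrite /sqmod !cE; ring. Qed.
Lemma cabs_ge0 z : 0 <= cabs z. Proof. exact: sqrtr_ge0. Qed.
Lemma cabs_sqr z : cabs z ^+ 2 = sqmod z. Proof. by rewrite sqr_sqrtr ?sqmod_ge0. Qed.
Lemma cabsM x y : cabs (x * y) = cabs x * cabs y.
Proof. by rewrite /cabs sqmodM sqrtrM ?sqmod_ge0. Qed.
Lemma cabsD x y : cabs (x + y) <= cabs x + cabs y.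
Proof.
have nE z : (cabs z)%:C = `|z| by rewrite normc_def.
by rewrite -lecR rmorphD/= !nE ler_normD.
Qed.
Lemma cabsJ x : cabs (conjc x) = cabs x. Proof. by rewrite /cabs sqmodJ. Qed.
Lemma cabsN x : cabs (- x) = cabs x. Proof. by rewrite /cabs sqmodN. Qed.
Lemma cabsC (a : R) : cabs a%:C = `|a|. Proof. by rewrite /cabs sqmodC sqrtr_sqr. Qed.
Lemma cabs0 : cabs (0 : C) = 0. Proof. by rewrite (cabsC 0) normr0. Qed.
Lemma cabs1 : cabs (1 : C) = 1. Proof. by rewrite (cabsC 1) normr1. Qed.
Lemma cabs_sum (I : Type) (s : seq I) (F : I -> C) :
  cabs (\sum_(i <- s) F i) <= \sum_(i <- s) cabs (F i).
Proof.
elim/big_ind2 : _ => //; first by rewrite cabs0.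
by move=> ? ? ? ? h1 h2; exact: (le_trans (cabsD _ _) (lerD h1 h2)).
Qed.

Lemma normr_cRe z : `|cRe z| <= cabs z.
Proof. by rewrite -sqrtr_sqr ler_sqrt ?sqmod_ge0// lerDl sqr_ge0. Qed.
Lemma normr_cIm z : `|cIm z| <= cabs z.
Proof. by rewrite -sqrtr_sqr ler_sqrt ?sqmod_ge0// lerDr sqr_ge0. Qed.
Lemma cabs_le z : cabs z <= `|cRe z| + `|cIm z|.
Proof.
have h : z = (cRe z)%:C + (0 +i* 1) * (cIm z)%:C.
  by apply: complex_ext; rewrite !cE /=; ring.
rewrite {1}h (le_trans (cabsD _ _))// cabsM !cabsC.
by rewrite /cabs/sqmod/= expr0n/= expr1n add0r sqrtr1 mul1r.
Qed.

Lemma sqmod_le_cabs z (a : R) : cabs z <= a -> sqmod z <= a ^+ 2.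
Proof.
by move=> h; rewrite -cabs_sqr ler_sqr ?nnegrE ?cabs_ge0// (le_trans _ h)// cabs_ge0.
Qed.

Lemma sqmodD_le2 x y : sqmod (x + y) <= 2 * sqmod x + 2 * sqmod y.
Proof.
rewrite /sqmod !cE.
have := sqr_ge0 (cRe x - cRe y); have := sqr_ge0 (cIm x - cIm y); nra.
Qed.

(** The weighted form of the triangle inequality for squares. With [e] small the main term keeps a
    factor close to 1, which the factor 2 of [sqmodD_le2] would spoil in a sharp identity of
    norms. *)
Lemma sqmodD_le x y (e : R) : 0 < e ->
  sqmod (x + y) <= (1 + e) * sqmod x + (1 + e^-1) * sqmod y.
Proof.
move=> e0; rewrite /sqmod !cE.
have h a b : (a + b) ^+ 2 <= (1 + e) * a ^+ 2 + (1 + e^-1) * b ^+ 2.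
  rewrite -subr_ge0 (_ : _ - _ = e * (a - e^-1 * b) ^+ 2).
    by rewrite mulr_ge0 ?sqr_ge0// ltW.
  by field; rewrite gt_eqF.
have := h (cRe x) (cRe y); have := h (cIm x) (cIm y); lra.
Qed.

(** Componentwise, in agreement with [limC], so that real limit theorems apply to each part. *)
Definition ccvg (u : nat -> C) (l : C) : Prop :=
  ((fun n => cRe (u n)) @ \oo --> cRe l) /\ ((fun n => cIm (u n)) @ \oo --> cIm l).

Lemma ccvg_cst z : ccvg (fun=> z) z.
Proof. by split; exact: cvg_cst. Qed.

Lemma ccvgD u v x y : ccvg u x -> ccvg v y -> ccvg (fun n => u n + v n) (x + y).
Proof.
move=> [ux ux'] [vy vy']; split; rewrite cE.
  by under eq_fun do rewrite cReD; exact: cvgD.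
by under eq_fun do rewrite cImD; exact: cvgD.
Qed.

Lemma ccvgM u v x y : ccvg u x -> ccvg v y -> ccvg (fun n => u n * v n) (x * y).
Proof.
move=> [ux ux'] [vy vy']; split; rewrite cE.
  by under eq_fun do rewrite cReM; apply: cvgB; exact: cvgM.
by under eq_fun do rewrite cImM; apply: cvgD; exact: cvgM.
Qed.

Lemma ccvgJ u x : ccvg u x -> ccvg (fun n => conjc (u n)) (conjc x).
Proof.
move=> [ux ux']; split; rewrite cE.
  by under eq_fun do rewrite cReJ.
by under eq_fun do rewrite cImJ; exact: cvgN.
Qed.

Lemma ccvg_sum (I : Type) (s : seq I) (F : I -> nat -> C) (l : I -> C) :
  (forall i, ccvg (F i) (l i)) ->
  ccvg (fun n => \sum_(i <- s) F i n) (\sum_(i <- s) l i).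
Proof.
move=> h; elim: s => [|i s IH].
  rewrite big_nil (_ : (fun n => _) = fun=> 0); first exact: ccvg_cst.
  by apply/funext => n; rewrite big_nil.
rewrite big_cons (_ : (fun n => _) = fun n => F i n + \sum_(j <- s) F j n).
  exact: ccvgD.
by apply/funext => n; rewrite big_cons.
Qed.

Lemma ccvg_sqmod u x : ccvg u x -> (fun n => sqmod (u n)) @ \oo --> sqmod x.
Proof.
move=> [ux ux']; rewrite /sqmod; apply: cvgD.
  by under eq_fun do rewrite expr2; rewrite expr2; exact: cvgM.
by under eq_fun do rewrite expr2; rewrite expr2; exact: cvgM.
Qed.

Lemma ccvg_unique u x y : ccvg u x -> ccvg u y -> x = y.
Proof.
move=> [a b] [a' b']; apply: complex_ext; [exact: (cvg_unique _ a a')|exact: (cvg_unique _ b b')].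
Qed.

Lemma ccvg_limC u x : ccvg u x -> limC u = x.
Proof.
by move=> [a b]; apply: complex_ext; rewrite /limC/=; apply/cvg_lim.
Qed.

Lemma ccvg_le (u : nat -> C) (l : C) (v : nat -> R) :
  (forall n, cabs (u n - l) <= v n) -> v @ \oo --> (0 : R) -> ccvg u l.
Proof.
move=> uv v0; split.
  apply/subr_cvg0; apply: (@squeeze_cvgr _ _ _ _ (fun n => - v n) v) => //.
    apply: nearW => n; rewrite -ler_norml (le_trans _ (uv n))//.
    by rewrite -cReB normr_cRe.
  by rewrite -oppr0; exact: cvgN.
apply/subr_cvg0; apply: (@squeeze_cvgr _ _ _ _ (fun n => - v n) v) => //.
  apply: nearW => n; rewrite -ler_norml (le_trans _ (uv n))//.
  by rewrite -cImB normr_cIm.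
by rewrite -oppr0; exact: cvgN.
Qed.

Lemma ccvg_cabs (u : nat -> C) (l : C) : ccvg u l ->
  (fun n => cabs (u n - l)) @ \oo --> (0 : R).
Proof.
move=> [ul ul'].
apply: (@squeeze_cvgr _ _ _ _ (fun=> 0)
   (fun n => `|cRe (u n) - cRe l| + `|cIm (u n) - cIm l|)).
- by apply: nearW => n; rewrite cabs_ge0/= (le_trans (cabs_le _))// cReB cImB.
- exact: cvg_cst.
- rewrite -[X in _ --> X]addr0; apply: cvgD.
    by rewrite -(normr0 R); apply: cvg_norm; apply/subr_cvg0.
  by rewrite -(normr0 R); apply: cvg_norm; apply/subr_cvg0.
Qed.

Lemma ccvg_shift u l : ccvg u l -> ccvg (fun n => u n.+1) l.
Proof.
move=> [a b]; split.
  by rewrite (cvg_shiftS (fun n => cRe (u n))).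
by rewrite (cvg_shiftS (fun n => cIm (u n))).
Qed.

End complex_aux.

Section cint.
Context dT (T : measurableType dT) (R : realType) (mu : {measure set T -> \bar R}).
Local Notation C := R[i].
Implicit Types f g : T -> C.

Definition cmeas f : Prop :=
  measurable_fun setT (fun t => cRe (f t)) /\ measurable_fun setT (fun t => cIm (f t)).

Definition cintegrable f : Prop :=
  mu.-integrable setT (fun t => (cRe (f t))%:E) /\
  mu.-integrable setT (fun t => (cIm (f t))%:E).

Definition cint f : C :=
  (fine (\int[mu]_t (cRe (f t))%:E)%E) +i* (fine (\int[mu]_t (cIm (f t))%:E)%E).

Lemma cmeasD f g : cmeas f -> cmeas g -> cmeas (fun t => f t + g t).
Proof.
move=> [a b] [a' b']; split.
  by under eq_fun do rewrite cReD; exact: measurable_funD.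
by under eq_fun do rewrite cImD; exact: measurable_funD.
Qed.

Lemma cmeasM f g : cmeas f -> cmeas g -> cmeas (fun t => f t * g t).
Proof.
move=> [a b] [a' b']; split.
  by under eq_fun do rewrite cReM; apply: measurable_funB; exact: measurable_funM.
by under eq_fun do rewrite cImM; apply: measurable_funD; exact: measurable_funM.
Qed.

Lemma cmeas_cst (c : C) : cmeas (fun=> c).
Proof. by split; exact: measurable_cst. Qed.

Lemma cmeasJ f : cmeas f -> cmeas (fun t => conjc (f t)).
Proof.
move=> [a b]; split; first by under eq_fun do rewrite cReJ.
by under eq_fun do rewrite cImJ; exact: measurableT_comp.
Qed.

Lemma cmeasN f : cmeas f -> cmeas (fun t => - f t).
Proof.
move=> [a b]; split; first by under eq_fun do rewrite cReN; exact: measurableT_comp.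
by under eq_fun do rewrite cImN; exact: measurableT_comp.
Qed.

Lemma cmeasB f g : cmeas f -> cmeas g -> cmeas (fun t => f t - g t).
Proof. by move=> mf mg; apply: cmeasD => //; exact: cmeasN. Qed.

Lemma cmeasC (u : T -> R) : measurable_fun setT u -> cmeas (fun t => (u t)%:C).
Proof. by move=> mu_; split => //=; exact: measurable_cst. Qed.

Lemma cmeas_sum (I : Type) (s : seq I) (F : I -> T -> C) :
  (forall i, cmeas (F i)) -> cmeas (fun t => \sum_(i <- s) F i t).
Proof.
move=> h; elim: s => [|i s IH].
  by under eq_fun do rewrite big_nil; exact: cmeas_cst.
by under eq_fun do rewrite big_cons; exact: cmeasD.
Qed.

Lemma cmeas_expi (u : T -> R) : measurable_fun setT u -> cmeas (fun t => expi (u t)).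
Proof.
move=> mu_; split => /=; apply: measurableT_comp mu_; apply: continuous_measurable_fun.
  exact: continuous_cos.
exact: continuous_sin.
Qed.

Lemma measurable_sqmod f : cmeas f -> measurable_fun setT (fun t => sqmod (f t)).
Proof. by move=> [a b]; apply: measurable_funD; exact: measurable_funX. Qed.

Lemma measurable_cabs f : cmeas f -> measurable_fun setT (fun t => cabs (f t)).
Proof.
move=> mf; apply: (measurableT_comp _ (measurable_sqmod mf)).
apply: continuous_measurable_fun; exact: sqrt_continuous.
Qed.

Lemma cintegrable_cmeas f : cintegrable f -> cmeas f.
Proof.
by move=> [a b]; split; apply/measurable_EFinP; [exact: (measurable_int _ a)|exact: (measurable_int _ b)].
Qed.

Lemma cintegrable_le f (g : T -> R) : cmeas f -> mu.-integrable setT (fun t => (g t)%:E) ->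
  (forall t, cabs (f t) <= g t) -> cintegrable f.
Proof.
move=> [a b] ig fg; split; apply: (le_integrable measurableT _ _ ig);
  try exact/measurable_EFinP.
  move=> t _ /=; rewrite lee_fin (le_trans (normr_cRe _))// (le_trans (fg t))//.
  exact: ler_norm.
move=> t _ /=; rewrite lee_fin (le_trans (normr_cIm _))// (le_trans (fg t))//.
exact: ler_norm.
Qed.

Lemma cintegrable_cabs f : cintegrable f -> mu.-integrable setT (fun t => (cabs (f t))%:E).
Proof.
move=> cf; have [a b] := cf.
have ab : mu.-integrable setT (fun t => (`|cRe (f t)| + `|cIm (f t)|)%:E).
  under eq_fun do rewrite EFinD.
  by apply: integrableD => //; [exact: (integrable_abse a)|exact: (integrable_abse b)].
apply: (le_integrable measurableT _ _ ab).
  apply/measurable_EFinP; exact: measurable_cabs (cintegrable_cmeas cf).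
move=> t _ /=; rewrite lee_fin ger0_norm ?cabs_ge0// (le_trans (cabs_le _))//.
exact: ler_norm.
Qed.

Lemma cintegrable_lty f : cmeas f -> (\int[mu]_t (cabs (f t))%:E < +oo)%E -> cintegrable f.
Proof.
move=> mf h; apply: (@cintegrable_le _ (fun t => cabs (f t))) => //.
apply/integrableP; split; first exact/measurable_EFinP/measurable_cabs.
rewrite (eq_integral (fun t => (cabs (f t))%:E))// => t _ /=.
by rewrite ger0_norm ?cabs_ge0.
Qed.

Lemma cintegrableD f g : cintegrable f -> cintegrable g ->
  cintegrable (fun t => f t + g t).
Proof.
move=> [a b] [a' b']; split.
  by under eq_fun do rewrite cReD EFinD; exact: integrableD.
by under eq_fun do rewrite cImD EFinD; exact: integrableD.
Qed.

Lemma cintegrableZ (c : C) f : cintegrable f -> cintegrable (fun t => c * f t).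
Proof.
move=> cf; apply: (@cintegrable_le _ (fun t => cabs c * cabs (f t))).
- by apply: cmeasM; [exact: cmeas_cst|exact: cintegrable_cmeas].
- under eq_fun do rewrite EFinM.
  by apply: integrableZl => //; exact: cintegrable_cabs.
- by move=> t; rewrite cabsM.
Qed.

Lemma cintegrable0 : cintegrable (fun=> 0).
Proof. by split; exact: integrable0. Qed.

Lemma cintegrable_sum (I : Type) (s : seq I) (F : I -> T -> C) :
  (forall i, cintegrable (F i)) -> cintegrable (fun t => \sum_(i <- s) F i t).
Proof.
move=> h; elim: s => [|i s IH].
  by under eq_fun do rewrite big_nil; exact: cintegrable0.
by under eq_fun do rewrite big_cons; exact: cintegrableD.
Qed.

Lemma cintD f g : cintegrable f -> cintegrable g ->
  cint (fun t => f t + g t) = cint f + cint g.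
Proof.
move=> [a b] [a' b']; apply: complex_ext; rewrite cE /=.
  under eq_integral do rewrite cReD EFinD.
  by rewrite integralD// fineD// integrable_fin_num.
under eq_integral do rewrite cImD EFinD.
by rewrite integralD// fineD// integrable_fin_num.
Qed.

Lemma cintZ (c : C) f : cintegrable f -> cint (fun t => c * f t) = c * cint f.
Proof.
move=> [a b]; have fa := integrable_fin_num measurableT a.
have fb := integrable_fin_num measurableT b.
apply: complex_ext; rewrite !cE/=.
  under eq_integral do rewrite cReM EFinB !EFinM.
  rewrite integralB//; [|exact: integrableZl|exact: integrableZl].
  by rewrite !integralZl// fineB ?fin_numM// !fineM.
under eq_integral do rewrite cImM EFinD !EFinM.
rewrite integralD//; [|exact: integrableZl|exact: integrableZl].
by rewrite !integralZl// fineD ?fin_numM// !fineM.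
Qed.

Lemma cint0 : cint (fun=> 0) = 0.
Proof. by apply: complex_ext => /=; rewrite integral0. Qed.

Lemma cint_sum (I : Type) (s : seq I) (F : I -> T -> C) :
  (forall i, cintegrable (F i)) ->
  cint (fun t => \sum_(i <- s) F i t) = \sum_(i <- s) cint (F i).
Proof.
move=> h; elim: s => [|i s IH].
  transitivity (cint (fun=> 0)); last by rewrite big_nil cint0.
  by congr cint; apply/funext => t; rewrite big_nil.
rewrite big_cons -IH -cintD//; last exact: cintegrable_sum.
by congr cint; apply/funext => t; rewrite big_cons.
Qed.

Lemma cintB f g : cintegrable f -> cintegrable g ->
  cint (fun t => f t - g t) = cint f - cint g.
Proof.
move=> cf cg; rewrite -mulN1r -cintZ// -cintD//; last exact: cintegrableZ.
by congr cint; apply/funext => t; rewrite mulN1r.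
Qed.

Lemma cintegrableB f g : cintegrable f -> cintegrable g ->
  cintegrable (fun t => f t - g t).
Proof.
move=> cf cg; rewrite (_ : (fun t => _) = fun t => f t + (- 1) * g t).
  by apply: cintegrableD => //; exact: cintegrableZ.
by apply/funext => t; rewrite mulN1r.
Qed.

Lemma cintJ f : cintegrable f -> cint (fun t => conjc (f t)) = conjc (cint f).
Proof.
move=> [a b]; apply: complex_ext; rewrite cE /=.
  by congr fine; apply: eq_integral => t _; rewrite cReJ.
under eq_integral do rewrite cImJ -mulN1r EFinM.
rewrite integralZl// fineM// ?mulN1r//; exact: (integrable_fin_num measurableT b).
Qed.

Lemma cintegrableJ f : cintegrable f -> cintegrable (fun t => conjc (f t)).
Proof.
move=> cf; apply: (@cintegrable_le _ (fun t => cabs (f t))).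
- exact/cmeasJ/cintegrable_cmeas.
- exact: cintegrable_cabs.
- by move=> t; rewrite cabsJ.
Qed.

(* Rotate so that the integral becomes a nonnegative real. *)
Lemma cabs_cint f : cintegrable f -> cabs (cint f) <= fine (\int[mu]_t (cabs (f t))%:E)%E.
Proof.
move=> cf; have icabs := cintegrable_cabs cf.
have icf : 0 <= fine (\int[mu]_t (cabs (f t))%:E)%E.
  by rewrite fine_ge0// integral_ge0// => t _; rewrite lee_fin cabs_ge0.
have [->|c0] := eqVneq (cabs (cint f)) 0; first by [].
have cp : 0 < cabs (cint f) by rewrite lt_neqAle eq_sym c0 cabs_ge0.
rewrite -(ler_pM2l cp) -expr2 cabs_sqr.
have [a _] := cintegrableZ (conjc (cint f)) cf.
have -> : sqmod (cint f) = fine (\int[mu]_t (cRe (conjc (cint f) * f t))%:E)%E.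
  transitivity (cRe (cint (fun t => conjc (cint f) * f t))); last by [].
  by rewrite cintZ// mulrC mul_conjc.
rewrite -[X in X * _]/(fine (cabs (cint f))%:E) -fineM//; last first.
  exact: integrable_fin_num.
rewrite -integralZl//; apply: fine_le.
- exact: integrable_fin_num.
- by apply: integrable_fin_num => //; exact: integrableZl.
apply: le_integral => //; first exact: integrableZl.
move=> t _; rewrite lee_fin (le_trans (ler_norm _))// (le_trans (normr_cRe _))//.
by rewrite cabsM cabsJ.
Qed.

Lemma cint_dominated (f_ : nat -> T -> C) f (g : T -> R) :
  (forall n, cmeas (f_ n)) -> cmeas f ->
  (forall t, ccvg (fun n => f_ n t) (f t)) ->
  mu.-integrable setT (fun t => (g t)%:E) ->
  (forall n t, cabs (f_ n t) <= g t) ->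
  ccvg (fun n => cint (f_ n)) (cint f).
Proof.
move=> mf_ mf ff ig fg.
have key (p : C -> R) : (forall z, `|p z| <= cabs z) ->
   (forall n, measurable_fun setT (fun t => p (f_ n t))) ->
   measurable_fun setT (fun t => p (f t)) ->
   (forall t, (fun n => p (f_ n t)) @ \oo --> p (f t)) ->
   (fun n => fine (\int[mu]_t (p (f_ n t))%:E)%E) @ \oo --> fine (\int[mu]_t (p (f t))%:E)%E.
  move=> pa m1 m2 cv.
  have [|||||i _ c] := @dominated_convergence _ _ _ mu setT measurableT
    (fun n t => (p (f_ n t))%:E) (fun t => (p (f t))%:E) (fun t => (g t)%:E).
  - by move=> n; apply/measurable_EFinP.
  - exact/measurable_EFinP.
  - by apply: aeW => t _; apply/fine_cvgP; split; [exact: nearW|exact: cv].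
  - exact: ig.
  - by apply: aeW => t n _; rewrite lee_fin (le_trans (pa _)).
  apply: fine_cvg.
  by rewrite fineK//; exact: integrable_fin_num.
split.
- apply: key => //; [exact: normr_cRe|by move=> n; case: (mf_ n)|by case: mf|by move=> t; case: (ff t)].
- apply: key => //; [exact: normr_cIm|by move=> n; case: (mf_ n)|by case: mf|by move=> t; case: (ff t)].
Qed.

End cint.

(** * Square-integrable functions *)

(** The optimal weight is l = x / a, which equals the two sides of the arithmetic-geometric
    inequality up to the claim. Only a = 0 needs another choice. *)
Lemma quad_disc (R : realFieldType) (x a b : R) : 0 <= x -> 0 <= a -> 0 <= b ->
  (forall l, 0 < l -> 2 * x <= l * a + l^-1 * b) -> x ^+ 2 <= a * b.
Proof.
move=> x0 a0 b0 h.
have [->|xn0] := eqVneq x 0; first by rewrite expr0n/= mulr_ge0.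
have xp : 0 < x by rewrite lt_neqAle eq_sym xn0.
have [a00|an0] := eqVneq a 0.
  (* At this weight the hypothesis with a = 0 reads 2x <= x b / (b + 1), which is impossible for x >
     0. *)
  have l0 : 0 < (b + 1) / x by rewrite divr_gt0// ltr_wpDl.
  have := h _ l0; rewrite a00 mulr0 add0r invf_div mulrAC.
  rewrite ler_pdivlMr; last by rewrite ltr_wpDl.
  by move=> H; exfalso; nra.
have ap : 0 < a by rewrite lt_neqAle eq_sym an0.
have l0 : 0 < x / a by rewrite divr_gt0.
have := h _ l0; rewrite divfK ?gt_eqF// invf_div => H.
have : x <= a * b / x by move: H; rewrite mulrAC; lra.
by rewrite ler_pdivlMr// -expr2.
Qed.

Section dominated_real.
Context dT (T : measurableType dT) (R : realType) (mu : {measure set T -> \bar R}).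

Lemma fine_integral_dominated (f_ : nat -> T -> R) (f g : T -> R) :
  (forall n, measurable_fun setT (f_ n)) -> measurable_fun setT f ->
  {ae mu, forall t, (fun n => f_ n t) @ \oo --> f t} ->
  mu.-integrable setT (fun t => (g t)%:E) ->
  (forall n t, `|f_ n t| <= g t) ->
  (fun n => fine (\int[mu]_t (f_ n t)%:E)%E) @ \oo --> fine (\int[mu]_t (f t)%:E)%E.
Proof.
move=> m1 m2 cv ig fg.
have [|||||i _ c] := @dominated_convergence _ _ _ mu setT measurableT
  (fun n t => (f_ n t)%:E) (fun t => (f t)%:E) (fun t => (g t)%:E).
- by move=> n; apply/measurable_EFinP.
- exact/measurable_EFinP.
- by apply: filterS cv => t cv _; apply/fine_cvgP; split; [exact: nearW|exact: cv].
- exact: ig.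
- by apply: aeW => t n _; rewrite lee_fin.
apply: fine_cvg.
by rewrite fineK//; exact: integrable_fin_num.
Qed.

End dominated_real.

Section l2.
Context dT (T : measurableType dT) (R : realType) (mu : {measure set T -> \bar R}).
Local Notation C := R[i].
Implicit Types f g : T -> C.

Definition nsq f : \bar R := (\int[mu]_t (sqmod (f t))%:E)%E.
Definition l2 f : Prop := cmeas f /\ (nsq f < +oo)%E.
Definition nr f : R := fine (nsq f).
Definition cip f g : C := cint mu (fun t => f t * conjc (g t)).

Lemma nsq_ge0 f : (0 <= nsq f)%E.
Proof. by apply: integral_ge0 => t _; rewrite lee_fin sqmod_ge0. Qed.

Lemma nr_ge0 f : 0 <= nr f. Proof. exact: fine_ge0 (nsq_ge0 f). Qed.

Lemma nsqE f : l2 f -> nsq f = (nr f)%:E.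
Proof. by move=> [_ h]; rewrite /nr fineK// ge0_fin_numE// nsq_ge0. Qed.

Lemma l2_integrable f : l2 f -> mu.-integrable setT (fun t => (sqmod (f t))%:E).
Proof.
move=> [mf h]; apply/integrableP; split; first exact/measurable_EFinP/measurable_sqmod.
rewrite (eq_integral (fun t => (sqmod (f t))%:E))// => t _ /=.
by rewrite ger0_norm ?sqmod_ge0.
Qed.

Lemma l2_le f (g : T -> R) : cmeas f -> mu.-integrable setT (fun t => (g t)%:E) ->
  (forall t, sqmod (f t) <= g t) -> l2 f /\ nr f <= fine (\int[mu]_t (g t)%:E)%E.
Proof.
move=> mf ig fg.
have mg : measurable_fun setT (fun t => (g t)%:E) := measurable_int _ ig.
have g0 t : 0 <= g t := le_trans (sqmod_ge0 _) (fg t).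
have le : (nsq f <= \int[mu]_t (g t)%:E)%E.
  apply: ge0_le_integral => //.
  - by move=> t _; rewrite lee_fin sqmod_ge0.
  - exact/measurable_EFinP/measurable_sqmod.
  - by move=> t _; rewrite lee_fin.
have lty : (\int[mu]_t (g t)%:E < +oo)%E.
  by have := integrable_fin_num measurableT ig; rewrite ge0_fin_numE ?(le_trans (nsq_ge0 f)).
have l2f : l2 f by split => //; exact: le_lt_trans lty.
split => //; apply: fine_le => //.
  by rewrite nsqE.
exact: integrable_fin_num.
Qed.

Lemma l2_le_fun f g : cmeas f -> l2 g -> (forall t, sqmod (f t) <= sqmod (g t)) ->
  l2 f /\ nr f <= nr g.
Proof. by move=> mf /l2_integrable; exact: l2_le. Qed.

Lemma l2D f g : l2 f -> l2 g -> l2 (fun t => f t + g t).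
Proof.
move=> lf lg; have i1 := l2_integrable lf; have i2 := l2_integrable lg.
apply: (proj1 (@l2_le _ (fun t => 2 * sqmod (f t) + 2 * sqmod (g t)) _ _ _)).
- by apply: cmeasD; [case: lf|case: lg].
- under eq_fun do rewrite EFinD !EFinM.
  by apply: integrableD => //; exact: integrableZl.
- by move=> t; exact: sqmodD_le2.
Qed.

Lemma l2Z c f : l2 f -> l2 (fun t => c * f t).
Proof.
move=> lf; have i1 := l2_integrable lf.
apply: (proj1 (@l2_le _ (fun t => sqmod c * sqmod (f t)) _ _ _)).
- by apply: cmeasM; [exact: cmeas_cst|case: lf].
- by under eq_fun do rewrite EFinM; exact: integrableZl.
- by move=> t; rewrite sqmodM.
Qed.

Lemma l2N f : l2 f -> l2 (fun t => - f t).
Proof.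
by move=> /(l2Z (-1)); congr l2; apply/funext => t; rewrite mulN1r.
Qed.

Lemma l2B f g : l2 f -> l2 g -> l2 (fun t => f t - g t).
Proof. by move=> lf lg; apply: l2D => //; exact: l2N. Qed.

Lemma l20 : l2 (fun=> 0).
Proof.
split; first exact: cmeas_cst.
by rewrite /nsq; under eq_integral do rewrite sqmod0; rewrite integral0 ltry.
Qed.

Lemma l2_sum (I : Type) (s : seq I) (F : I -> T -> C) :
  (forall i, l2 (F i)) -> l2 (fun t => \sum_(i <- s) F i t).
Proof.
move=> h; elim: s => [|i s IH].
  by under eq_fun do rewrite big_nil; exact: l20.
by under eq_fun do rewrite big_cons; exact: l2D.
Qed.

Lemma nrZ c f : l2 f -> nr (fun t => c * f t) = sqmod c * nr f.
Proof.
move=> lf; have i1 := l2_integrable lf; rewrite /nr /nsq.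
under eq_integral do rewrite sqmodM EFinM.
by rewrite integralZl// fineM// integrable_fin_num.
Qed.

Lemma nrN f : nr (fun t => - f t) = nr f.
Proof. by congr fine; apply: eq_integral => t _; rewrite sqmodN. Qed.

Lemma nr_subC f g : nr (fun t => f t - g t) = nr (fun t => g t - f t).
Proof. by rewrite -nrN; congr nr; apply/funext => t; rewrite opprB. Qed.

Lemma nr0 : nr (fun=> 0) = 0.
Proof. by rewrite /nr /nsq; under eq_integral do rewrite sqmod0; rewrite integral0. Qed.

Lemma nrD_le f g e : 0 < e -> l2 f -> l2 g ->
  nr (fun t => f t + g t) <= (1 + e) * nr f + (1 + e^-1) * nr g.
Proof.
move=> e0 lf lg; have i1 := l2_integrable lf; have i2 := l2_integrable lg.
have ig : mu.-integrable setT (fun t => ((1 + e) * sqmod (f t) + (1 + e^-1) * sqmod (g t))%:E).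
  under eq_fun do rewrite EFinD !EFinM.
  by apply: integrableD => //; exact: integrableZl.
have [] := @l2_le (fun t => f t + g t)
  (fun t => (1 + e) * sqmod (f t) + (1 + e^-1) * sqmod (g t)) _ ig.
- by apply: cmeasD; [case: lf|case: lg].
- by move=> t; exact: sqmodD_le.
move=> _ /le_trans; apply.
under eq_integral do rewrite EFinD !EFinM.
rewrite integralD//; [|exact: integrableZl|exact: integrableZl].
rewrite !integralZl// fineD ?fin_numM ?integrable_fin_num//.
by rewrite !fineM// integrable_fin_num.
Qed.

Lemma nrD_le2 f g : l2 f -> l2 g ->
  nr (fun t => f t + g t) <= 2 * nr f + 2 * nr g.
Proof. by move=> lf lg; have := nrD_le ltr01 lf lg; rewrite invr1. Qed.

Lemma cip_integrable f g : l2 f -> l2 g -> cintegrable mu (fun t => f t * conjc (g t)).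
Proof.
move=> lf lg; have i1 := l2_integrable lf; have i2 := l2_integrable lg.
apply: (@cintegrable_le _ _ _ _ _ (fun t => sqmod (f t) + sqmod (g t))).
- by apply: cmeasM; [case: lf|apply: cmeasJ; case: lg].
- by under eq_fun do rewrite EFinD; exact: integrableD.
- move=> t; rewrite cabsM cabsJ -!cabs_sqr.
  have := sqr_ge0 (cabs (f t) - cabs (g t)).
  have := sqr_ge0 (cabs (f t)); have := sqr_ge0 (cabs (g t)); nra.
Qed.

Lemma cipBl f1 f2 g : l2 f1 -> l2 f2 -> l2 g ->
  cip (fun t => f1 t - f2 t) g = cip f1 g - cip f2 g.
Proof.
move=> l1 l2_ lg; rewrite /cip -cintB; try exact: cip_integrable.
by congr cint; apply/funext => t; rewrite mulrBl.
Qed.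

Lemma cipBr f g1 g2 : l2 f -> l2 g1 -> l2 g2 ->
  cip f (fun t => g1 t - g2 t) = cip f g1 - cip f g2.
Proof.
move=> l1 l2_ lg; rewrite /cip -cintB; try exact: cip_integrable.
by congr cint; apply/funext => t; rewrite rmorphB mulrBr.
Qed.

Lemma cipDr f g1 g2 : l2 f -> l2 g1 -> l2 g2 ->
  cip f (fun t => g1 t + g2 t) = cip f g1 + cip f g2.
Proof.
move=> l1 l2_ lg; rewrite /cip -cintD; try exact: cip_integrable.
by congr cint; apply/funext => t; rewrite rmorphD mulrDr.
Qed.

Lemma cipZr c f g : l2 f -> l2 g -> cip f (fun t => c * g t) = conjc c * cip f g.
Proof.
move=> lf lg; rewrite /cip -cintZ; last exact: cip_integrable.
by congr cint; apply/funext => t; rewrite rmorphM mulrCA.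
Qed.

Lemma cipZl c f g : l2 f -> l2 g -> cip (fun t => c * f t) g = c * cip f g.
Proof.
move=> lf lg; rewrite /cip -cintZ; last exact: cip_integrable.
by congr cint; apply/funext => t; rewrite mulrA.
Qed.

Lemma cip_sumr (I : Type) (s : seq I) f (F : I -> T -> C) :
  l2 f -> (forall i, l2 (F i)) ->
  cip f (fun t => \sum_(i <- s) F i t) = \sum_(i <- s) cip f (F i).
Proof.
move=> lf h; rewrite /cip -cint_sum; last by move=> i; exact: cip_integrable.
by congr cint; apply/funext => t; rewrite rmorph_sum mulr_sumr.
Qed.

Lemma cip_suml (I : Type) (s : seq I) f (F : I -> T -> C) :
  l2 f -> (forall i, l2 (F i)) ->
  cip (fun t => \sum_(i <- s) F i t) f = \sum_(i <- s) cip (F i) f.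
Proof.
move=> lf h; rewrite /cip -cint_sum; last by move=> i; exact: cip_integrable.
by congr cint; apply/funext => t; rewrite mulr_suml.
Qed.

Lemma cipJ f g : l2 f -> l2 g -> cip g f = conjc (cip f g).
Proof.
move=> lf lg; rewrite /cip -cintJ; last exact: cip_integrable.
by congr cint; apply/funext => t; rewrite rmorphM/= conjcK mulrC.
Qed.

Lemma cip_self f : l2 f -> cip f f = (nr f)%:C.
Proof.
move=> lf; apply: complex_ext => /=; rewrite /nr /nsq.
  by congr fine; apply: eq_integral => t _; rewrite mul_conjc.
rewrite (eq_integral (fun=> 0%E)) ?integral0// => t _.
by rewrite mul_conjc.
Qed.

(** Integrating 2 |f g| <= l |f|^2 + l^-1 |g|^2 pointwise gives a bound for every weight l > 0, and
    [quad_disc] optimises it. *)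
Lemma cauchy_schwarz f g : l2 f -> l2 g -> sqmod (cip f g) <= nr f * nr g.
Proof.
move=> lf lg; have i1 := l2_integrable lf; have i2 := l2_integrable lg.
rewrite -cabs_sqr; apply: quad_disc; rewrite ?cabs_ge0 ?nr_ge0// => l l0.
have := cabs_cint (cip_integrable lf lg) => h.
have ig : mu.-integrable setT (fun t => ((l * sqmod (f t) + l^-1 * sqmod (g t)) / 2)%:E).
  under eq_fun do rewrite mulrC EFinM EFinD !EFinM.
  by apply: integrableZl => //; apply: integrableD => //; exact: integrableZl.
have le : fine (\int[mu]_t (cabs (f t * conjc (g t)))%:E)%E <=
          fine (\int[mu]_t ((l * sqmod (f t) + l^-1 * sqmod (g t)) / 2)%:E)%E.
  apply: fine_le.
  - by apply: integrable_fin_num => //; exact: cintegrable_cabs (cip_integrable lf lg).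
  - exact: integrable_fin_num.
  apply: le_integral => //; first exact: cintegrable_cabs (cip_integrable lf lg).
  move=> t _; rewrite lee_fin cabsM cabsJ -!cabs_sqr ler_pdivlMr//.
  rewrite -subr_ge0 (_ : _ - _ = l^-1 * (l * cabs (f t) - cabs (g t)) ^+ 2).
    by rewrite mulr_ge0 ?sqr_ge0// invr_ge0 ltW.
  by field; rewrite gt_eqF.
have e : fine (\int[mu]_t ((l * sqmod (f t) + l^-1 * sqmod (g t)) / 2)%:E)%E =
   (l * nr f + l^-1 * nr g) / 2.
  under eq_integral do rewrite mulrC EFinM EFinD !EFinM.
  rewrite integralZl//; last by apply: integrableD => //; exact: integrableZl.
  rewrite integralD//; [|exact: integrableZl|exact: integrableZl].
  rewrite !integralZl// fineM ?fin_numD ?fin_numM ?integrable_fin_num//.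
  rewrite fineD ?fin_numM ?integrable_fin_num// !fineM ?integrable_fin_num//=.
  by rewrite mulrC.
rewrite e in le; have := le_trans h le.
by rewrite -/(cip f g) ler_pdivlMr// mulrC.
Qed.

Lemma cabs_cip_le f g : l2 f -> l2 g -> cabs (cip f g) <= Num.sqrt (nr f) * Num.sqrt (nr g).
Proof.
move=> lf lg; rewrite -sqrtrM ?nr_ge0// /cabs ler_sqrt; first exact: cauchy_schwarz.
by rewrite mulr_ge0 ?nr_ge0.
Qed.

Lemma ccvg_cip_l (u : nat -> T -> C) f g : (forall n, l2 (u n)) -> l2 f -> l2 g ->
  (fun n => nr (fun t => u n t - f t)) @ \oo --> (0 : R) ->
  ccvg (fun n => cip (u n) g) (cip f g).
Proof.
move=> lu lf lg h.
apply: (@ccvg_le _ _ _ (fun n => Num.sqrt (nr (fun t => u n t - f t)) * Num.sqrt (nr g))).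
  by move=> n; rewrite -cipBl// cabs_cip_le//; exact: l2B.
rewrite -[X in _ --> X](mul0r (Num.sqrt (nr g))); apply: cvgMr_tmp => //.
rewrite -(@sqrtr0 R); apply: (cvg_comp _ _ h); exact: sqrt_continuous.
Qed.

Lemma nr_cvg (u : nat -> T -> C) f (g : T -> R) :
  (forall n, cmeas (u n)) -> cmeas f ->
  {ae mu, forall t, ccvg (fun n => u n t) (f t)} ->
  mu.-integrable setT (fun t => (g t)%:E) ->
  (forall n t, sqmod (u n t - f t) <= g t) ->
  (fun n => nr (fun t => u n t - f t)) @ \oo --> (0 : R).
Proof.
move=> mu_ mf cv ig le.
rewrite -[X in _ --> X](_ : fine (\int[mu]_(t in setT) (0 : R)%:E)%E = 0); last first.
  by rewrite integral0.
apply: (@fine_integral_dominated _ _ _ _ (fun n t => sqmod (u n t - f t)) (fun=> 0) g) => //.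
- by move=> n; apply: measurable_sqmod; exact: cmeasB.
- apply: filterS cv => t cvt.
  have := ccvg_sqmod (ccvgD cvt (ccvg_cst (- f t))).
  by rewrite subrr sqmod0.
- by move=> n t; rewrite ger0_norm ?sqmod_ge0.
Qed.

End l2.

(** * Linear changes of variables *)

Section cfubini.
Context d1 d2 (T1 : measurableType d1) (T2 : measurableType d2) (R : realType).
Variable m1 : {sigma_finite_measure set T1 -> \bar R}.
Variable m2 : {sigma_finite_measure set T2 -> \bar R}.
Local Open Scope ereal_scope.

Lemma fine_integral_prod1 (f : T1 * T2 -> R) :
  (m1 \x m2).-integrable setT (fun z => (f z)%:E) ->
  \int[m1 \x m2]_z (f z)%:E = \int[m1]_x (fine (\int[m2]_y (f (x, y))%:E))%:E.
Proof.
move=> fi; rewrite -integral12_prod_meas1//; apply: ae_eq_integral => //.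
- exact: (measurable_fubini_F fi).
- apply/measurable_EFinP; apply: measurableT_comp => //.
  exact: (measurable_fubini_F fi).
- apply: filterS (ae_integrable1 fi) => x fx _.
  by rewrite fineK//; exact: integrable_fin_num.
Qed.

Lemma fine_integral_prod2 (f : T1 * T2 -> R) :
  (m1 \x m2).-integrable setT (fun z => (f z)%:E) ->
  \int[m1 \x m2]_z (f z)%:E = \int[m2]_y (fine (\int[m1]_x (f (x, y))%:E))%:E.
Proof.
move=> fi; rewrite -integral21_prod_meas1//; apply: ae_eq_integral => //.
- exact: (measurable_fubini_G fi).
- apply/measurable_EFinP; apply: measurableT_comp => //.
  exact: (measurable_fubini_G fi).
- apply: filterS (ae_integrable2 fi) => x fx _.
  by rewrite fineK//; exact: integrable_fin_num.
Qed.

Lemma cint_prod1 (G : T1 * T2 -> R[i]) : cintegrable (m1 \x m2) G ->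
  cint (m1 \x m2) G = cint m1 (fun x => cint m2 (fun y => G (x, y))).
Proof.
move=> [a b]; apply: complex_ext => /=.
  by rewrite (fine_integral_prod1 a).
by rewrite (fine_integral_prod1 b).
Qed.

Lemma cint_prod2 (G : T1 * T2 -> R[i]) : cintegrable (m1 \x m2) G ->
  cint (m1 \x m2) G = cint m2 (fun y => cint m1 (fun x => G (x, y))).
Proof.
move=> [a b]; apply: complex_ext => /=.
  by rewrite (fine_integral_prod2 a).
by rewrite (fine_integral_prod2 b).
Qed.

Lemma cintegrable_prod (G : T1 * T2 -> R[i]) : cmeas G ->
  \int[m1]_x \int[m2]_y (cabs (G (x, y)))%:E < +oo -> cintegrable (m1 \x m2) G.
Proof.
move=> mG h; apply: cintegrable_lty => //.
rewrite fubini_tonelli1//; last by move=> z; rewrite lee_fin cabs_ge0.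
exact/measurable_EFinP/measurable_cabs.
Qed.

Lemma cintegrable_prod_le (G : T1 * T2 -> R[i]) (u : T1 -> R) (v : T2 -> R) :
  cmeas G -> (forall x y, (cabs (G (x, y)) <= u x * v y)%R) ->
  (forall x, (0 <= u x)%R) -> (forall y, (0 <= v y)%R) ->
  m1.-integrable setT (fun x => (u x)%:E) -> m2.-integrable setT (fun y => (v y)%:E) ->
  cintegrable (m1 \x m2) G.
Proof.
move=> mG le u0 v0 iu iv; apply: cintegrable_prod => //.
have mcG : measurable_fun setT (fun z => (cabs (G z))%:E).
  exact/measurable_EFinP/measurable_cabs.
have ev : \int[m2]_y (v y)%:E = (fine (\int[m2]_y (v y)%:E))%:E.
  by rewrite fineK//; exact: integrable_fin_num.
set c := fine _ in ev.
have c0 : (0 <= c)%R by rewrite -lee_fin -ev; apply: integral_ge0 => y _; rewrite lee_fin.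
apply: (@le_lt_trans _ _ (\int[m1]_x (c%:E * (u x)%:E))); last first.
  by rewrite integralZl// ltey_eq fin_numM// integrable_fin_num.
apply: ge0_le_integral => //.
- by move=> x _; apply: integral_ge0 => y _; rewrite lee_fin cabs_ge0.
- apply: (measurable_fun_fubini_tonelli_F (fun z => (cabs (G z))%:E)) => //.
  by move=> z; rewrite lee_fin cabs_ge0.
- by apply: measurable_funeM; exact: measurable_int iu.
- move=> x _; rewrite -ev muleC -integralZl//.
  apply: ge0_le_integral => //.
  + by move=> y _; rewrite lee_fin cabs_ge0.
  + exact: (measurableT_comp mcG (measurable_pair1 x)).
  + by apply: measurable_funeM; exact: measurable_int iv.
  + by move=> y _; rewrite -EFinM lee_fin.
Qed.

Lemma cmeas_cint_param1 (G : T1 * T2 -> R[i]) : cmeas G ->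
  cmeas (fun x => cint m2 (fun y => G (x, y))).
Proof.
have key (f : T1 * T2 -> R) : measurable_fun setT f ->
    measurable_fun setT (fun x => fine (\int[m2]_y (f (x, y))%:E)).
  move=> mf; apply: measurableT_comp => //.
  have mE : measurable_fun setT (fun z => (f z)%:E) by exact/measurable_EFinP.
  rewrite (_ : (fun x => _) =
     (fun x => \int[m2]_y (EFin \o f)^\+ (x, y)) \- (fun x => \int[m2]_y (EFin \o f)^\- (x, y))).
    apply: emeasurable_funB.
      by apply: measurable_fun_fubini_tonelli_F => //; exact: measurable_funepos.
    by apply: measurable_fun_fubini_tonelli_F => //; exact: measurable_funeneg.
  by apply/funext => x; rewrite [LHS]integralE; congr (_ - _);
    apply: eq_integral => y _; rewrite ?funeposE ?funenegE.
by move=> [a b]; split; [exact: (key _ a)|exact: (key _ b)].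
Qed.

End cfubini.

(** * Maps that multiply integrals by a constant *)

Section scaling_map.
Context dT (T : measurableType dT) (R : realType) (mu : {measure set T -> \bar R}).
Variables (p : T -> T) (k : R).
Hypothesis mp : measurable_fun setT p.
Hypothesis pE : forall F : T -> \bar R, measurable_fun setT F -> (forall t, 0 <= F t)%E ->
  (\int[mu]_t F (p t) = k%:E * \int[mu]_t F t)%E.

Lemma scaling_integral (f : T -> R) : mu.-integrable setT (fun t => (f t)%:E) ->
  mu.-integrable setT (fun t => (f (p t))%:E) /\
  (\int[mu]_t (f (p t))%:E = k%:E * \int[mu]_t (f t)%:E)%E.
Proof.
move=> fi; have mf := measurable_int _ fi.
have fi' : mu.-integrable setT (fun t => (f (p t))%:E).
  apply/integrableP; split; first exact: (measurableT_comp mf mp).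
  rewrite (pE (F := fun t => `|(f t)%:E|%E))//; last exact: measurableT_comp.
  case/integrableP: fi => _ fi; rewrite ltey_eq fin_numM// ge0_fin_numE//.
  exact: integral_ge0.
split=> //.
rewrite [LHS]integralE [in RHS]integralE muleBr//; last first.
  apply: fin_num_adde_defr.
  exact: (integrable_fin_num measurableT (integrable_funepos measurableT fi)).
rewrite -!pE//.
- by congr (_ - _)%E; apply: eq_integral => t _; rewrite ?funeposE ?funenegE.
- exact: measurable_funeneg.
- exact: measurable_funepos.
Qed.

Lemma scaling_cmeas (f : T -> R[i]) : cmeas f -> cmeas (fun t => f (p t)).
Proof. by move=> [a b]; split; [exact: (measurableT_comp a mp)|exact: (measurableT_comp b mp)]. Qed.

Lemma scaling_cintegrable (f : T -> R[i]) : cintegrable mu f -> cintegrable mu (fun t => f (p t)).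
Proof. by move=> [/scaling_integral[a _] /scaling_integral[b _]]. Qed.

Lemma scaling_cint (f : T -> R[i]) : cintegrable mu f ->
  cint mu (fun t => f (p t)) = k%:C * cint mu f.
Proof.
move=> [a b]; have [_ ea] := scaling_integral a; have [_ eb] := scaling_integral b.
apply: complex_ext; rewrite !cE /= ?ea ?eb fineM ?integrable_fin_num//= mul0r ?subr0 ?addr0//.
Qed.

Lemma scaling_nsq (f : T -> R[i]) : cmeas f ->
  (nsq mu (fun t => f (p t)) = k%:E * nsq mu f)%E.
Proof.
move=> mf; rewrite /nsq (pE (F := fun t => (sqmod (f t))%:E))//.
  exact/measurable_EFinP/measurable_sqmod.
by move=> t; rewrite lee_fin sqmod_ge0.
Qed.

Lemma scaling_l2 (f : T -> R[i]) : l2 mu f -> l2 mu (fun t => f (p t)).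
Proof.
move=> lf; have [mf _] := lf; split; first exact: scaling_cmeas.
by rewrite scaling_nsq// nsqE// -EFinM ltry.
Qed.

Lemma scaling_nr (f : T -> R[i]) : l2 mu f -> nr mu (fun t => f (p t)) = k * nr mu f.
Proof. by move=> lf; have [mf _] := lf; rewrite /nr scaling_nsq// nsqE. Qed.

End scaling_map.

Section affine1.
Variable R : realType.
Local Notation RR := (measurableTypeR R).
Local Notation leb := (@lebesgue_measure R).
Local Open Scope ereal_scope.

Lemma measurable_affine (a b : R) : measurable_fun setT ((fun x => a * x + b)%R : RR -> RR).
Proof.
have h : measurable_fun [set: R] (fun x : R => a * x + b)%R.
  by apply: measurable_funD => //; exact: measurable_funM.
exact: h.
Qed.

(** The right-hand side is a measure in [X], so by uniqueness of Lebesgue measure it is enough to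
    compare lengths on half-open intervals. *)
Lemma lebesgue_affine_preimage (a b : R) (X : set RR) : a != 0%R -> measurable X ->
  leb X = `|a|%:E * leb ((fun x : R => a * x + b)%R @^-1` X).
Proof.
move=> a0 mX.
pose na : {nonneg R} := NngNum (normr_ge0 a).
pose q : RR -> RR := (fun x => a * x + b)%R.
pose m : {measure set RR -> \bar R} :=
  mscale na (measure_function_pushforward__canonical__measure_function_Measure
     leb (measurable_affine a b)).
suff -> : leb X = m X by [].
apply: lebesgue_measure_unique => // Y [[x y] _ <-].
rewrite -[RHS]/(`|a|%:E * leb (q @^-1` `]x, y]%classic)) /=.
have [ap|an] := ltP 0%R a.
  rewrite (_ : _ @^-1` _ = `]((x - b) / a)%R, ((y - b) / a)%R]%classic); last first.
    have aux (z : R) : (x < a * z + b <= y)%R = ((x - b) / a < z <= (y - b) / a)%R.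
      by rewrite ltr_pdivrMr// ler_pdivlMr//; apply/idP/idP => /andP[h1 h2];
        apply/andP; split; lra.
    by apply/seteqP; split => z; rewrite /preimage /q /= !in_itv/= aux.
  rewrite !lebesgue_measure_itv/= !lte_fin ltr_pM2r ?invr_gt0// ltrD2r.
  case: ifP => _; last by rewrite mule0.
  by rewrite -!EFinB -EFinM gtr0_norm//; congr EFin; field; rewrite gt_eqF.
have {}an : (a < 0)%R by rewrite lt_neqAle a0.
(* A negative factor reverses the interval, so the preimage is closed on the left and open on the
   right. *)
rewrite (_ : _ @^-1` _ = `[((y - b) / a)%R, ((x - b) / a)%R[%classic); last first.
  have aux (z : R) : (x < a * z + b <= y)%R = ((y - b) / a <= z < (x - b) / a)%R.
    by rewrite ltr_ndivlMr// ler_ndivrMr//; apply/idP/idP => /andP[h1 h2];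
      apply/andP; split; lra.
  by apply/seteqP; split => z; rewrite /preimage /q /= !in_itv/= aux.
rewrite !lebesgue_measure_itv/= !lte_fin ltr_nM2r ?invr_lt0// ltrD2r.
case: ifP => _; last by rewrite mule0.
by rewrite -!EFinB -EFinM ltr0_norm//; congr EFin; field; rewrite lt_eqF.
Qed.

Lemma ge0_integral_affine (a b : R) (F : RR -> \bar R) : a != 0%R ->
  measurable_fun setT F -> (forall x, 0 <= F x) ->
  \int[leb]_x F (a * x + b)%R = `|a|^-1%:E * \int[leb]_x F x.
Proof.
move=> a0 mF F0.
pose na : {nonneg R} := NngNum (normr_ge0 a).
pose m : {measure set RR -> \bar R} :=
  measure_function_pushforward__canonical__measure_function_Measure
     leb (measurable_affine a b).
have e : \int[leb]_x F x = `|a|%:E * \int[m]_x F x.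
  rewrite -[RHS](ge0_integral_mscale _ _ na)//.
  by apply: eq_measure_integral => X mX _; exact: lebesgue_affine_preimage.
rewrite e muleA -EFinM mulVf ?normr_eq0// mul1e.
rewrite (@ge0_integral_pushforward _ _ _ _ _ _ (measurable_affine a b))//.
Qed.

End affine1.

Section tuple_cov.
Variable R : realType.
Local Notation RR := (measurableTypeR R).
Local Notation leb := (@lebesgue_measure R).
Local Open Scope ereal_scope.

Definition addt (d : nat) (t u : d.-tuple R) : d.-tuple R :=
  [tuple (tnth t i + tnth u i)%R | i < d].

Lemma tnth_addt d (t u : d.-tuple R) i : tnth (addt t u) i = (tnth t i + tnth u i)%R.
Proof. by rewrite tnth_mktuple. Qed.

Lemma tnth_subt d (t u : d.-tuple R) i : tnth (subt t u) i = (tnth t i - tnth u i)%R.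
Proof. by rewrite tnth_mktuple. Qed.

Lemma tnth_intv d (n : 'cV[int]_d) i : tnth (intv R n) i = ((n i 0)%:~R)%R.
Proof. by rewrite tnth_mktuple. Qed.

Lemma tnth_actM d (M : 'M[R]_d) (t : d.-tuple R) i :
  tnth (actM M t) i = (\sum_j M i j * tnth t j)%R.
Proof. by rewrite tnth_mktuple mxE; apply: eq_bigr => j _; rewrite mxE. Qed.

Lemma measurable_tuple_coord dX (X : measurableType dX) d (f : X -> d.-tuple R) :
  (forall i, measurable_fun setT (fun x => tnth (f x) i)) -> measurable_fun setT f.
Proof. by move=> h; apply/measurable_fun_tnthP. Qed.

Lemma measurable_actM d (M : 'M[R]_d) : measurable_fun setT (actM M).
Proof.
apply: measurable_tuple_coord => i.
under eq_fun do rewrite tnth_actM.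
apply: measurable_sum => j; apply: measurable_funM => //; exact: measurable_tnth.
Qed.

Lemma measurable_addt d (u : d.-tuple R) : measurable_fun setT (fun t => addt t u).
Proof.
apply: measurable_tuple_coord => i.
under eq_fun do rewrite tnth_addt.
by apply: measurable_funD => //; exact: measurable_tnth.
Qed.

Lemma tcons_ext k (t : k.+1.-tuple R) (x : R) (u : k.-tuple R) :
  tnth t ord0 = x -> (forall i, tnth t (lift ord0 i) = tnth u i) -> t = cons_tuple x u.
Proof.
move=> h1 h2; apply: eq_from_tnth => i.
by case: (unliftP ord0 i) => [j|] ->; rewrite ?tnthS ?tnth0 ?h1 ?h2.
Qed.

Lemma ge0_integral_addt d (u : d.-tuple R) (F : d.-tuple R -> \bar R) :
  measurable_fun setT F -> (forall t, 0 <= F t) ->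
  \int[lebT R d]_t F (addt t u) = \int[lebT R d]_t F t.
Proof.
elim: d u F => [|k IH] u F mF F0.
  rewrite !ge0_integral_mu0//; first by rewrite !tuple0.
  exact: (measurableT_comp mF (measurable_addt u)).
pose u' := [tuple of behead u] : k.-tuple R.
have e (x : R) (t : k.-tuple R) :
    addt (cons_tuple x t) u = cons_tuple (x + thead u)%R (addt t u').
  apply: tcons_ext; first by rewrite tnth_addt tnth0.
  move=> i; rewrite !tnth_addt tnthS; congr (_ + _)%R.
  by rewrite [in LHS](tuple_eta u) tnthS.
rewrite !ge0_integral_muS//; last exact: (measurableT_comp mF (measurable_addt u)).
transitivity (\int[leb]_x \int[lebT R k]_t F (cons_tuple (x + thead u)%R t)).
  apply: eq_integral => x _.
  under eq_integral do rewrite e.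
  by rewrite (IH u' (fun t => F (cons_tuple (x + thead u)%R t)))//; exact: measurable_tcons2.
have := @ge0_integral_affine R 1%R (thead u)
  (fun x => \int[lebT R k]_t F (cons_tuple x t)) (oner_neq0 _).
rewrite normr1 invr1 mul1e => <-.
- by apply: eq_integral => x _; rewrite mul1r.
- exact: measurable_ge0_integral_section.
- by move=> x; exact: integral_ge0.
Qed.

Definition cov d (M : 'M[R]_d) := forall F : d.-tuple R -> \bar R,
  measurable_fun setT F -> (forall t, 0 <= F t) ->
  \int[lebT R d]_t F (actM M t) = (`|\det M|^-1)%:E * \int[lebT R d]_t F t.

Lemma actM_mul d (M N : 'M[R]_d) t : actM (M *m N) t = actM M (actM N t).
Proof.
rewrite /actM -mulmxA; congr (cv2tup (M *m _)).
by apply/colP => i; rewrite !mxE tnth_mktuple mxE.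
Qed.

Lemma actM1 d (t : d.-tuple R) : actM 1%:M t = t.
Proof.
apply: eq_from_tnth => i; rewrite tnth_actM (bigD1 i)//= big1 ?addr0.
  by rewrite mxE eqxx mul1r.
by move=> j ji; rewrite mxE eq_sym (negbTE ji) mul0r.
Qed.

Lemma cov_mul d (M N : 'M[R]_d) : cov M -> cov N -> cov (M *m N).
Proof.
move=> cM cN F mF F0; under eq_integral do rewrite actM_mul.
have mFM : measurable_fun setT (fun t => F (actM M t)) :=
  measurableT_comp mF (measurable_actM M).
rewrite (cN (fun t => F (actM M t)) mFM (fun t => F0 _)).
by rewrite cM// det_mulmx normrM invfM muleA -EFinM [in RHS]mulrC.
Qed.

Lemma block1E k (a : R) (r : 'rV[R]_k) (c : 'cV[R]_k) (N : 'M[R]_k)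
    (M : 'M[R]_k.+1 := block_mx a%:M r c N) :
  [/\ M ord0 ord0 = a, forall j, M ord0 (lift ord0 j) = r 0%R j,
    forall i, M (lift ord0 i) ord0 = c i 0%R &
    forall i j, M (lift ord0 i) (lift ord0 j) = N i j].
Proof.
have e0 : ord0 = lshift k ord0 :> 'I_(1 + k) by exact/val_inj.
have e1 j : lift ord0 j = rshift 1 j :> 'I_(1 + k) by exact/val_inj.
split.
- have := block_mxEul (a%:M : 'M[R]_1) r c N ord0 ord0.
  by rewrite [RHS]mxE eqxx mulr1n -e0.
- by move=> j; have := block_mxEur (a%:M : 'M[R]_1) r c N ord0 j; rewrite -e0 -e1.
- by move=> i; have := block_mxEdl (a%:M : 'M[R]_1) r c N i ord0; rewrite -e0 -e1.
- by move=> i j; have := block_mxEdr (a%:M : 'M[R]_1) r c N i j; rewrite -!e1.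
Qed.

(** With the first coordinate [x] fixed, the tail undergoes [N] followed by a translation by x c.
    Translation invariance absorbs the latter in the inner integral, and what remains is a scaling
    of [x]. *)
Lemma cov_lower k (a : R) (c : 'cV[R]_k) (N : 'M[R]_k) : a != 0%R -> cov N ->
  cov (block_mx a%:M 0 c N : 'M[R]_k.+1).
Proof.
move=> a0 cN F mF F0; pose M : 'M[R]_k.+1 := block_mx a%:M 0 c N; rewrite -/M.
have e (x : R) (t : k.-tuple R) :
    actM M (cons_tuple x t) = cons_tuple (a * x)%R (addt (actM N t) (cv2tup (x *: c))).
  have [M00 M0 Mi Mij] := block1E a 0 c N.
  apply: tcons_ext.
    rewrite tnth_actM big_ord_recl tnth0 M00 big1 ?addr0// => j _.
    by rewrite M0 mxE mul0r.
  move=> i; rewrite tnth_addt !tnth_actM big_ord_recl tnth0 addrC; congr (_ + _)%R.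
    by apply: eq_bigr => j _; rewrite tnthS Mij.
  by rewrite Mi tnth_mktuple mxE mulrC.
rewrite !ge0_integral_muS//; last exact: (measurableT_comp mF (measurable_actM M)).
transitivity (\int[leb]_x ((`|\det N|^-1)%:E * \int[lebT R k]_t F (cons_tuple (a * x)%R t))).
  apply: eq_integral => x _.
  under eq_integral do rewrite e.
  have mFx := @measurable_tcons2 R k F (a * x)%R mF.
  have mFx' := measurableT_comp mFx (measurable_addt (cv2tup (x *: c))).
  rewrite (cN (fun t => F (cons_tuple (a * x)%R (addt t (cv2tup (x *: c))))) mFx' (fun t => F0 _)).
  by rewrite (@ge0_integral_addt _ _ (fun t => F (cons_tuple (a * x)%R t))).
have mS := measurable_ge0_integral_section mF F0.
rewrite ge0_integralZl//; last 2 first.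
- have := measurableT_comp mS (measurable_affine a 0).
  by congr measurable_fun; apply/funext => x /=; rewrite addr0.
- by move=> x _; exact: integral_ge0.
have -> : \int[leb]_x \int[lebT R k]_t F (cons_tuple (a * x)%R t) =
   (`|a|^-1)%:E * \int[leb]_x \int[lebT R k]_t F (cons_tuple x t).
  rewrite -(@ge0_integral_affine R a 0)//; last by move=> x; exact: integral_ge0.
  by apply: eq_integral => x _; rewrite addr0.
rewrite muleA -EFinM; congr (_%:E * _).
by rewrite (det_lblock (a%:M : 'M[R]_1)) det_scalar1 normrM invfM mulrC.
Qed.

(** Here the translation hits the first coordinate and depends on the tail, so that coordinate must
    be integrated first, whence the swapped order of integration. *)
Lemma cov_upper k (a : R) (r : 'rV[R]_k) (N : 'M[R]_k) : a != 0%R -> cov N ->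
  cov (block_mx a%:M r 0 N : 'M[R]_k.+1).
Proof.
move=> a0 cN F mF F0; pose M : 'M[R]_k.+1 := block_mx a%:M r 0 N; rewrite -/M.
have e (x : R) (t : k.-tuple R) : actM M (cons_tuple x t) =
    cons_tuple (a * x + \sum_j r 0 j * tnth t j)%R (actM N t).
  have [M00 M0 Mi Mij] := block1E a r 0 N.
  apply: tcons_ext.
    rewrite tnth_actM big_ord_recl tnth0 M00; congr (_ + _)%R.
    by apply: eq_bigr => j _; rewrite tnthS M0.
  move=> i; rewrite !tnth_actM big_ord_recl tnth0 Mi mxE mul0r add0r.
  by apply: eq_bigr => j _; rewrite tnthS Mij.
rewrite !ge0_integral_muS_swap//; last exact: (measurableT_comp mF (measurable_actM M)).
have mG : measurable_fun setT (fun t : k.-tuple R => \int[leb]_x F (cons_tuple x t)).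
  apply: (measurable_fun_fubini_tonelli_G (F \o @tcons R k)).
    exact: (measurableT_comp mF (@measurable_tcons R k)).
  by move=> x; exact: F0.
transitivity (\int[lebT R k]_t ((`|a|^-1)%:E * \int[leb]_x F (cons_tuple x (actM N t)))).
  apply: eq_integral => t _.
  under eq_integral do rewrite e.
  rewrite (@ge0_integral_affine R a _ (fun x => F (cons_tuple x (actM N t))))//.
  apply: (measurableT_comp mF).
  by apply: measurable_cons => //; exact: measurable_cst.
rewrite ge0_integralZl//; last 2 first.
- exact: (measurableT_comp mG (measurable_actM N)).
- by move=> x _; exact: integral_ge0.
rewrite (cN (fun t => \int[leb]_x F (cons_tuple x t)) mG); last first.
  by move=> x; exact: integral_ge0.
rewrite muleA -EFinM; congr (_%:E * _).
by rewrite (det_ublock (a%:M : 'M[R]_1)) det_scalar1 normrM invfM.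
Qed.

(** Block elimination: a nonzero pivot factors the matrix into a lower triangular part with unit
    diagonal and an upper one whose lower right block is the Schur complement, invertible because
    the determinant is multiplicative. *)
Lemma cov_pivot k (a : R) (r : 'rV[R]_k) (c : 'cV[R]_k) (N : 'M[R]_k) : a != 0%R ->
  (forall P : 'M[R]_k, P \in unitmx -> cov P) ->
  (block_mx a%:M r c N : 'M[R]_k.+1) \in unitmx -> cov (block_mx a%:M r c N : 'M[R]_k.+1).
Proof.
move=> a0 IH.
have E : (block_mx a%:M r c N : 'M[R]_k.+1) =
    block_mx 1%:M 0 (a^-1 *: c) 1%:M *m block_mx a%:M r 0 (N - a^-1 *: (c *m r)).
  rewrite (mulmx_block (1%:M : 'M[R]_1)) !(mul1mx, mul0mx, mulmx0, addr0, add0r).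
  rewrite mul_mx_scalar scalerA divff// scale1r -scalemxAl.
  by rewrite addrC subrK.
rewrite E => u; apply: cov_mul.
  by apply: cov_lower; [exact: oner_neq0|apply: IH; exact: unitmx1].
apply: cov_upper => //; apply: IH.
move: u; rewrite !unitmxE det_mulmx unitrM => /andP[_].
by rewrite (det_ublock (a%:M : 'M[R]_1)) unitrM => /andP[].
Qed.

Lemma block_shear k (r : 'rV[R]_k) :
  (block_mx 1%:M (- r)%R 0%R 1%:M : 'M[R]_(1 + k)) *m block_mx 1%:M r 0%R 1%:M = 1%:M.
Proof.
rewrite mulmx_block !(mul1mx, mulmx1, mul0mx, mulmx0, addr0, add0r) subrr.
by rewrite -scalar_mx_block.
Qed.

Lemma unitmx_cov d (M : 'M[R]_d) : M \in unitmx -> cov M.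
Proof.
elim: d M => [|k IH] M uM.
  move=> F mF F0; rewrite !ge0_integral_mu0//; first by rewrite det_mx00 normr1 invr1 mul1e !tuple0.
  exact: (measurableT_comp mF (measurable_actM M)).
have [a0|a0] := eqVneq (M ord0 ord0) 0%R; last first.
  have E : M = block_mx (M ord0 ord0)%:M (ursubmx (M : 'M[R]_(1 + k)))
      (dlsubmx (M : 'M[R]_(1 + k))) (drsubmx (M : 'M[R]_(1 + k))).
    have <- : ulsubmx (M : 'M[R]_(1 + k)) = (M ord0 ord0)%:M.
      by apply/matrixP => i j; rewrite !mxE !ord1 eqxx; congr (M _ _); exact/val_inj.
    by rewrite submxK.
  by rewrite E in uM *; exact: cov_pivot.
(* When the pivot vanishes, expanding the nonzero determinant along the first column yields a
   nonzero entry below it. Multiplication by the shear [E dj] adds that row to the first one and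
   creates a pivot; the inverse shear is itself of the form treated by [cov_upper]. *)
have [j Mj] : exists j : 'I_k, M (lift ord0 j) ord0 != 0%R.
  apply: contrapT => /forallNP h.
  have := uM; rewrite unitmxE (expand_det_col M ord0) big1 ?unitr0// => i _.
  case: (unliftP ord0 i) => [j|] ->; last by rewrite a0 mul0r.
  by have /negP := h j; rewrite negbK => /eqP ->; rewrite mul0r.
pose dj : 'rV[R]_k := delta_mx 0%R j.
pose E (r : 'rV[R]_k) : 'M[R]_k.+1 := block_mx (1%R%:M : 'M[R]_1) r 0%R 1%:M.
have EE : E (- dj)%R *m E dj = 1%:M := block_shear dj.
have uEM : E dj *m M \in unitmx.
  rewrite unitmx_mul uM andbT; have := unitmx1 R k.+1.
  by rewrite -EE unitmx_mul => /andP[].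
rewrite -[M]mul1mx -EE -mulmxA; apply: cov_mul.
  apply: cov_upper; first exact: oner_neq0.
  by apply: IH; exact: unitmx1.
set P := E dj *m M in uEM *.
have P0 : P ord0 ord0 != 0%R.
  have [_ E0 _ _] := block1E 1%R dj 0%R (1%:M : 'M[R]_k).
  rewrite /P mxE big_ord_recl a0 mulr0 add0r (bigD1 j)//= big1 ?addr0.
    by rewrite E0 !mxE !eqxx mul1r.
  by move=> i ij; rewrite E0 !mxE (negbTE ij) andbF mul0r.
have EP : P = block_mx (P ord0 ord0)%:M (ursubmx (P : 'M[R]_(1 + k)))
      (dlsubmx (P : 'M[R]_(1 + k))) (drsubmx (P : 'M[R]_(1 + k))).
  have <- : ulsubmx (P : 'M[R]_(1 + k)) = (P ord0 ord0)%:M.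
    apply/matrixP => i i'; rewrite [RHS]mxE !ord1 eqxx [LHS]mxE [LHS]mxE.
    by congr (P _ _); exact/val_inj.
  by rewrite submxK.
by rewrite EP in uEM *; exact: cov_pivot.
Qed.

End tuple_cov.

(** * Integrals of products of one-variable functions *)

Section tuple_products.
Variable R : realType.
Local Notation RR := (measurableTypeR R).
Local Notation leb := (@lebesgue_measure R).

Lemma measurable_tuple_prod d (F : 'I_d -> R -> R) :
  (forall i, measurable_fun setT (F i)) ->
  measurable_fun setT (fun t : d.-tuple R => \prod_i F i (tnth t i)).
Proof.
move=> mF; apply: measurable_prod => i _.
by apply: (measurableT_comp (mF i)); exact: measurable_tnth.
Qed.

Lemma integral_tuple_prod d (F : 'I_d -> R -> R) (c : 'I_d -> R) :
  (forall i, measurable_fun setT (F i)) -> (forall i x, 0 <= F i x) ->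
  (forall i, \int[leb]_x (F i x)%:E = (c i)%:E)%E ->
  (\int[lebT R d]_t (\prod_i F i (tnth t i))%:E = (\prod_i c i)%:E)%E.
Proof.
elim: d F c => [|k IH] F c mF F0 Fc.
  rewrite ge0_integral_mu0 ?big_ord0//.
  by apply/measurable_EFinP; exact: measurable_tuple_prod.
rewrite ge0_integral_muS; last 2 first.
- by apply/measurable_EFinP; exact: measurable_tuple_prod.
- by move=> t; rewrite lee_fin prodr_ge0.
transitivity (\int[leb]_x ((\prod_i c (lift ord0 i))%:E * (F ord0 x)%:E))%E.
  apply: eq_integral => x _.
  rewrite -(IH (fun i => F (lift ord0 i)) (fun i => c (lift ord0 i)))//.
  rewrite muleC -ge0_integralZl_EFin//.
  - by apply: eq_integral => t _; rewrite big_ord_recl tnth0 -EFinM;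
      congr (_ * _)%:E; apply: eq_bigr => i _; rewrite tnthS.
  - by move=> t _; rewrite lee_fin prodr_ge0.
  - by apply/measurable_EFinP; exact: (@measurable_tuple_prod _ (fun i => F (lift ord0 i))).
have c0 i : 0 <= c i.
  by rewrite -lee_fin -Fc integral_ge0// => x _; rewrite lee_fin.
rewrite ge0_integralZl_EFin//.
- by rewrite Fc -EFinM big_ord_recl mulrC.
- by move=> x _; rewrite lee_fin.
- by apply/measurable_EFinP; exact: (mF ord0).
- exact: prodr_ge0.
Qed.

Lemma cmeas_tuple_prod d (F : 'I_d -> R -> R[i]) :
  (forall i, @cmeas _ RR _ (F i)) ->
  cmeas (fun t : d.-tuple R => \prod_i F i (tnth t i)).
Proof.
move=> mF.
suff h (s : seq 'I_d) : cmeas (fun t : d.-tuple R => \prod_(i <- s) F i (tnth t i)) by exact: h.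
elim: s => [|i s IH].
  by under eq_fun do rewrite big_nil; exact: cmeas_cst.
under eq_fun do rewrite big_cons; apply: cmeasM => //.
have [a b] := mF i; have mt := @measurable_tnth _ R d i.
by split; [exact: (measurableT_comp a mt)|exact: (measurableT_comp b mt)].
Qed.

Lemma cabs_prod (I : Type) (s : seq I) (F : I -> R[i]) :
  cabs (\prod_(i <- s) F i) = \prod_(i <- s) cabs (F i).
Proof. by elim/big_rec2 : _ => [|i x y _ <-]; rewrite ?cabs1 ?cabsM. Qed.

Lemma cint_lebTS k (F : k.+1.-tuple R -> R[i]) : cintegrable (lebT R k.+1) F ->
  cint (lebT R k.+1) F = cint leb (fun x => cint (lebT R k) (fun t => F (cons_tuple x t))).
Proof.
move=> iF; have [a b] := iF; have [a' b'] : cintegrable (leb \x lebT R k)%E (F \o @tcons R k).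
  by split; [exact: integrable_tcons a|exact: integrable_tcons b].
have -> : cint (lebT R k.+1) F = cint (leb \x lebT R k)%E (F \o @tcons R k).
  apply: complex_ext => /=; congr fine.
    rewrite [LHS](@integral_pushforward _ _ _ _ _ _ (@measurable_tcons R k)) ?preimage_setT//=.
    exact: measurable_int a.
  rewrite [LHS](@integral_pushforward _ _ _ _ _ _ (@measurable_tcons R k)) ?preimage_setT//=.
  exact: measurable_int b.
by rewrite cint_prod1.
Qed.

Lemma cintegrable_tuple_prod d (F : 'I_d -> R -> R[i]) :
  (forall i, cintegrable leb (F i)) ->
  cintegrable (lebT R d) (fun t : d.-tuple R => \prod_i F i (tnth t i)).
Proof.
move=> iF; apply: cintegrable_lty.
  by apply: cmeas_tuple_prod => i; exact: cintegrable_cmeas (iF i).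
under eq_integral do rewrite cabs_prod.
rewrite (@integral_tuple_prod _ (fun i x => cabs (F i x))
  (fun i => fine (\int[leb]_x (cabs (F i x))%:E)%E)) ?ltry//.
- by move=> i; exact: measurable_cabs (cintegrable_cmeas (iF i)).
- by move=> i x; exact: cabs_ge0.
- move=> i; rewrite fineK//; apply: integrable_fin_num => //.
  exact: cintegrable_cabs.
Qed.

Lemma cint_tuple_prod d (F : 'I_d -> R -> R[i]) :
  (forall i, cintegrable leb (F i)) ->
  cint (lebT R d) (fun t : d.-tuple R => \prod_i F i (tnth t i)) = \prod_i cint leb (F i).
Proof.
elim: d F => [|k IH] F iF.
  have -> : (fun t : 0.-tuple R => \prod_(i < 0) F i (tnth t i)) = fun=> 1.
    by apply/funext => t; rewrite big_ord0.
  by rewrite big_ord0; apply: complex_ext => /=; rewrite ge0_integral_mu0//;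
    exact: measurable_cst.
rewrite cint_lebTS; last exact: cintegrable_tuple_prod.
rewrite big_ord_recl mulrC -cintZ//; congr cint; apply/funext => x.
rewrite -(IH (fun i => F (lift ord0 i)))// mulrC -cintZ.
  congr cint; apply/funext => t; rewrite big_ord_recl tnth0; congr (_ * _).
  by apply: eq_bigr => i _; rewrite tnthS.
by apply: (@cintegrable_tuple_prod _ (fun i => F (lift ord0 i))) => i; exact: iF.
Qed.

End tuple_products.

(** * Density of step functions *)

Section boxes.
Variables (R : realType) (d : nat).
Local Notation RR := (measurableTypeR R).
Local Notation leb := (@lebesgue_measure R).
Local Notation V := (d.-tuple R).
Local Notation C := R[i].
Local Notation lebV := (lebT R d).

Definition boxf (a b t : V) : R := \prod_i \1_(`[tnth a i, tnth b i]%classic) (tnth t i).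

Lemma measurable_boxf a b : measurable_fun setT (boxf a b).
Proof.
apply: (@measurable_tuple_prod R d (fun i => \1_(`[tnth a i, tnth b i]%classic))) => i.
exact: measurable_indic.
Qed.

Lemma boxf_ge0 a b t : 0 <= boxf a b t.
Proof. by apply: prodr_ge0 => i _. Qed.

Lemma boxf_in a b t : (forall i, tnth a i <= tnth t i <= tnth b i) -> boxf a b t = 1.
Proof.
by move=> h; rewrite /boxf big1// => i _; rewrite indicE mem_set//= in_itv/= h.
Qed.

Lemma boxf_out a b t i : ~~ (tnth a i <= tnth t i <= tnth b i) -> boxf a b t = 0.
Proof.
move=> h; rewrite /boxf (bigD1 i)//= indicE memNset ?mul0r//=.
by rewrite in_itv/=; exact/negP.
Qed.

Lemma boxf_01 a b t : boxf a b t = 0 \/ boxf a b t = 1.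
Proof.
have [/forallP h|/forallPn[i h]] := boolP [forall i, tnth a i <= tnth t i <= tnth b i].
  by right; exact: boxf_in.
by left; exact: boxf_out h.
Qed.

Lemma boxf_le1 a b t : boxf a b t <= 1.
Proof. by case: (boxf_01 a b t) => ->; rewrite ?ler01. Qed.

Lemma boxf_sqr a b t : boxf a b t ^+ 2 = boxf a b t.
Proof. by case: (boxf_01 a b t) => ->; rewrite ?expr1n ?expr0n. Qed.

Lemma boxf_neq0 a b t : boxf a b t != 0 -> forall i, tnth a i <= tnth t i <= tnth b i.
Proof.
move=> h i; apply: contraNT h => h; apply/eqP; exact: boxf_out h.
Qed.

Lemma integral_boxf a b :
  (\int[lebV]_t (boxf a b t)%:E = (\prod_i Num.max 0 (tnth b i - tnth a i))%:E)%E.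
Proof.
apply: (@integral_tuple_prod R d (fun i => \1_(`[tnth a i, tnth b i]%classic))).
- by move=> i; exact: measurable_indic.
- by move=> i x.
- move=> i; rewrite integral_indic//= setIT lebesgue_measure_itv/= lte_fin.
  have [ab|ba] := ltP; first by rewrite -EFinB max_r// subr_ge0 ltW.
  by rewrite max_l// subr_le0.
Qed.

Lemma integrable_boxf a b : lebV.-integrable setT (fun t => (boxf a b t)%:E).
Proof.
apply/integrableP; split; first by apply/measurable_EFinP; exact: measurable_boxf.
rewrite (eq_integral (fun t => (boxf a b t)%:E)) ?integral_boxf ?ltry// => t _.
by rewrite /= ger0_norm ?boxf_ge0.
Qed.

Lemma l2_boxf a b : l2 lebV (fun t => (boxf a b t)%:C).
Proof.
apply: (proj1 (@l2_le _ _ _ _ _ (boxf a b) _ _ _)).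
- by apply: cmeasC; exact: measurable_boxf.
- exact: integrable_boxf.
- by move=> t; rewrite sqmodC boxf_sqr.
Qed.

Definition stepf (s : seq (C * (V * V))) (t : V) : C :=
  \sum_(p <- s) p.1 * (boxf p.2.1 p.2.2 t)%:C.

Lemma l2_stepf s : l2 lebV (stepf s).
Proof. by apply: l2_sum => p; apply: l2Z; exact: l2_boxf. Qed.

Lemma stepf_cat s1 s2 t : stepf (s1 ++ s2) t = stepf s1 t + stepf s2 t.
Proof. by rewrite /stepf big_cat. Qed.

Lemma stepf_scale c s t :
  stepf [seq (c * p.1, p.2) | p <- s] t = c * stepf s t.
Proof. by rewrite /stepf big_map mulr_sumr; apply: eq_bigr => p _; rewrite mulrA. Qed.

Definition approximable (f : V -> C) : Prop := l2 lebV f /\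
  forall e : R, 0 < e -> exists s, nr lebV (fun t => f t - stepf s t) < e.

Lemma approx_box a b : approximable (fun t => (boxf a b t)%:C).
Proof.
split; first exact: l2_boxf.
move=> e e0; exists [:: (1, (a, b))].
rewrite (_ : (fun t => _) = fun=> 0) ?nr0//.
by apply/funext => t; rewrite /stepf big_seq1 mul1r subrr.
Qed.

Lemma approx0 : approximable (fun=> 0).
Proof.
split; first exact: l20.
move=> e e0; exists [::]; rewrite (_ : (fun t => _) = fun=> 0) ?nr0//.
by apply/funext => t; rewrite /stepf big_nil subrr.
Qed.

Lemma approxD f g : approximable f -> approximable g -> approximable (fun t => f t + g t).
Proof.
move=> [lf hf] [lg hg]; split; first exact: l2D.
move=> e e0; have e4 : 0 < e / 4 by rewrite divr_gt0.
have [s1 h1] := hf _ e4; have [s2 h2] := hg _ e4; exists (s1 ++ s2).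
rewrite (_ : (fun t => _) = fun t => (f t - stepf s1 t) + (g t - stepf s2 t)); last first.
  by apply/funext => t; rewrite stepf_cat; ring.
apply: (le_lt_trans (nrD_le2 _ _)); [exact/l2B/l2_stepf|exact/l2B/l2_stepf|lra].
Qed.

Lemma approxZ c f : approximable f -> approximable (fun t => c * f t).
Proof.
move=> [lf hf]; split; first exact: l2Z.
move=> e e0; have c1 : 0 < 1 + sqmod c by rewrite ltr_pwDl ?sqmod_ge0.
have [s h] := hf _ (divr_gt0 e0 c1).
exists [seq (c * p.1, p.2) | p <- s].
rewrite (_ : (fun t => _) = fun t => c * (f t - stepf s t)); last first.
  by apply/funext => t; rewrite stepf_scale mulrBr.
rewrite nrZ; last exact/l2B/l2_stepf.
apply: (@le_lt_trans _ _ ((1 + sqmod c) * nr lebV (fun t => f t - stepf s t))).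
  by rewrite ler_wpM2r ?nr_ge0// lerDr.
by rewrite -ltr_pdivlMl// mulrC.
Qed.

Lemma approx_sum (I : Type) (s : seq I) (F : I -> V -> C) :
  (forall i, approximable (F i)) -> approximable (fun t => \sum_(i <- s) F i t).
Proof.
move=> h; elim: s => [|i s IH].
  by under eq_fun do rewrite big_nil; exact: approx0.
by under eq_fun do rewrite big_cons; exact: approxD.
Qed.

Lemma approx_lim (u : nat -> V -> C) f : (forall n, approximable (u n)) -> l2 lebV f ->
  (fun n => nr lebV (fun t => u n t - f t)) @ \oo --> (0 : R) -> approximable f.
Proof.
move=> hu lf cv; split => // e e0; have e4 : 0 < e / 4 by rewrite divr_gt0.
have /cvgrPdist_lt/(_ _ e4)[N _ hN] := cv.
have := hN N (leqnn N) => /=; rewrite sub0r normrN ger0_norm ?nr_ge0// => hn.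
have [lu hun] := hu N; have [s hs] := hun _ e4; exists s.
rewrite (_ : (fun t => _) = fun t => (f t - u N t) + (u N t - stepf s t)); last first.
  by apply/funext => t; ring.
have := nrD_le2 (l2B lf lu) (l2B lu (l2_stepf s)).
by rewrite (nr_subC _ f); lra.
Qed.

Definition cst_tuple (x : R) : V := [tuple x | i < d].

Definition cube (n : nat) : V -> R := boxf (cst_tuple (- n%:R)) (cst_tuple n%:R).

Lemma cube_in n t : (forall i, `|tnth t i| <= n%:R) -> cube n t = 1.
Proof. by move=> h; apply: boxf_in => i; rewrite !tnth_mktuple -ler_norml. Qed.

Lemma cvg_cube t : (fun n => cube n t) @ \oo --> (1 : R).
Proof.
apply: cvg_near_cst.
exists (Num.truncn (\sum_i `|tnth t i|)).+1 => //= n hn.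
apply/eqP; apply/eqP; apply: cube_in => i.
apply: (@le_trans _ _ (\sum_i `|tnth t i|)).
  by rewrite (bigD1 i)//= lerDl sumr_ge0.
apply: (@le_trans _ _ (Num.truncn (\sum_i `|tnth t i|)).+1%:R); last by rewrite ler_nat.
by rewrite ltW// truncnS_gt.
Qed.

(** A generating family stable under intersection, the corner of an intersection being the
    coordinatewise maximum. Cut with a cube, an orthant becomes a box, which is how boxes enter the
    Dynkin argument. *)
Definition orthants : set (set V) := [set E | exists x : V,
  E = [set t | forall i, tnth x i <= tnth t i]].

Lemma measurable_orthants : @measurable _ V = <<s orthants >>.
Proof.
apply/seteqP; split.
  pose W := g_sigma_algebraType orthants.
  have h : measurable_fun [set: W] (id : W -> V).
    apply/measurable_fun_tnthP => i.
    apply: (measurability (@RGenCInfty.G R)); first exact: RGenCInfty.measurableE.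
    move=> _ [_ [x ->] <-]; rewrite setTI.
    (* A half-space in coordinate [i] is the union of orthants whose corner has [x] there and
       recedes to - n in the other coordinates. *)
    pose v n : V := [tuple if j == i then x else - n%:R | j < d].
    rewrite (_ : _ @^-1` _ = \bigcup_n [set t | forall j, tnth (v n) j <= tnth t j]).
      by apply: bigcupT_measurable => n; apply: sub_sigma_algebra; exists (v n).
    apply/seteqP; split => [t|t [n _ h]] /=; rewrite in_itv/= andbT.
      move=> xt; exists (Num.truncn (\sum_i `|tnth t i|)).+1 => // j.
      rewrite tnth_mktuple; case: eqP => [->//|_].
      have : `|tnth t j| <= (Num.truncn (\sum_i `|tnth t i|)).+1%:R.
        apply: (@le_trans _ _ (\sum_i `|tnth t i|)).
          by rewrite (bigD1 j)//= lerDl sumr_ge0.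
        by rewrite ltW// truncnS_gt.
      by rewrite ler_norml => /andP[].
    by have := h i; rewrite tnth_mktuple eqxx.
  by move=> A mA; have := h measurableT A mA; rewrite setTI.
apply: smallest_sub; first exact: sigma_algebra_measurable.
move=> _ [x ->].
rewrite (_ : [set t | _] = \bigcap_(i in [set: 'I_d]) [set t : V | tnth x i <= tnth t i]).
  apply: fin_bigcap_measurable => // i _.
  rewrite (_ : [set t | _] = setT `&` (fun t : V => tnth t i) @^-1` `[tnth x i, +oo[%classic).
    exact: (@measurable_tnth _ R d i).
  by rewrite setTI; apply/seteqP; split => t /=; rewrite in_itv/= andbT.
by apply/seteqP; split => t /= h i; [move=> _; exact: h|exact: h].
Qed.

(** Dynkin induction on [E]. Truncation to a cube keeps every function square integrable, including
    those arising from the whole space and from complements. *)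
Lemma approx_indic n (E : set V) : measurable E ->
  approximable (fun t => (\1_E t * cube n t)%:C).
Proof.
have lE (F : set V) : measurable F -> l2 lebV (fun t => (\1_F t * cube n t)%:C).
  move=> mF; apply: (proj1 (@l2_le_fun _ _ _ _ _ (fun t => (cube n t)%:C) _ _ _)).
  - apply: cmeasC; apply: measurable_funM; first exact: measurable_indic.
    exact: measurable_boxf.
  - exact: l2_boxf.
  - move=> t; rewrite !sqmodC exprMn indicE; case: (_ \in _) => /=.
      by rewrite expr1n mul1r.
    by rewrite expr0n mul0r sqr_ge0.
rewrite measurable_orthants => sE.
apply: (@dynkin_induction _ V orthants
  (fun E => approximable (fun t => (\1_E t * cube n t)%:C))); last exact: sE.
- exact: measurable_orthants.
- move=> _ _ [x ->] [y ->]; exists [tuple Num.max (tnth x i) (tnth y i) | i < d].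
  apply/seteqP; split => t /=.
    by move=> [h1 h2] i; rewrite tnth_mktuple ge_max h1 h2.
  by move=> h; split => i; have := h i; rewrite tnth_mktuple ge_max => /andP[].
- rewrite (_ : (fun t => _) = fun t => (cube n t)%:C); first exact: approx_box.
  by apply/funext => t; rewrite indicE in_setT mul1r.
- move=> _ [x ->].
  rewrite (_ : (fun t => _) = fun t =>
    (boxf [tuple Num.max (tnth x i) (- n%:R) | i < d] (cst_tuple n%:R) t)%:C).
    exact: approx_box.
  apply/funext => t; congr (_ %:C).
  rewrite indicE; have [|/negP] := boolP (t \in _).
    rewrite inE/= => xt; rewrite mul1r; apply: eq_bigr => i _.
    rewrite !indicE; congr ((nat_of_bool _)%:R); apply/idP/idP; rewrite !inE/= !in_itv/= !tnth_mktuple.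
      by move=> /andP[h ->]; rewrite ge_max xt h.
    by move=> /andP[]; rewrite ge_max => /andP[_ ->].
  rewrite inE/= => /existsNP[i xt]; rewrite mul0r (@boxf_out _ _ _ i)//.
  by rewrite tnth_mktuple ge_max; apply/negP => /andP[/andP[/xt]].
- move=> S mS aS.
  rewrite (_ : (fun t => _) = fun t => (cube n t)%:C + (-1) * (\1_S t * cube n t)%:C).
    by apply: approxD; [exact: approx_box|exact: approxZ].
  apply/funext => t; rewrite mulN1r -rmorphN -rmorphD; congr (_%:C).
  by rewrite !indicE in_setC; case: (_ \in _) => /=; ring.
- move=> F mF tF aF.
  apply: (@approx_lim (fun k t => \sum_(j < k) (\1_(F j) t * cube n t)%:C)).
  + by move=> k; exact: approx_sum.
  + by apply: lE; exact: bigcup_measurable.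
  (* By disjointness the partial sums of the indicators are eventually constant at each point.
     Together with the bound by 1 below, this supplies the dominated convergence that handles
     countable unions. *)
  have key t : exists k0, forall k, (k0 <= k)%N ->
      \sum_(j < k) (\1_(F j) t : R) = \1_(\bigcup_k F k) t.
    have [[j _ Fj]|nF] := pselect ((\bigcup_k F k) t).
      exists j.+1 => k jk; rewrite [RHS]indicE mem_set; last by exists j.
      rewrite (bigD1 (Ordinal jk))//= indicE mem_set// big1 ?addr0// => i ij.
      rewrite indicE memNset// => Fi; move/eqP: ij; apply; apply/val_inj => /=.
      by apply: (tF i j) => //; exists t.
    exists 0%N => k _; rewrite [RHS]indicE memNset// big1// => j _.
    by rewrite indicE memNset// => Fj; apply: nF; exists j.
  have b01 k t : 0 <= \sum_(j < k) (\1_(F j) t : R) <= 1.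
    rewrite sumr_ge0//=.
    have [[j Fj]|nF] := pselect (exists j : 'I_k, F j t).
      rewrite (bigD1 j)//= big1 ?addr0 ?indicE ?lern1 ?leq_b1// => i ij.
      rewrite indicE memNset// => Fi; move/eqP: ij; apply; apply/val_inj => /=.
      by apply: (tF i j) => //; exists t.
    rewrite big1 ?ler01// => j _; rewrite indicE memNset// => Fj.
    by apply: nF; exists j.
  apply: (@nr_cvg _ _ _ _ _ _ (fun t => cube n t)).
  + by move=> k; apply: cmeas_sum => j; apply: cmeasC; apply: measurable_funM;
      [exact: measurable_indic|exact: measurable_boxf].
  + by apply: cmeasC; apply: measurable_funM; [apply: measurable_indic; exact: bigcup_measurable|exact: measurable_boxf].
  + apply: aeW => t; have [k0 hk0] := key t.
    have sE' k : \sum_(j < k) (\1_(F j) t * cube n t)%:C =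
        ((\sum_(j < k) (\1_(F j) t)) * cube n t)%:C by rewrite mulr_suml rmorph_sum.
    split; apply: cvg_near_cst; exists k0 => //= k hk; by rewrite sE' hk0.
  + exact: integrable_boxf.
  + move=> k t; rewrite -rmorph_sum -mulr_suml -rmorphB -mulrBl sqmodC exprMn.
    rewrite /cube boxf_sqr -[X in _ <= X]mul1r ler_wpM2r ?boxf_ge0//.
    have /andP[h1 h2] := b01 k t.
    have : 0 <= (\1_(\bigcup_k0 F k0) t : R) <= 1 by rewrite indicE; case: (_ \in _); rewrite /= ?ler01 ?lexx.
    move=> /andP[h3 h4]; set x := \sum_(j < k) _ in h1 h2 *; set y : R := \1__ t in h3 h4 *.
    have h5 : -1 <= x - y by lra.
    have h6 : x - y <= 1 by lra.
    by nra.
Qed.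

Import HBNNSimple.

Lemma approx_nonneg n (f : V -> R) : measurable_fun setT f -> (forall t, 0 <= f t) ->
  l2 lebV (fun t => (f t)%:C) -> approximable (fun t => (f t * cube n t)%:C).
Proof.
move=> mf f0 lf.
have mfE : measurable_fun [set: V] (fun t => (f t)%:E) by exact/measurable_EFinP.
pose g := nnsfun_approx measurableT mfE.
have g0 k t : 0 <= g k t by [].
have cvg_g t : (fun k => g k t) @ \oo --> f t.
  have f0E (x : V) : [set: V] x -> (0 <= (f x)%:E)%E by rewrite lee_fin.
  exact: (fine_cvg (@cvg_nnsfun_approx _ _ _ _ measurableT _ mfE f0E t I)).
have gf k t : g k t <= f t.
  have nd : nondecreasing_seq (fun k => g k t).
    by move=> i j ij; have /lefP := nd_nnsfun_approx measurableT mfE ij; exact.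
  rewrite -(cvg_lim _ (cvg_g t))//; apply: nondecreasing_cvgn_le => //.
  by apply/cvg_ex; exists (f t).
have lfc : l2 lebV (fun t => (f t * cube n t)%:C).
  apply: (proj1 (@l2_le_fun _ _ _ _ _ (fun t => (f t)%:C) _ _ _)) => //.
    by apply: cmeasC; apply: measurable_funM => //; exact: measurable_boxf.
  by move=> t; rewrite !sqmodC exprMn boxf_sqr ler_piMr ?sqr_ge0 ?boxf_le1.
apply: (@approx_lim (fun k t => (g k t * cube n t)%:C)) => //.
  move=> k; pose s : seq R := finmap.enum_fset (fset_set (g k @` setT)).
  rewrite (_ : (fun t => _) = fun t => \sum_(y <- s) y%:C * (\1_(g k @^-1` [set y]) t * cube n t)%:C).
    apply: approx_sum => y; apply: approxZ; exact: approx_indic.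
  apply/funext => t; rewrite (fimfunE (g k)) fsbig_finite//= mulr_suml rmorph_sum.
  by apply: eq_bigr => y _; rewrite -rmorphM mulrA.
apply: (@nr_cvg _ _ _ _ _ _ (fun t => sqmod (f t)%:C)).
- by move=> k; apply: cmeasC; apply: measurable_funM; [exact: measurable_funP|exact: measurable_boxf].
- by case: lfc.
- apply: aeW => t; split => /=; last exact: cvg_cst.
  by apply: cvgMr_tmp; exact: cvg_g.
- exact: l2_integrable.
- move=> k t; rewrite -rmorphB -mulrBl !sqmodC exprMn boxf_sqr.
  apply: (@le_trans _ _ ((g k t - f t) ^+ 2)); first by rewrite ler_piMr ?sqr_ge0 ?boxf_le1.
  have := gf k t; have := g0 k t; have := f0 t; nra.
Qed.

Lemma approx_real (f : V -> R) : measurable_fun setT f ->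
  l2 lebV (fun t => (f t)%:C) -> approximable (fun t => (f t)%:C).
Proof.
move=> mf lf.
have lm (p : V -> R) : measurable_fun setT p -> (forall t, `|p t| <= `|f t|) ->
    l2 lebV (fun t => (p t)%:C).
  move=> mp pf; apply: (proj1 (@l2_le_fun _ _ _ _ _ (fun t => (f t)%:C) _ _ _)) => //.
  move=> t; rewrite !sqmodC -[p t ^+ 2]real_normK ?num_real//.
  by rewrite -[f t ^+ 2]real_normK ?num_real// ler_sqr ?nnegrE.
have mp : measurable_fun setT (fun t => Num.max (f t) 0) by exact: measurable_maxr.
have mn : measurable_fun setT (fun t => Num.max (- f t) 0).
  by apply: measurable_maxr => //; exact: measurableT_comp.
apply: (@approx_lim (fun n t => (f t * cube n t)%:C)) => //.
  move=> n; rewrite (_ : (fun t => _) = fun t =>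
     (Num.max (f t) 0 * cube n t)%:C + (-1) * (Num.max (- f t) 0 * cube n t)%:C).
    apply: approxD; last apply: approxZ.
      apply: approx_nonneg => //; first by move=> t; rewrite le_max lexx orbT.
      by apply: lm => // t; case: (lerP (f t) 0) => h; rewrite ?normr0.
    apply: approx_nonneg => //; first by move=> t; rewrite le_max lexx orbT.
    by apply: lm => // t; case: (lerP (- f t) 0) => h; rewrite ?normr0 ?normrN.
  apply/funext => t; rewrite mulN1r -rmorphN -rmorphD; congr (_%:C).
  rewrite -mulrBl; congr (_ * _); 
  by case: (lerP (f t) 0) => h; case: (lerP (- f t) 0) => h'; lra.
apply: (@nr_cvg _ _ _ _ _ _ (fun t => sqmod (f t)%:C)).
- by move=> k; apply: cmeasC; apply: measurable_funM => //; exact: measurable_boxf.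
- exact: cmeasC.
- apply: aeW => t; split => /=; last exact: cvg_cst.
  by rewrite -[X in _ --> X](mulr1 (f t)); apply: cvgMl_tmp; exact: cvg_cube.
- exact: l2_integrable.
- move=> k t; rewrite -rmorphB !sqmodC -[X in (_ - X) ^+ 2]mulr1 -mulrBr exprMn.
  rewrite ler_piMr ?sqr_ge0//; case: (boxf_01 (cst_tuple (- k%:R)) (cst_tuple k%:R) t);
  by rewrite /cube => ->; rewrite ?subrr ?expr0n ?sub0r ?sqrrN ?expr1n ?ler01.
Qed.

Theorem step_dense (f : V -> C) : l2 lebV f ->
  forall e : R, 0 < e -> exists s, nr lebV (fun t => f t - stepf s t) < e.
Proof.
move=> lf; have [[mr mi] _] := lf.
suff [] : approximable f by [].
rewrite (_ : f = fun t => (cRe (f t))%:C + (0 +i* 1) * (cIm (f t))%:C); last first.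
  by apply/funext => t; apply: complex_ext; rewrite !cE /=; ring.
apply: approxD; last apply: approxZ.
  apply: approx_real => //; apply: (proj1 (@l2_le_fun _ _ _ _ _ f _ _ _)) => //.
  by move=> t; rewrite sqmodC /sqmod lerDl sqr_ge0.
apply: approx_real => //; apply: (proj1 (@l2_le_fun _ _ _ _ _ f _ _ _)) => //.
by move=> t; rewrite sqmodC /sqmod lerDr sqr_ge0.
Qed.

End boxes.

(** * Decay of inverse powers of an expansive matrix *)

Section spectral.
Variable n : nat.

Definition decays (F : numFieldType) (U : nat -> 'M[F]_n.+1) : Prop :=
  exists C r : F, [/\ 0 <= C, 0 <= r, r < 1 & forall k i j, `|U k i j| <= C * r ^+ k].

Lemma decays_recurrence (F : numFieldType) (w : F) (U : nat -> 'M[F]_n.+1) :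
  `|w| < 1 -> decays (fun k => U k.+1 - w *: U k) -> decays U.
Proof.
move=> w1 [C [r [C0 r0 r1 h]]].
(* This [rho] bounds both |w| and r without comparing them. The midpoint [s] between [rho] and 1
   leaves a gap s - rho that pays for the inhomogeneous term of the recurrence. *)
pose rho := 1 - (1 - `|w|) * (1 - r).
have wrho : `|w| <= rho.
  rewrite -subr_ge0 (_ : _ - _ = r * (1 - `|w|)); last by rewrite /rho; ring.
  by rewrite mulr_ge0// subr_ge0 ltW.
have rrho : r <= rho.
  rewrite -subr_ge0 (_ : _ - _ = `|w| * (1 - r)); last by rewrite /rho; ring.
  by rewrite mulr_ge0// subr_ge0 ltW.
have rho1 : rho < 1.
  by rewrite /rho ltrBlDr ltrDl mulr_gt0// subr_gt0.
have [rhos s1] := midf_lt rho1; set s := (rho + 1) / 2 in rhos s1.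
have rho0 : 0 <= rho := le_trans r0 rrho.
have s0 : 0 <= s := le_trans rho0 (ltW rhos).
have sr0 : 0 < s - rho by rewrite subr_gt0.
pose S := \sum_i \sum_j `|U 0%N i j|.
have S0 : 0 <= S by apply: sumr_ge0 => i _; apply: sumr_ge0 => j _.
(* The summand [S] covers k = 0; the other one makes C + rho C' <= s C', which is the induction
   step. *)
pose C' := S + C / (s - rho).
have C'0 : 0 <= C' by rewrite addr_ge0// divr_ge0// ltW.
exists C', s; split => // k i j; elim: k => [|k IH].
  rewrite expr0 mulr1; apply: (@le_trans _ _ S); last by rewrite lerDl divr_ge0// ltW.
  rewrite /S (bigD1 i)//= (bigD1 j)//= -addrA lerDl addr_ge0//; first exact: sumr_ge0.
  by apply: sumr_ge0 => i' _; exact: sumr_ge0.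
have := h k i j; rewrite !mxE => hk.
rewrite -[U k.+1 i j](subrK (w * U k i j)).
apply: (le_trans (ler_normD _ _)); rewrite normrM.
apply: (@le_trans _ _ (C * s ^+ k + rho * (C' * s ^+ k))).
  apply: lerD; last exact: ler_pM.
  apply: (le_trans hk); apply: ler_wpM2l => //; apply: lerXn2r; rewrite ?nnegrE//.
  exact: le_trans rrho (ltW rhos).
rewrite -subr_ge0 (_ : _ - _ = S * (s - rho) * s ^+ k).
  by rewrite mulr_ge0 ?exprn_ge0// mulr_ge0// ltW.
have -> : C = (C' - S) * (s - rho) by rewrite /C' addrAC subrr add0r divfK ?gt_eqF.
by rewrite exprS; ring.
Qed.

Lemma decays_scale (F : numFieldType) (c : F) (U : nat -> 'M[F]_n.+1) :
  decays U -> decays (fun k => c *: U k).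
Proof.
move=> [C [r [C0 r0 r1 h]]]; exists (`|c| * C), r; split => //.
  by rewrite mulr_ge0.
by move=> k i j; rewrite mxE normrM -mulrA ler_wpM2l.
Qed.

(** A replacement for the Jordan form. Peeling off one factor, B^(k+1) M - z^-1 B^k M = - z^-1
    B^(k+1) (A - z) M, and the right side decays by induction on the list of roots because (A - z) M
    is annihilated by the remaining factors. As |z^-1| < 1, the recurrence lemma applies. *)
Lemma decays_prod (F : numFieldType) (A B M : 'M[F]_n.+1) (s : seq F) :
  B * A = 1 -> (forall z, z \in s -> 1 < `|z|) ->
  (\prod_(z <- s) (A - z%:M)) * M = 0 -> decays (fun k => B ^+ k * M).
Proof.
move=> BA; elim: s M => [|z s IH] M hs.
  rewrite big_nil mul1r => ->; exists 0, 0; split => //.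
  by move=> k i j; rewrite mulr0 mxE normr0 mul0r.
rewrite big_cons => h0.
have comm_z : GRing.comm (\prod_(z <- s) (A - z%:M)) (A - z%:M).
  have cz c : GRing.comm A c%:M by rewrite /GRing.comm -!mulmxE scalar_mxC.
  apply: commr_sym; apply: commr_prod => y _; apply: commrB; apply: commr_sym; apply: commrB.
  - exact: commr_refl.
  - exact: cz.
  - exact/commr_sym/cz.
  - by rewrite /GRing.comm -!mulmxE scalar_mxC.
have z1 : 1 < `|z| by apply: hs; rewrite mem_head.
have z0 : z != 0 by rewrite -normr_eq0 gt_eqF// (lt_trans ltr01).
have [] := IH ((A - z%:M) * M).
- by move=> y ys; apply: hs; rewrite inE ys orbT.
- by rewrite mulrA comm_z.
move=> C [r [C0 r0 r1 h]].
apply: (@decays_recurrence _ z^-1); first by rewrite normfV invf_lt1// (lt_trans ltr01).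
have E k : B ^+ k.+1 * M - z^-1 *: (B ^+ k * M) =
    - z^-1 *: (B ^+ k.+1 * ((A - z%:M) * M)).
  rewrite mulrA mulrBr mulrBl scalerBr exprSr -[B ^+ k * B * A]mulrA BA mulr1.
  rewrite !scaleNr opprK addrC; congr (_ + _).
  have -> : z%:M = z *: (1 : 'M[F]_n.+1) by rewrite -scalemx1.
  by rewrite -scalerAr mulr1 -scalerAl scalerA mulVf// scale1r.
under eq_fun do rewrite E; apply: decays_scale.
exists (C * r), r; split => //; first by rewrite mulr_ge0.
by move=> k i j; rewrite -mulrA -exprS.
Qed.

Lemma decays_expansive (A : 'M[int]_n.+1) (B : 'M[algC]_n.+1) : expansive A ->
  B * map_mx intr A = 1 -> decays (fun k => B ^+ k).
Proof.
move=> hA BA; set Ac := map_mx intr A in BA *.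
have [s ps] := closed_field_poly_normal (char_poly Ac).
have : char_poly Ac \is monic := char_poly_monic _.
rewrite monicE => /eqP lc; rewrite lc scale1r in ps.
have H : (\prod_(z <- s) (Ac - z%:M)) * 1 = 0.
  have := Cayley_Hamilton Ac; rewrite ps rmorph_prod/= mulr1 => <-.
  by apply: eq_bigr => z _; rewrite rmorphB /= horner_mx_X horner_mx_C.
have [] := decays_prod BA _ H.
  by move=> z zs; apply: hA; rewrite ps root_prod_XsubC.
move=> C [r [C0 r0 r1 h]]; exists C, r; split => // k i j.
by have := h k i j; rewrite mulr1.
Qed.

End spectral.

(** * Transfer of the decay to real matrices *)

Section expansive_real.
Variables (R : realType) (d : nat) (A : 'M[int]_d).
Hypothesis hexp : expansive A.
Hypothesis hdet : `|\det A| = 2 :> int.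

Lemma det_intr_neq0 (F : numFieldType) : \det (map_mx intr A : 'M[F]_d) != 0.
Proof.
rewrite (det_map_mx (intr : {rmorphism int -> F})) intr_eq0 -normr_eq0 hdet.
by [].
Qed.

Lemma unitmx_intr (F : numFieldType) : (map_mx intr A : 'M[F]_d) \in unitmx.
Proof. by rewrite unitmxE unitfE det_intr_neq0. Qed.

(** Expansivity speaks of eigenvalues in [algC], while the estimate is wanted in [R]. The entries of
    the powers of the inverse are rational, so the bound travels from [algC] to [R] through [rat],
    once its constants have been made rational. In dimension 0 there are no entries to bound. *)
Lemma expansive_decay : exists C r : R, [/\ 0 <= C, 0 < r, r < 1 &
  forall k i j, `|(invmx (mxR R A) ^+ k) i j| <= C * r ^+ k].
Proof.
move: hexp hdet unitmx_intr; case: d A => [|m] A' hexp' hdet' uA.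
  by exists 0, 2^-1; split => //; [lra|move=> k []].
pose Bq : 'M[rat]_m.+1 := invmx (map_mx intr A').
pose Bc : 'M[algC]_m.+1 := map_mx ratr Bq.
have BA : Bc * map_mx intr A' = 1.
  have -> : map_mx intr A' = map_mx ratr (map_mx intr A' : 'M[rat]_m.+1) :> 'M[algC]_m.+1.
    by apply/matrixP => i j; rewrite !mxE ratr_int.
  by rewrite -mulmxE /Bc -(map_mxM (ratr : {rmorphism rat -> algC})) mulVmx ?uA// map_mx1.
have [C [r [C0 r0 r1 h]]] := decays_expansive hexp' BA.
have hr : 0 < 1 - r by rewrite subr_gt0.
(* The constants found in [algC] are enlarged to rational ones: a natural number above [C], and q =
   1 - 1/m' with 1/m' <= 1 - r, hence r <= q < 1. *)
pose N := Num.bound C; pose m' := (Num.bound (1 - r)^-1).+1.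
have CN : C <= N%:R := ltW (archi_boundP C0).
pose q : rat := 1 - m'%:R^-1.
have m'2 : (1 < m')%N.
  rewrite /m' ltnS lt0n; apply/eqP => h0.
  have := archi_boundP (ltW (_ : 0 < (1 - r)^-1)); rewrite invr_gt0 => /(_ hr).
  by rewrite h0 => /lt_gtF; rewrite invr_gt0 hr.
have q0 : 0 < q by rewrite /q subr_gt0 invf_lt1 ?ltr1n ?ltr0n.
have q1 : q < 1 by rewrite /q ltrBlDr ltrDl invr_gt0 ltr0n.
have rq : r <= ratr q.
  rewrite /q rmorphB rmorph1 fmorphV rmorph_nat lerBrDl -lerBrDr.
  rewrite -[X in _ <= X]invrK lef_pV2 ?posrE ?invr_gt0 ?ltr0n//.
  rewrite /m' -natr1 (le_trans (ltW (archi_boundP _)))// ?invr_ge0 ?ltW//.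
  by rewrite ltrDl.
have hq k i j : `|(Bq ^+ k) i j| <= N%:R * q ^+ k.
  have := h k i j.
  have -> : Bc ^+ k = map_mx ratr (Bq ^+ k).
    elim: k => [|k IH]; first by rewrite !expr0 map_mx1.
    by rewrite !exprS IH -!mulmxE map_mxM.
  rewrite mxE => hk; rewrite -(ler_rat algC) rmorphM rmorphXn/= ratr_nat ratr_norm.
  apply: (le_trans hk); apply: ler_pM => //; first exact: exprn_ge0.
  by apply: lerXn2r; rewrite ?nnegrE// (le_trans r0).
exists N%:R, (ratr q); split.
- exact: ler0n.
- by rewrite ltr0q.
- by rewrite -(rmorph1 (ratr : {rmorphism rat -> R})) ltr_rat.
- move=> k i j.
  have -> : invmx (mxR R A') ^+ k = map_mx ratr (Bq ^+ k).
    have E : mxR R A' = map_mx ratr (map_mx intr A' : 'M[rat]_m.+1).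
      by apply/matrixP => i' j'; rewrite !mxE ratr_int.
    elim: k => [|k IH]; first by rewrite !expr0 map_mx1.
    by rewrite !exprS IH -!mulmxE map_mxM /Bq map_invmx -E.
  by rewrite mxE -ratr_norm -(ratr_nat R N) -rmorphXn -rmorphM ler_rat.
Qed.

Lemma unit_mxR : mxR R A \in unitmx. Proof. exact: unitmx_intr. Qed.

Lemma expmx_tr (M : 'M[R]_d) k : (M^T) ^+ k = (M ^+ k)^T.
Proof.
elim: k => [|k IH]; first by rewrite !expr0 trmx1.
by rewrite exprS IH -mulmxE -trmx_mul mulmxE -exprSr.
Qed.

Lemma norm_actM_le (M : 'M[R]_d) (t : d.-tuple R) (c rho : R) :
  0 <= c -> (forall i j, `|M i j| <= c) -> (forall j, `|tnth t j| <= rho) ->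
  forall i, `|tnth (actM M t) i| <= d%:R * c * rho.
Proof.
move=> c0 Mc tr i; rewrite tnth_actM.
apply: (le_trans (ler_norm_sum _ _ _)).
apply: (@le_trans _ _ (\sum_(j < d) c * rho)).
  by apply: ler_sum => j _; rewrite normrM ler_pM.
by rewrite sumr_const card_ord -mulrA mulr_natl.
Qed.

Lemma expansive_actM_decay : exists C r : R, [/\ 0 <= C, 0 < r, r < 1 &
  forall k (t : d.-tuple R) rho, (forall j, `|tnth t j| <= rho) ->
   (forall i, `|tnth (actM (invmx (mxR R A) ^+ k) t) i| <= C * r ^+ k * rho) /\
   (forall i, `|tnth (actM (ATinv R A ^+ k) t) i| <= C * r ^+ k * rho)].
Proof.
have [C [r [C0 r0 r1 h]]] := expansive_decay.
exists (d%:R * C), r; split => //; first by rewrite mulr_ge0.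
have c0 k : 0 <= C * r ^+ k by rewrite mulr_ge0// exprn_ge0// ltW.
move=> k t rho ht; split => i; rewrite -[d%:R * C * _]mulrA; apply: norm_actM_le => //.
move=> i' j'; rewrite /ATinv.
have -> : invmx (mxR R A)^T = (invmx (mxR R A))^T by rewrite trmx_inv.
by rewrite expmx_tr mxE.
Qed.

End expansive_real.

(** * Fourier transforms of damped intervals *)

Section expi_lemmas.
Variable R : realType.

Lemma expiD (x y : R) : expi (x + y) = expi x * expi y.
Proof. by apply: complex_ext; rewrite !cE /= ?cosD ?sinD; ring. Qed.

Lemma expi0 : expi (0 : R) = 1.
Proof. by apply: complex_ext => /=; rewrite ?cos0 ?sin0. Qed.

Lemma expi_sum (I : Type) (s : seq I) (F : I -> R) :
  expi (\sum_(i <- s) F i) = \prod_(i <- s) expi (F i).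
Proof. by elim/big_rec2 : _ => [|i x y _ <-]; rewrite ?expi0 ?expiD. Qed.

Lemma sqmod_expi (x : R) : sqmod (expi x) = 1.
Proof. by rewrite /sqmod /= cos2Dsin2. Qed.

Lemma cabs_expi (x : R) : cabs (expi x) = 1.
Proof. by rewrite /cabs sqmod_expi sqrtr1. Qed.

Lemma MVT_le1 (f df : R -> R) (x : R) : (forall z : R, is_derive z (1 : R) f (df z)) ->
  (forall z, `|df z| <= 1) -> `|f x - f 0| <= `|x|.
Proof.
move=> fd df1.
have cf : continuous f.
  by move=> z; apply: differentiable_continuous; apply/derivable1_diffP; apply: (@ex_derive _ _ _ _ _ _ _ (fd z)).
have [x0|x0] := leP 0 x.
  have [c _ ->] := MVT_segment x0 (fun z _ => fd z) (continuous_subspaceT cf).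
  by rewrite subr0 normrM ler_piMl.
have [c _ h] := MVT_segment (ltW x0) (fun z _ => fd z) (continuous_subspaceT cf).
by rewrite distrC h sub0r normrM normrN ler_piMl.
Qed.

Lemma cabs_expi_sub1 (x : R) : cabs (expi x - 1) <= 2 * `|x|.
Proof.
apply: (le_trans (cabs_le _)); rewrite cReB cImB /= subr0.
have h1 : `|cos x - 1| <= `|x|.
  rewrite -[X in _ - X](@cos0 R); apply: (@MVT_le1 _ (fun z => - sin z)).
  by move=> z; rewrite normrN sin_max.
have h2 : `|sin x| <= `|x|.
  rewrite -[X in `|X| <= _]subr0 -[X in _ - X](@sin0 R).
  by apply: (@MVT_le1 _ (fun z => cos z)) => z; exact: cos_max.
by rewrite mulr2n mulrDl mul1r lerD.
Qed.

End expi_lemmas.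

Section laplace.
Variable R : realType.
Local Notation RR := (measurableTypeR R).
Local Notation leb := (@lebesgue_measure R).

Implicit Types e a b s x y : R.

(** The Laplace kernel. Its transform is the Poisson kernel, whose integral over an interval is an
    explicit difference of arctangents. *)
Definition lapl (e x : R) : R := expR (- (e * `|x|)).

Lemma lapl_ge0 e x : 0 <= lapl e x. Proof. exact: expR_ge0. Qed.

Lemma continuous_lapl e : continuous (lapl e).
Proof.
move=> x; apply: continuous_comp; last exact: continuous_expR.
apply: continuousN; apply: continuousM; first exact: cst_continuous.
exact: norm_continuous.
Qed.

Lemma measurable_lapl e : measurable_fun [set: R] (lapl e).
Proof. exact: continuous_measurable_fun (@continuous_lapl e). Qed.

Lemma cvgy_expR_lin (e : R) : 0 < e -> expR (- (e * x)) @[x --> +oo] --> (0 : R).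
Proof.
move=> e0; apply: (cvg_comp (fun x => e * x) (fun x => expR (- x))); last exact: cvgr_expR.
exact: (gt0_cvgMry e0 cvg_id).
Qed.

Lemma continuous_cos_lin (y : R) : continuous (fun x : R => cos (y * x)).
Proof.
move=> x; apply: continuous_comp; last exact: continuous_cos.
by apply: continuousM; [exact: cst_continuous|exact: cvg_id].
Qed.

(** Adding 1 to the cosine makes the integrand nonnegative, so that evenness and the fundamental
    theorem on a half-line apply in their nonnegative forms. The case y = 0 gives the integral of
    [lapl] itself, and subtraction then isolates the cosine. *)
Lemma integral_lapl_1Dcos (e y : R) : 0 < e ->
  (\int[leb]_x (lapl e x * (1 + cos (y * x)))%:E =
   (2 * (e^-1 + e / (e ^+ 2 + y ^+ 2)))%:E)%E.
Proof.
move=> e0.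
have f0 x : 0 <= 1 + cos (y * x) by have := cos_geN1 (y * x); lra.
have cf : continuous (fun x => lapl e x * (1 + cos (y * x))).
  move=> x; apply: continuousM; first exact: continuous_lapl.
  by apply: continuousD; [exact: cst_continuous|exact: continuous_cos_lin].
have cf2 : continuous (fun x => expR (- (e * x)) * (1 + cos (y * x))).
  move=> x; apply: cvgM.
    apply: continuous_comp; last exact: continuous_expR.
    by apply: continuousN; apply: continuousM; [exact: cst_continuous|exact: cvg_id].
  by apply: cvgD; [exact: cvg_cst|exact: continuous_cos_lin].
rewrite ge0_symfun_integralT//; last 2 first.
- by move=> x; rewrite mulr_ge0 ?lapl_ge0.
- by move=> x /=; rewrite /lapl normrN mulrN cosN.
rewrite EFinM; congr (_ * _)%E.
rewrite -set_itvcy.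
rewrite (eq_integral (fun x : RR => (expR (- (e * x)) * (1 + cos (y * x)))%:E)); last first.
  by move=> x; rewrite inE/= in_itv/= andbT /lapl => x0; rewrite ger0_norm.
pose D := e ^+ 2 + y ^+ 2.
have D0 : 0 < D by rewrite ltr_pwDl ?sqr_ge0// exprn_gt0.
pose F (x : R) := expR (- (e * x)) * (- e^-1) +
  expR (- (e * x)) * (y * sin (y * x) - e * cos (y * x)) * D^-1.
have dF (x : R) : is_derive x 1 F (expR (- (e * x)) * (1 + cos (y * x))).
  apply: is_derive_eq; rewrite /GRing.scale/= ?mulr1 /D.
  by field; rewrite !gt_eqF.
have cF : continuous F.
  by move=> z; apply: differentiable_continuous; apply/derivable1_diffP; apply: (@ex_derive _ _ _ _ _ _ _ (dF z)).
rewrite (@ge0_continuous_FTC2y _ _ F 0 0).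
- rewrite /F !mulr0 oppr0 expR0 sin0 cos0 !mul1r mulr0 sub0r mulr1 -EFinB; congr EFin.
  by rewrite /D; ring.
- by move=> x _; rewrite mulr_ge0 ?expR_ge0.
- exact: (continuous_subspaceT cf2).
- apply: (@squeeze_cvgr _ _ _ _
    (fun x => - (expR (- (e * x)) * (e^-1 + (`|y| + e) / D)))
    (fun x => expR (- (e * x)) * (e^-1 + (`|y| + e) / D))).
  + apply: nearW => x; rewrite -ler_norml /F -mulrA -mulrDr normrM (ger0_norm (expR_ge0 _)).
    rewrite ler_wpM2l ?expR_ge0// (le_trans (ler_normD _ _))// lerD//.
      by rewrite normrN ger0_norm// invr_ge0 ltW.
    rewrite normrM (ger0_norm (_ : 0 <= D^-1)) ?invr_ge0 ?(ltW D0)//.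
    rewrite ler_wpM2r ?invr_ge0 ?(ltW D0)// (le_trans (ler_normB _ _))//.
    rewrite !normrM (ger0_norm (ltW e0)) lerD// ?ler_piMr// ?sin_max ?cos_max// ltW//.
  + rewrite -oppr0; apply: cvgN; rewrite -[X in _ --> X](mul0r (e^-1 + (`|y| + e) / D)).
    by apply: cvgMr_tmp; exact: cvgy_expR_lin.
  + rewrite -[X in _ --> X](mul0r (e^-1 + (`|y| + e) / D)).
    by apply: cvgMr_tmp; exact: cvgy_expR_lin.
- by move=> x _; apply: (@ex_derive _ _ _ _ _ _ _ (dF x)).
- by apply: cvg_at_right_filter; exact: cF.
- by move=> x _; rewrite derive1E; exact: (@derive_val _ _ _ _ _ _ _ (dF x)).
Qed.

Lemma integral_lapl (e : R) : 0 < e -> (\int[leb]_x (lapl e x)%:E = (2 / e)%:E)%E.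
Proof.
move=> e0; have := integral_lapl_1Dcos 0 e0.
under eq_integral do rewrite mul0r cos0 mulrC EFinM.
rewrite ge0_integralZl_EFin//; last 2 first.
- by move=> x _; rewrite lee_fin lapl_ge0.
- by apply/measurable_EFinP; exact: measurable_lapl.
move=> h; have : ((2^-1)%:E * ((1 + 1)%:E * \int[leb]_x (lapl e x)%:E) = (2^-1)%:E *
   (2 * (e^-1 + e / (e ^+ 2 + 0 ^+ 2)))%:E)%E by rewrite h.
rewrite muleA -!EFinM mulVf ?mul1e// => ->; congr EFin.
by rewrite expr0n/= addr0; field; rewrite gt_eqF.
Qed.

Lemma integrable_lapl (e : R) : 0 < e -> leb.-integrable setT (fun x => (lapl e x)%:E).
Proof.
move=> e0; apply/integrableP; split; first by apply/measurable_EFinP; exact: measurable_lapl.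
rewrite (eq_integral (fun x : RR => (lapl e x)%:E)) ?integral_lapl ?ltry// => x _.
by rewrite /= ger0_norm ?lapl_ge0.
Qed.

Lemma cmeas1_lin (y : R) : @cmeas _ RR R (fun x => expi (y * x)).
Proof.
have h : measurable_fun [set: R] (fun x : R => y * x) by exact: measurable_funM.
exact: (@cmeas_expi _ RR R (fun x => y * x) h).
Qed.

Lemma cintegrable_lapl (e y : R) : 0 < e ->
  cintegrable leb (fun x => (lapl e x)%:C * expi (y * x)).
Proof.
move=> e0; apply: (@cintegrable_le _ RR R leb _ (lapl e)).
- by apply: cmeasM; [apply: cmeasC; exact: measurable_lapl|exact: cmeas1_lin].
- exact: integrable_lapl.
- by move=> x; rewrite cabsM cabs_expi mulr1 cabsC ger0_norm ?lapl_ge0.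
Qed.

Lemma cint_lapl (e y : R) : 0 < e ->
  cint leb (fun x => (lapl e x)%:C * expi (y * x)) = (2 * e / (e ^+ 2 + y ^+ 2))%:C.
Proof.
move=> e0; have [i1 i2] := cintegrable_lapl y e0; apply: complex_ext => /=.
  have E : (\int[leb]_x (cRe ((lapl e x)%:C * expi (y * x)))%:E =
     \int[leb]_x ((lapl e x * (1 + cos (y * x)))%:E - (lapl e x)%:E))%E.
    by apply: eq_integral => x _; rewrite !cE /= -EFinB; congr EFin; ring.
  rewrite E integralB//.
  - rewrite integral_lapl_1Dcos// integral_lapl// -EFinB /=.
    have D0 : 0 < e ^+ 2 + y ^+ 2 by rewrite ltr_pwDl ?sqr_ge0// exprn_gt0.
    by field; rewrite !gt_eqF.
  - have : leb.-integrable setT (fun x => (lapl e x)%:E + (cRe ((lapl e x)%:C * expi (y * x)))%:E)%E.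
      by apply: integrableD => //; exact: integrable_lapl.
    apply: eq_integrable => // x _; rewrite !cE /= -EFinD; congr EFin; ring.
  - exact: integrable_lapl.
(* The imaginary part is odd: the substitution x -> - x shows that its integral equals its own
   negative. *)
have mN := @measurable_affine R (-1) 0.
have sN (F : RR -> \bar R) : measurable_fun setT F -> (forall t, 0 <= F t)%E ->
    (\int[leb]_t F (-1 * t + 0)%R = 1%R%:E * \int[leb]_t F t)%E.
  move=> mF F0; rewrite (@ge0_integral_affine R (-1) 0 F)// ?normrN1 ?invr1//.
have [_ h] := scaling_integral mN sN i2.
have E : (\int[leb]_t (cIm ((lapl e (-1 * t + 0))%:C * expi (y * (-1 * t + 0))))%:E =
  \int[leb]_t ((-1)%:E * (cIm ((lapl e t)%:C * expi (y * t)))%:E))%E.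
  apply: eq_integral => t _; rewrite -EFinM; congr EFin; rewrite !cE /= /lapl.
  by rewrite mulN1r addr0 normrN mulrN sinN; ring.
move: h; rewrite mul1e E integralZl// => h.
have fi := integrable_fin_num measurableT i2.
have := congr1 fine h; rewrite fineM//= => ?; lra.
Qed.

End laplace.

(** * Poisson smoothing of an interval *)

Section smoothed_interval.
Variable R : realType.
Local Notation RR := (measurableTypeR R).
Local Notation leb := (@lebesgue_measure R).

Implicit Types e a b s x y : R.

Definition itvf (a b x : R) : R := \1_(`[a, b]%classic) x.

Lemma measurable_itvf a b : measurable_fun [set: R] (itvf a b).
Proof. exact: measurable_indic. Qed.

Lemma itvf_ge0 a b x : 0 <= itvf a b x. Proof. by []. Qed.

Lemma itvf_sqr a b x : itvf a b x ^+ 2 = itvf a b x.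
Proof. by rewrite /itvf indicE; case: (_ \in _); rewrite /= ?expr1n ?expr0n. Qed.

Lemma integral_itvf a b : (\int[leb]_x (itvf a b x)%:E = (Num.max 0 (b - a))%:E)%E.
Proof.
rewrite /itvf integral_indic//= setIT lebesgue_measure_itv/= lte_fin.
have [ab|ba] := ltP; first by rewrite -EFinB max_r// subr_ge0 ltW.
by rewrite max_l// subr_le0.
Qed.

Lemma integrable_itvf a b : leb.-integrable setT (fun x => (itvf a b x)%:E).
Proof.
apply/integrableP; split; first by apply/measurable_EFinP; exact: measurable_itvf.
rewrite (eq_integral (fun x : RR => (itvf a b x)%:E)) ?integral_itvf ?ltry// => x _.
by rewrite /= ger0_norm ?itvf_ge0.
Qed.

(* The Fourier transform of the interval damped by [lapl e]; transforming once
   more yields the convolution of the interval with the Poisson kernel. *)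
Definition damped (e a b x : R) : R[i] :=
  (lapl e x)%:C * cint leb (fun al => (itvf a b al)%:C * expi (al * x)).

(** The integral over [a, b] of the kernel 2 e / (e^2 + (x - s)^2), of total mass 2 pi. The guard
    gives 0 for an empty interval, where the arctangent formula would be negative. *)
Definition smoothed (e a b s : R) : R :=
  if a < b then 2 * (atan ((b - s) / e) - atan ((a - s) / e)) else 0.

Lemma cmeas_damped e a b : @cmeas _ RR _ (damped e a b).
Proof.
apply: cmeasM; first by apply: cmeasC; exact: measurable_lapl.
apply: (@cmeas_cint_param1 _ _ RR RR R leb (fun p => (itvf a b p.2)%:C * expi (p.2 * p.1))).
apply: cmeasM.
  apply: cmeasC; exact: (measurableT_comp (@measurable_itvf a b) (@measurable_snd _ _ RR RR)).
apply: cmeas_expi; apply: measurable_funM; first exact: (@measurable_snd _ _ RR RR).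
exact: (@measurable_fst _ _ RR RR).
Qed.

Lemma cintegrable_itvf a b (x : R) :
  cintegrable leb (fun al => (itvf a b al)%:C * expi (al * x)).
Proof.
apply: (@cintegrable_le _ RR R leb _ (itvf a b)).
- apply: cmeasM; first by apply: cmeasC; exact: measurable_itvf.
  by under eq_fun do rewrite mulrC; exact: cmeas1_lin.
- exact: integrable_itvf.
- by move=> al; rewrite cabsM cabs_expi mulr1 cabsC ger0_norm.
Qed.

Lemma cabs_damped e a b x : cabs (damped e a b x) <= lapl e x * Num.max 0 (b - a).
Proof.
rewrite /damped cabsM cabsC ger0_norm ?lapl_ge0// ler_wpM2l ?lapl_ge0//.
apply: (le_trans (cabs_cint (cintegrable_itvf a b x))).
rewrite (eq_integral (fun al : RR => (itvf a b al)%:E)) ?integral_itvf//= => al _.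
by rewrite cabsM cabs_expi mulr1 cabsC ger0_norm.
Qed.

Lemma cintegrable_damped e a b : 0 < e -> cintegrable leb (damped e a b).
Proof.
move=> e0; apply: (@cintegrable_le _ RR R leb _ (fun x => lapl e x * Num.max 0 (b - a))).
- exact: cmeas_damped.
- under eq_fun do rewrite mulrC EFinM.
  by apply: integrableZl => //; exact: integrable_lapl.
- exact: cabs_damped.
Qed.

Lemma l2_damped e a b : 0 < e -> l2 leb (damped e a b).
Proof.
move=> e0; apply: (proj1 (@l2_le _ RR R leb _ (fun x => Num.max 0 (b - a) ^+ 2 * lapl e x) _ _ _)).
- exact: cmeas_damped.
- under eq_fun do rewrite EFinM.
  by apply: integrableZl => //; exact: integrable_lapl.
- move=> x; apply: (le_trans (sqmod_le_cabs (cabs_damped e a b x))).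
  rewrite exprMn mulrC ler_wpM2l ?sqr_ge0// expr2 ler_piMl ?lapl_ge0//.
  by rewrite /lapl -[X in _ <= X]expR0 ler_expR oppr_le0 mulr_ge0// ltW.
Qed.

Lemma is_derive_atan_lin (e s x : R) : 0 < e ->
  is_derive x 1 (fun x : R => 2 * atan ((x - s) / e)) (2 * e / (e ^+ 2 + (x - s) ^+ 2)).
Proof.
move=> e0; apply: is_derive_eq; rewrite /GRing.scale/= ?mulr1 mulr0 add0r subr0.
have D0 : 0 < e ^+ 2 + (x - s) ^+ 2 by rewrite ltr_pwDl ?sqr_ge0// exprn_gt0.
have D1 : 0 < 1 + ((x - s) / e) ^+ 2 by rewrite ltr_pwDl ?sqr_ge0.
have -> : 1 + ((x - s) / e) ^+ 2 = (e ^+ 2 + (x - s) ^+ 2) / e ^+ 2.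
  by field; rewrite gt_eqF.
by field; rewrite !gt_eqF.
Qed.

Lemma continuous_atan_lin (e s : R) : 0 < e -> continuous (fun x : R => 2 * atan ((x - s) / e)).
Proof.
move=> e0 z; apply: differentiable_continuous; apply/derivable1_diffP.
by apply: (@ex_derive _ _ _ _ _ _ _ (is_derive_atan_lin s z e0)).
Qed.

Lemma continuous_poisson (e s : R) : 0 < e ->
  continuous (fun x => 2 * e / (e ^+ 2 + (x - s) ^+ 2)).
Proof.
move=> e0 x; apply: cvgM; first exact: cvg_cst.
apply: cvgV; first by rewrite gt_eqF// ltr_pwDl ?sqr_ge0// exprn_gt0.
apply: cvgD; first exact: cvg_cst.
apply: (@continuous_comp _ _ _ (fun z : R => z - s) (fun z : R => z ^+ 2)).
  by apply: cvgB; [exact: cvg_id|exact: cvg_cst].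
exact: exprn_continuous.
Qed.

Lemma integral_poisson (e a b s : R) : 0 < e ->
  (\int[leb]_al (itvf a b al * (2 * e / (e ^+ 2 + (al - s) ^+ 2)))%:E = (smoothed e a b s)%:E)%E.
Proof.
move=> e0; rewrite /smoothed.
have E : (\int[leb]_al (itvf a b al * (2 * e / (e ^+ 2 + (al - s) ^+ 2)))%:E =
   \int[leb]_(al in `[a, b]) (2 * e / (e ^+ 2 + (al - s) ^+ 2))%:E)%E.
  rewrite [RHS]integral_mkcond; apply: eq_integral => al _.
  rewrite /itvf indicE patchE; case: (_ \in _); rewrite ?mul1r ?mul0r//.
rewrite E; case: ifPn => [ab|].
  rewrite (@continuous_FTC2 _ _ (fun x : R => 2 * atan ((x - s) / e)))//.
  - by rewrite -EFinB -mulrBr.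
  - exact/continuous_subspaceT/continuous_poisson.
  - split.
    + by move=> x _; apply: (@ex_derive _ _ _ _ _ _ _ (is_derive_atan_lin s x e0)).
    + by apply: cvg_at_right_filter; exact: continuous_atan_lin.
    + by apply: cvg_at_left_filter; exact: continuous_atan_lin.
  - by move=> x _; rewrite derive1E; exact: (@derive_val _ _ _ _ _ _ _ (is_derive_atan_lin s x e0)).
rewrite -leNgt => ba; rewrite (@integral_Sset1 _ _ _ a)// => x /=.
rewrite in_itv/= => /andP[ax xb]; apply/eqP; rewrite eq_le ax andbT.
exact: le_trans xb ba.
Qed.


Lemma measurable_smoothed e a b : 0 < e -> measurable_fun [set: R] (smoothed e a b).
Proof.
move=> e0; rewrite /smoothed; case: (a < b); last exact: measurable_cst.
have h c : measurable_fun [set: R] (fun s => atan ((c - s) / e)).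
  apply: (measurableT_comp (continuous_measurable_fun (@continuous_atan R))).
  by apply: measurable_funM => //; apply: measurable_funB.
by apply: measurable_funM => //; apply: measurable_funB.
Qed.

Lemma smoothed_MVT e a b s : 0 < e -> a < b -> exists2 c, a < c < b &
  smoothed e a b s = 2 * e / (e ^+ 2 + (c - s) ^+ 2) * (b - a).
Proof.
move=> e0 ab; rewrite /smoothed ab.
have [c cab h] := MVT ab (fun z _ => is_derive_atan_lin s z e0)
  (continuous_subspaceT (@continuous_atan_lin e s e0)).
exists c; first by move: cab; rewrite in_itv.
by rewrite -h mulrBr.
Qed.

Lemma smoothed_ge0 e a b s : 0 < e -> 0 <= smoothed e a b s.
Proof.
move=> e0; have [ab|ba] := ltP a b; last by rewrite /smoothed ltNge ba.
have [c _ ->] := smoothed_MVT s e0 ab.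
have D0 : 0 < e ^+ 2 + (c - s) ^+ 2 by rewrite ltr_pwDl ?sqr_ge0// exprn_gt0.
by rewrite mulr_ge0 ?subr_ge0 ?(ltW ab)// divr_ge0 ?mulr_ge0// ltW.
Qed.

Lemma smoothed_le e a b s : 0 < e -> smoothed e a b s <= 2 * pi.
Proof.
move=> e0; rewrite /smoothed; case: ifP => _; last by rewrite mulr_ge0// pi_ge0.
have := atan_ltpi2 ((b - s) / e); have := atan_gtNpi2 ((a - s) / e); lra.
Qed.

(** An integrable majorant independent of [e], needed to let [e] tend to 0 under the integral. Near
    the interval the total mass 2 pi bounds the value; far away the mean value form does, since
    every point of the interval is then at distance at least |s| / 2 from [s]. *)
Lemma smoothed_decay (a b : R) : exists2 c, 0 <= c &
  forall e s, 0 < e -> e <= 1 -> smoothed e a b s <= c / (1 + s ^+ 2).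
Proof.
have [ab|ba] := ltP a b; last first.
  by exists 0 => // e s _ _; rewrite /smoothed ltNge ba/= mul0r.
pose M := 1 + `|a| + `|b|.
have M1 : 1 <= M by rewrite /M -addrA lerDl addr_ge0.
(* The first summand serves |s| <= 2 M, where 1 + s^2 <= 1 + 4 M^2. The second serves |s| > 2 M,
   where 1 <= s^2 and s^2 <= 4 (x - s)^2 give 1 + s^2 <= 8 (x - s)^2. *)
pose c := 2 * pi * (1 + 4 * M ^+ 2) + 16 * (b - a).
have pi0 : 0 <= 2 * pi :> R by rewrite mulr_ge0// pi_ge0.
have p1 : 0 <= 2 * pi * (1 + 4 * M ^+ 2) by rewrite mulr_ge0// addr_ge0// mulr_ge0// sqr_ge0.
have p2 : 0 <= 16 * (b - a) by rewrite mulr_ge0// subr_ge0 ltW.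
have c0 : 0 <= c by rewrite addr_ge0.
exists c => // e s e0 e1.
have S0 : 0 < 1 + s ^+ 2 by rewrite ltr_pwDl ?sqr_ge0.
rewrite ler_pdivlMr//.
have [sM|sM] := leP `|s| (2 * M).
  have s2 : s ^+ 2 <= 4 * M ^+ 2.
    rewrite -[s ^+ 2]real_normK ?num_real// (_ : 4 * M ^+ 2 = (2 * M) ^+ 2); last by ring.
    by rewrite ler_sqr ?nnegrE// mulr_ge0// (le_trans ler01).
  have := smoothed_le a b s e0; have := smoothed_ge0 a b s e0 => h1 h2.
  apply: (@le_trans _ _ (2 * pi * (1 + 4 * M ^+ 2))); last by rewrite /c lerDl.
  by apply: ler_pM => //; [exact: ltW|rewrite lerD2l].
have [x /andP[ax xb] ->] := smoothed_MVT s e0 ab.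
have xM : `|x| <= M.
  rewrite /M ler_norml; have := ler_norm b; have := ler_norm (- a); rewrite normrN.
  have := normr_ge0 a; have := normr_ge0 b; move=> *; apply/andP; split; lra.
have sx : s ^+ 2 <= 4 * (x - s) ^+ 2.
  rewrite -[s ^+ 2]real_normK ?num_real// -[(x - s) ^+ 2]real_normK ?num_real//.
  rewrite (_ : 4 * _ = (2 * `|x - s|) ^+ 2); last by ring.
  rewrite ler_sqr ?nnegrE ?mulr_ge0//.
  have := ler_normB s (s - x); rewrite opprB addrCA subrr addr0 distrC.
  have := ler_distD x s 0; rewrite !subr0 => h _.
  rewrite distrC; lra.
have s1 : 1 <= s ^+ 2.
  rewrite -[s ^+ 2]real_normK ?num_real// -[X in X <= _](expr1n _ 2) ler_sqr ?nnegrE//.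
  by rewrite ltW// (le_lt_trans _ sM)//; lra.
have D0 : 0 < e ^+ 2 + (x - s) ^+ 2 by rewrite ltr_pwDl ?sqr_ge0// exprn_gt0.
rewrite -!mulrA [_^-1 * _]mulrC !mulrA ler_pdivrMr//.
apply: (@le_trans _ _ (16 * (b - a) * (e ^+ 2 + (x - s) ^+ 2))); last first.
  by rewrite ler_wpM2r ?(ltW D0)// /c lerDr.
have e2 := sqr_ge0 e.
have h1 : 2 * e * (b - a) * (1 + s ^+ 2) <= 2 * (b - a) * (1 + s ^+ 2).
  by rewrite ler_wpM2r ?(ltW S0)// ler_wpM2r ?subr_ge0 ?(ltW ab)//; lra.
apply: (le_trans h1).
have h2 : 1 + s ^+ 2 <= 8 * (e ^+ 2 + (x - s) ^+ 2) by lra.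
rewrite (_ : 16 * (b - a) * _ = 2 * (b - a) * (8 * (e ^+ 2 + (x - s) ^+ 2))); last by ring.
by rewrite ler_wpM2l// mulr_ge0// subr_ge0 ltW.
Qed.

Lemma cvgn_atan_pos (x : R) : 0 < x -> (fun n => atan (x / n.+1%:R^-1)) @ \oo --> (pi / 2 : R).
Proof.
move=> x0; apply: (cvg_comp (fun n : nat => x / n.+1%:R^-1) (@atan R)); last exact: cvgy_atan.
apply/cvgryPge => A; exists (Num.truncn (`|A| / x)).+1 => //= n hn.
rewrite invrK; apply: (le_trans (ler_norm A)).
rewrite mulrC -ler_pdivrMr//.
apply: (@le_trans _ _ (Num.truncn (`|A| / x)).+1%:R); first by rewrite ltW// truncnS_gt.
by rewrite ler_nat (leq_trans hn).
Qed.

Lemma cvgn_atan_neg (x : R) : x < 0 -> (fun n => atan (x / n.+1%:R^-1)) @ \oo --> (- (pi / 2) : R).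
Proof.
move=> x0; have h := @cvgn_atan_pos (- x); rewrite oppr_gt0 in h.
rewrite (_ : (fun n => _) = fun n => - atan (- x / n.+1%:R^-1)); first exact: cvgN (h x0).
by apply/funext => n; rewrite mulNr atanN opprK.
Qed.

(** Each arctangent tends to pi/2 or - pi/2 according to the side on which [s] lies. At an endpoint
    of a nondegenerate interval the limit is half the stated value, so the endpoints are excluded;
    they form a null set. *)
Lemma cvg_smoothed a b s : s != a -> s != b ->
  (fun n => smoothed n.+1%:R^-1 a b s) @ \oo --> (2 * pi * itvf a b s : R).
Proof.
move=> sa sb; rewrite /smoothed; have [ab|ba] := ltP a b; last first.
  rewrite (_ : itvf a b s = 0) ?mulr0; first exact: cvg_cst.
  rewrite /itvf indicE memNset//= in_itv/= => /andP[h1 h2].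
  by move/eqP: sa; apply; apply/eqP; rewrite eq_le h1 andbT (le_trans h2).
have [ltsa|] := ltP s a.
  rewrite (_ : itvf a b s = 0) ?mulr0; last first.
    by rewrite /itvf indicE memNset//= in_itv/= leNgt ltsa.
  rewrite -[X in _ --> X](_ : 2 * (pi / 2 - pi / 2) = 0); last by rewrite subrr mulr0.
  apply: cvgM; first exact: cvg_cst.
  by apply: cvgB; apply: cvgn_atan_pos; rewrite subr_gt0// (lt_trans ltsa).
rewrite le_eqVlt eq_sym (negbTE sa)/= => ltas.
have [ltbs|] := ltP b s.
  rewrite (_ : itvf a b s = 0) ?mulr0; last first.
    by rewrite /itvf indicE memNset//= in_itv/= [s <= b]leNgt ltbs andbF.
  rewrite -[X in _ --> X](_ : 2 * (- (pi / 2) - - (pi / 2)) = 0); last by rewrite subrr mulr0.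
  apply: cvgM; first exact: cvg_cst.
  by apply: cvgB; apply: cvgn_atan_neg; rewrite subr_lt0// (lt_trans ltas).
rewrite le_eqVlt (negbTE sb)/= => ltsb.
rewrite (_ : itvf a b s = 1) ?mulr1; last by rewrite /itvf indicE mem_set//= in_itv/= !ltW.
rewrite -[X in _ --> X](_ : 2 * (pi / 2 - - (pi / 2)) = 2 * pi); last by field.
apply: cvgM; first exact: cvg_cst.
by apply: cvgB; [apply: cvgn_atan_pos; rewrite subr_gt0|apply: cvgn_atan_neg; rewrite subr_lt0].
Qed.

Lemma ae_neq2 (x y : R) : {ae leb, forall s, s != x /\ s != y}.
Proof.
exists ([set x] `|` [set y]); split => //.
  by apply: measurableU => //; exact: measurable_set1.
  by rewrite null_set_setU//; exact: lebesgue_measure_set1.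
move=> s /= h; apply: contrapT => /not_orP[/eqP sx /eqP sy].
by apply: h.
Qed.

Lemma aeS (P Q : R -> Prop) : {ae leb, forall x, P x} -> (forall x, P x -> Q x) ->
  {ae leb, forall x, Q x}.
Proof.
move=> [N [mN N0 h]] PQ; exists N; split => // x /= nQ.
by apply: h => /= Px; exact/nQ/PQ.
Qed.

Lemma integrable_oneDsqrV (c : R) : leb.-integrable setT (fun s => (c / (1 + s ^+ 2))%:E).
Proof.
under eq_fun do rewrite EFinM; apply: integrableZl => //.
have D0 (s : R) : 0 < 1 + s ^+ 2 by rewrite ltr_pwDl ?sqr_ge0.
have cD : continuous (fun s : R => (1 + s ^+ 2)^-1).
  move=> x; apply: cvgV; first by rewrite gt_eqF.
  by apply: cvgD; [exact: cvg_cst|exact: exprn_continuous].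
apply/integrableP; split.
  by apply/measurable_EFinP; exact: continuous_measurable_fun cD.
rewrite (eq_integral (fun s : RR => ((1 + s ^+ 2)^-1 : R)%:E)); last first.
  by move=> s _ /=; rewrite ger0_norm// invr_ge0 ltW.
rewrite (@ge0_symfun_integralT _ (fun s : R => (1 + s ^+ 2)^-1))//.
- by rewrite -set_itvcy integral0y_oneDsqr -EFinM ltry.
- by move=> s; rewrite invr_ge0 ltW.
- by move=> s /=; rewrite sqrrN.
Qed.

(** Fubini, with majorant [lapl e] times the interval indicator: integrating first against the
    Laplace kernel produces the Poisson kernel at al - s, which is then integrated over the
    interval. *)
Lemma cint_damped e a b s : 0 < e ->
  cint leb (fun x => expi (- (s * x)) * damped e a b x) = (smoothed e a b s)%:C.
Proof.
move=> e0.
pose G (p : RR * RR) : R[i] := (lapl e p.1)%:C * expi (- (s * p.1)) *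
   ((itvf a b p.2)%:C * expi (p.2 * p.1)).
have mG : cmeas G.
  have m1 := @measurable_fst _ _ RR RR; have m2 := @measurable_snd _ _ RR RR.
  apply: cmeasM; apply: cmeasM.
  - by apply: cmeasC; exact: (measurableT_comp (@measurable_lapl R e) m1).
  - apply: cmeas_expi; apply: measurableT_comp => //.
    by apply: measurable_funM => //; exact: m1.
  - by apply: cmeasC; exact: (measurableT_comp (@measurable_itvf a b) m2).
  - by apply: cmeas_expi; apply: measurable_funM; [exact: m2|exact: m1].
have iG : cintegrable (leb \x leb)%E G.
  apply: (@cintegrable_prod_le _ _ RR RR R leb leb G (lapl e) (itvf a b)) => //.
  - move=> x y; rewrite /G /= !cabsM !cabs_expi !mulr1 !cabsC !ger0_norm ?lapl_ge0//.
  - exact: lapl_ge0.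
  - exact: integrable_lapl.
  - exact: integrable_itvf.
transitivity (cint leb (fun x => cint leb (fun al => G (x, al)))).
  congr cint; apply/funext => x; rewrite /G /= cintZ; last exact: cintegrable_itvf.
  by rewrite /damped mulrCA mulrA.
rewrite -(cint_prod1 iG) (cint_prod2 iG).
have key (al : R) : cint leb (fun x => G (x, al)) =
    (itvf a b al * (2 * e / (e ^+ 2 + (al - s) ^+ 2)))%:C.
  rewrite rmorphM /= -(@cint_lapl R e (al - s) e0) -cintZ; last exact: cintegrable_lapl.
  congr cint; apply/funext => x; rewrite /G /= mulrCA -!mulrA; congr (_ * _).
  by rewrite -expiD; congr (_ * expi _); ring.
transitivity (cint leb (fun al => (itvf a b al * (2 * e / (e ^+ 2 + (al - s) ^+ 2)))%:C)).
  by congr cint; apply/funext => al; exact: key.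
apply: complex_ext => /=; first by rewrite integral_poisson.
by rewrite integral0.
Qed.

End smoothed_interval.

(** * Fourier pairing and weak convergence *)

Section bridge.
Variables (R : realType) (d : nat).
Local Notation V := (d.-tuple R).
Local Notation C := R[i].
Local Notation lebV := (lebT R d).
Implicit Types f g : V -> C.

Lemma normsqE f : cmeas f -> normsq f = nsq lebV f.
Proof.
move=> mf; rewrite /normsq ge0_iintE//.
  by apply/measurable_EFinP; exact: measurable_sqmod.
by move=> t; rewrite lee_fin sqmod_ge0.
Qed.

Lemma L2E f : L2 f <-> l2 lebV f.
Proof.
by split => -[mf h]; split => //; move: h; rewrite (normsqE mf).
Qed.

Lemma L1E f : L1 f <-> cintegrable lebV f.
Proof.
have E : cmeas f -> iint (fun t => (Num.sqrt (sqmod (f t)))%:E) = (\int[lebV]_t (cabs (f t))%:E)%E.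
  move=> mf; rewrite ge0_iintE//.
  by apply/measurable_EFinP; exact: measurable_cabs.
split=> [[mf h]|cf].
  by apply: cintegrable_lty => //; rewrite -E.
have mf := cintegrable_cmeas cf; split => //; rewrite E//.
have := integrable_fin_num measurableT (cintegrable_cabs cf).
by rewrite ge0_fin_numE// integral_ge0// => t _; rewrite lee_fin cabs_ge0.
Qed.

Lemma CintE f : cintegrable lebV f -> Cint f = cint lebV f.
Proof. by move=> [a b]; rewrite /Cint !iintE. Qed.

Lemma ipE f g : l2 lebV f -> l2 lebV g -> ip f g = cip lebV f g.
Proof. by move=> lf lg; rewrite /ip CintE//; exact: cip_integrable. Qed.

Lemma ccvg_epsP (u : nat -> C) l : ccvg u l <->
  forall e : R, 0 < e -> exists N, forall n, (N <= n)%N -> cabs (u n - l) < e.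
Proof.
split=> [h e e0|h].
  have /cvgrPdist_lt/(_ _ e0)[N _ hN] := ccvg_cabs h.
  exists N => n Nn; have := hN n Nn.
  by rewrite /= sub0r normrN ger0_norm ?cabs_ge0.
apply: (@ccvg_le _ _ _ (fun n => cabs (u n - l))) => //.
apply/cvgrPdist_lt => e e0; have [N hN] := h e e0; exists N => //= n Nn.
by rewrite sub0r normrN ger0_norm ?cabs_ge0//; exact: hN.
Qed.

End bridge.

Section fourier.
Variables (R : realType) (d : nat).
Local Notation V := (d.-tuple R).
Local Notation C := R[i].
Local Notation lebV := (lebT R d).
Local Notation leb := (@lebesgue_measure R).

Implicit Types e : R.

Lemma dotRC (x y : V) : dotR x y = dotR y x.
Proof. by apply: eq_bigr => i _; rewrite mulrC. Qed.

Lemma measurable_dotR : measurable_fun [set: V * V] (fun p => dotR p.1 p.2).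
Proof.
apply: measurable_sum => i; apply: measurable_funM.
  exact: (measurableT_comp (@measurable_tnth _ R d i) measurable_fst).
exact: (measurableT_comp (@measurable_tnth _ R d i) measurable_snd).
Qed.

Lemma measurable_dotRl (x : V) : measurable_fun [set: V] (dotR x).
Proof.
apply: measurable_sum => i; apply: measurable_funM => //; exact: measurable_tnth.
Qed.

(** The transform without the factor (2 pi)^(- d/2), so that its value at the origin is the integral
    of [u] and the product formula for the iterates carries no constants. *)
Definition FT0 (u : V -> C) (x : V) : C := cint lebV (fun s => expi (- dotR x s) * u s).

Lemma cintegrable_FT0 u x : cintegrable lebV u ->
  cintegrable lebV (fun s => expi (- dotR x s) * u s).
Proof.
move=> iu; apply: (@cintegrable_le _ _ _ _ _ (fun s => cabs (u s))).
- apply: cmeasM; last exact: cintegrable_cmeas iu.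
  by apply: cmeas_expi; apply: measurableT_comp => //; exact: measurable_dotRl.
- exact: cintegrable_cabs.
- by move=> s; rewrite cabsM cabs_expi mul1r.
Qed.

Lemma cabs_FT0 u x : cintegrable lebV u ->
  cabs (FT0 u x) <= fine (\int[lebV]_t (cabs (u t))%:E)%E.
Proof.
move=> iu; apply: (le_trans (cabs_cint (cintegrable_FT0 x iu))).
rewrite (eq_integral (fun t => (cabs (u t))%:E))// => t _.
by rewrite cabsM cabs_expi mul1r.
Qed.

Lemma cmeas_FT0 u : cmeas u -> cmeas (FT0 u).
Proof.
move=> mu_; apply: (@cmeas_cint_param1 _ _ V V R lebV (fun p => expi (- dotR p.1 p.2) * u p.2)).
apply: cmeasM.
  by apply: cmeas_expi; apply: measurableT_comp => //; exact: measurable_dotR.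
have [a b] := mu_; split.
  exact: (measurableT_comp a (@measurable_snd _ _ V V)).
exact: (measurableT_comp b (@measurable_snd _ _ V V)).
Qed.

(** The multiplication formula, by Fubini and the symmetry of the kernel. Transforms of the iterates
    are moved onto test functions only by this identity. *)
Lemma FT0_mult u w : cintegrable lebV u -> cintegrable lebV w ->
  cint lebV (fun s => u s * FT0 w s) = cint lebV (fun x => w x * FT0 u x).
Proof.
move=> iu iw.
pose G (p : V * V) : C := u p.1 * (expi (- dotR p.1 p.2) * w p.2).
have [ua ub] := cintegrable_cmeas iu; have [wa wb] := cintegrable_cmeas iw.
have mG : cmeas G.
  apply: cmeasM.
    by split; [exact: (measurableT_comp ua (@measurable_fst _ _ V V))|
               exact: (measurableT_comp ub (@measurable_fst _ _ V V))].
  apply: cmeasM.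
    by apply: cmeas_expi; apply: measurableT_comp => //; exact: measurable_dotR.
  by split; [exact: (measurableT_comp wa (@measurable_snd _ _ V V))|
             exact: (measurableT_comp wb (@measurable_snd _ _ V V))].
have iG : cintegrable (lebV \x lebV)%E G.
  apply: (@cintegrable_prod_le _ _ V V R lebV lebV G (fun x => cabs (u x)) (fun x => cabs (w x))) => //.
  - by move=> x y; rewrite /G /= !cabsM cabs_expi mul1r.
  - by move=> x; exact: cabs_ge0.
  - by move=> x; exact: cabs_ge0.
  - exact: cintegrable_cabs.
  - exact: cintegrable_cabs.
transitivity (cint lebV (fun s => cint lebV (fun x => G (s, x)))).
  by congr cint; apply/funext => s; rewrite /G /= cintZ//; exact: cintegrable_FT0.
rewrite -(cint_prod1 iG) (cint_prod2 iG); congr cint; apply/funext => x.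
rewrite /G /= -cintZ; last exact: cintegrable_FT0.
by congr cint; apply/funext => s; rewrite dotRC; ring.
Qed.

Definition dampedbox (e : R) (a b x : V) : C :=
  \prod_i damped e (tnth a i) (tnth b i) (tnth x i).

Definition smoothbox (e : R) (a b x : V) : R :=
  \prod_i smoothed e (tnth a i) (tnth b i) (tnth x i).

Lemma cintegrable_dampedbox e a b : 0 < e -> cintegrable lebV (dampedbox e a b).
Proof.
move=> e0; apply: (@cintegrable_tuple_prod R d (fun i => damped e (tnth a i) (tnth b i))) => i.
exact: cintegrable_damped.
Qed.

Lemma sqmod_prod (I : Type) (s : seq I) (F : I -> C) :
  sqmod (\prod_(i <- s) F i) = \prod_(i <- s) sqmod (F i).
Proof. by elim/big_rec2 : _ => [|i x y _ <-]; rewrite ?sqmodM// (sqmodC 1) expr1n. Qed.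

Lemma l2_dampedbox e a b : 0 < e -> l2 lebV (dampedbox e a b).
Proof.
move=> e0; split.
  by apply: (@cmeas_tuple_prod R d (fun i => damped e (tnth a i) (tnth b i))) => i; exact: cmeas_damped.
rewrite /nsq; under eq_integral do rewrite sqmod_prod.
rewrite (@integral_tuple_prod R d (fun i x => sqmod (damped e (tnth a i) (tnth b i) x))
  (fun i => nr leb (damped e (tnth a i) (tnth b i)))) ?ltry//.
- by move=> i; exact: (measurable_sqmod (@cmeas_damped R e _ _)).
- by move=> i x; exact: sqmod_ge0.
- by move=> i; rewrite -nsqE//; exact: l2_damped.
Qed.

Lemma FT0_dampedbox e a b s : 0 < e -> FT0 (dampedbox e a b) s = (smoothbox e a b s)%:C.
Proof.
move=> e0; rewrite /FT0 /smoothbox rmorph_prod.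
transitivity (cint lebV (fun x => \prod_i
   (expi (- (tnth s i * tnth x i)) * damped e (tnth a i) (tnth b i) (tnth x i)))).
  by congr cint; apply/funext => x; rewrite big_split/= /dotR -sumrN expi_sum.
rewrite (@cint_tuple_prod R d (fun i x => expi (- (tnth s i * x)) * damped e (tnth a i) (tnth b i) x)).
  by apply: eq_bigr => i _; exact: cint_damped.
move=> i; have id := cintegrable_damped (tnth a i) (tnth b i) e0.
apply: (@cintegrable_le _ (measurableTypeR R) R leb _ (fun x => cabs (damped e (tnth a i) (tnth b i) x))).
- apply: cmeasM; last exact: cmeas_damped.
  by under eq_fun do rewrite -mulNr; exact: cmeas1_lin.
- exact: cintegrable_cabs.
- by move=> x; rewrite cabsM cabs_expi mul1r.
Qed.

Lemma cvg_prod_ord (c : nat -> 'I_d -> R) (g : 'I_d -> R) :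
  (forall i, (fun n => c n i) @ \oo --> g i) ->
  (fun n => \prod_i c n i) @ \oo --> \prod_i g i.
Proof.
move=> h; suff H (s : seq 'I_d) : (fun n => \prod_(i <- s) c n i) @ \oo --> \prod_(i <- s) g i.
  exact: H.
elim: s => [|i s IH].
  rewrite big_nil (_ : (fun n => _) = fun=> 1); first exact: cvg_cst.
  by apply/funext => n; rewrite big_nil.
rewrite big_cons (_ : (fun n => _) = fun n => c n i * \prod_(j <- s) c n j); first exact: cvgM.
by apply/funext => n; rewrite big_cons.
Qed.

(** Expanding the square leaves three integrals of product functions, each of which factors.
    Convergence in L^2 on tuples is thereby reduced to limits of one-variable integrals. *)
Lemma nr_tuple_prod_sub (F G : 'I_d -> R -> R) (c m g : 'I_d -> R) :
  (forall i, measurable_fun setT (F i)) -> (forall i, measurable_fun setT (G i)) ->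
  (forall i x, 0 <= F i x) -> (forall i x, 0 <= G i x) ->
  (forall i, \int[leb]_x (F i x ^+ 2)%:E = (c i)%:E)%E ->
  (forall i, \int[leb]_x (F i x * G i x)%:E = (m i)%:E)%E ->
  (forall i, \int[leb]_x (G i x ^+ 2)%:E = (g i)%:E)%E ->
  l2 lebV (fun t => (\prod_i F i (tnth t i))%:C) /\
  nr lebV (fun t => (\prod_i F i (tnth t i))%:C - (\prod_i G i (tnth t i))%:C) =
    \prod_i c i - 2 * \prod_i m i + \prod_i g i.
Proof.
move=> mF mG F0 G0 hc hm hg.
have mFG i : measurable_fun setT (fun x => F i x * G i x) by exact: measurable_funM.
have mF2 i : measurable_fun setT (fun x => F i x ^+ 2) by exact: measurable_funX.
have mG2 i : measurable_fun setT (fun x => G i x ^+ 2) by exact: measurable_funX.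
have I1 := @integral_tuple_prod R d _ _ mF2 (fun i x => sqr_ge0 _) hc.
have I2 := @integral_tuple_prod R d _ _ mFG (fun i x => mulr_ge0 (F0 i x) (G0 i x)) hm.
have I3 := @integral_tuple_prod R d _ _ mG2 (fun i x => sqr_ge0 _) hg.
have int (H : 'I_d -> R -> R) (k : R) : (forall i, measurable_fun setT (H i)) -> (forall i x, 0 <= H i x) ->
   (\int[lebV]_t (\prod_i H i (tnth t i))%:E = k%:E)%E ->
   lebV.-integrable setT (fun t => (\prod_i H i (tnth t i))%:E).
  move=> mH H0 hk; apply/integrableP; split.
    by apply/measurable_EFinP; exact: measurable_tuple_prod.
  rewrite (eq_integral (fun t => (\prod_i H i (tnth t i))%:E)) ?hk ?ltry// => t _.
  by rewrite /= ger0_norm// prodr_ge0.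
have i1 := int _ _ mF2 (fun i x => sqr_ge0 _) I1.
have i2 := int _ _ mFG (fun i x => mulr_ge0 (F0 i x) (G0 i x)) I2.
have i3 := int _ _ mG2 (fun i x => sqr_ge0 _) I3.
split.
  split; first by apply: cmeasC; exact: measurable_tuple_prod.
  rewrite /nsq; under eq_integral do rewrite sqmodC -prodrXl.
  by rewrite I1 ltry.
rewrite /nr /nsq.
have E : (\int[lebV]_t (sqmod ((\prod_i F i (tnth t i))%:C - (\prod_i G i (tnth t i))%:C))%:E =
  \int[lebV]_t ((\prod_i F i (tnth t i) ^+ 2)%:E +
     ((-2)%:E * (\prod_i (F i (tnth t i) * G i (tnth t i)))%:E + (\prod_i G i (tnth t i) ^+ 2)%:E)))%E.
  apply: eq_integral => t _; rewrite -rmorphB sqmodC -EFinM -!EFinD; congr EFin.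
  set p := \prod_i F i (tnth t i); set q := \prod_i G i (tnth t i).
  have -> : \prod_i F i (tnth t i) ^+ 2 = p ^+ 2 by rewrite prodrXl.
  have -> : \prod_i G i (tnth t i) ^+ 2 = q ^+ 2 by rewrite prodrXl.
  have -> : \prod_i (F i (tnth t i) * G i (tnth t i)) = p * q by rewrite big_split.
  ring.
rewrite E integralD//; last by apply: integrableD => //; exact: integrableZl.
rewrite integralD//; last exact: integrableZl.
rewrite integralZl// I1 I2 I3 -EFinM -!EFinD /=; ring.
Qed.

Definition poissonbox (n : nat) (a b x : V) : R :=
  \prod_i ((2 * pi)^-1 * smoothed n.+1%:R^-1 (tnth a i) (tnth b i) (tnth x i)).

Lemma poissonboxE n a b x :
  poissonbox n a b x = (2 * pi)^-1 ^+ d * smoothbox n.+1%:R^-1 a b x.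
Proof. by rewrite /poissonbox big_split/= prodr_const card_ord. Qed.

Lemma poissonbox_cvg a b : (forall n, l2 lebV (fun t => (poissonbox n a b t)%:C)) /\
  (fun n => nr lebV (fun t => (poissonbox n a b t)%:C - (boxf a b t)%:C)) @ \oo --> (0 : R).
Proof.
have pi0 : 0 < 2 * pi :> R by rewrite mulr_gt0// pi_gt0.
have n0 n : 0 < n.+1%:R^-1 :> R by rewrite invr_gt0.
have n1 n : n.+1%:R^-1 <= 1 :> R by rewrite invf_le1// ler1n.
pose F n i x : R := (2 * pi)^-1 * smoothed n.+1%:R^-1 (tnth a i) (tnth b i) x.
pose G i := itvf (tnth a i) (tnth b i).
have mF n i : measurable_fun setT (F n i).
  by apply: measurable_funM => //; exact: measurable_smoothed.
have mG i : measurable_fun setT (G i) by exact: measurable_itvf.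
have F0 n i x : 0 <= F n i x by rewrite mulr_ge0 ?smoothed_ge0// invr_ge0 ltW.
have F1 n i x : F n i x <= 1 by rewrite /F mulrC ler_pdivrMr// mul1r smoothed_le.
have [c c0 hc] : exists2 c, (forall i, 0 <= c i) &
    forall n i x, F n i x <= c i / (1 + x ^+ 2).
  have h i : exists c, 0 <= c /\ forall n x, F n i x <= c / (1 + x ^+ 2).
    have [c c0 hc] := smoothed_decay (tnth a i) (tnth b i).
    exists ((2 * pi)^-1 * c); split; first by rewrite mulr_ge0// invr_ge0 ltW.
    by move=> n x; rewrite -mulrA ler_wpM2l ?invr_ge0 ?(ltW pi0)// hc.
  have [c hc] := choice h; exists c; first by move=> i; case: (hc i).
  by move=> n i x; case: (hc i).
have aeF i : {ae leb, forall x, (fun n => F n i x) @ \oo --> (G i x : R)}.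
  apply: aeS (ae_neq2 (tnth a i) (tnth b i)) _ => x [h1 h2].
  rewrite -[X in _ --> X](_ : (2 * pi)^-1 * (2 * pi * G i x) = _); last first.
    by rewrite mulrA mulVf ?mul1r// gt_eqF.
  apply: cvgM; first exact: cvg_cst.
  exact: cvg_smoothed.
have G01 i x : 0 <= G i x <= 1.
  by rewrite /G /itvf indicE; case: (_ \in _); rewrite /= ?ler01 ?lexx.
pose cc n i := fine (\int[leb]_x (F n i x ^+ 2)%:E)%E.
pose mm n i := fine (\int[leb]_x (F n i x * G i x)%:E)%E.
pose gg i := fine (\int[leb]_x (G i x ^+ 2)%:E)%E.
have dom (H : R -> R) i : measurable_fun setT H -> (forall x, 0 <= H x <= c i / (1 + x ^+ 2)) ->
   (\int[leb]_x (H x)%:E = (fine (\int[leb]_x (H x)%:E))%:E)%E.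
  move=> mH hH; rewrite fineK//; apply: integrable_fin_num => //.
  apply: (le_integrable measurableT _ _ (integrable_oneDsqrV (c i))).
    exact/measurable_EFinP.
  move=> x _ /=; rewrite lee_fin; have /andP[h1 h2] := hH x.
  by rewrite ger0_norm// (le_trans h2)// ler_norm.
have d1 n i x : 0 <= F n i x ^+ 2 <= c i / (1 + x ^+ 2).
  rewrite sqr_ge0/= (le_trans _ (hc n i x))// expr2 ler_piMl//.
have d2 n i x : 0 <= F n i x * G i x <= c i / (1 + x ^+ 2).
  have /andP[g0 g1] := G01 i x.
  by rewrite mulr_ge0//= (le_trans _ (hc n i x))// ler_piMr.
have E n i := dom _ i (measurable_funX 2 (mF n i)) (d1 n i).
have E2 n i := dom _ i (measurable_funM (mF n i) (mG i)) (d2 n i).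
have E3 i : (\int[leb]_x (G i x ^+ 2)%:E = (gg i)%:E)%E.
  rewrite /gg fineK//; under eq_integral do rewrite itvf_sqr.
  by rewrite integral_itvf.
have K n := nr_tuple_prod_sub (mF n) mG (F0 n) (fun i x => itvf_ge0 _ _ _) (E n) (E2 n) E3.
split; first by move=> n; case: (K n).
have -> : (fun n => nr lebV (fun t => (poissonbox n a b t)%:C - (boxf a b t)%:C)) =
   fun n => \prod_i cc n i - 2 * \prod_i mm n i + \prod_i gg i.
  by apply/funext => n; case: (K n).
have lim1 i : (fun n => cc n i) @ \oo --> gg i.
  apply: (@fine_integral_dominated _ _ _ leb (fun n x => F n i x ^+ 2) (fun x => G i x ^+ 2)
      (fun x => c i / (1 + x ^+ 2))).
  - by move=> n; exact: (measurable_funX 2 (mF n i)).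
  - exact: (measurable_funX 2 (mG i)).
  - apply: aeS (aeF i) _ => x h; under eq_fun do rewrite expr2; rewrite expr2; exact: cvgM.
  - exact: integrable_oneDsqrV.
  - by move=> n x; have /andP[h1 h2] := d1 n i x; rewrite ger0_norm.
have lim2 i : (fun n => mm n i) @ \oo --> gg i.
  rewrite /gg; under eq_integral do rewrite expr2.
  apply: (@fine_integral_dominated _ _ _ leb (fun n x => F n i x * G i x) (fun x => G i x * G i x)
      (fun x => c i / (1 + x ^+ 2))).
  - by move=> n; exact: (measurable_funM (mF n i) (mG i)).
  - exact: (measurable_funM (mG i) (mG i)).
  - by apply: aeS (aeF i) _ => x h; apply: cvgM => //; exact: cvg_cst.
  - exact: integrable_oneDsqrV.
  - by move=> n x; have /andP[h1 h2] := d2 n i x; rewrite ger0_norm.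
(* Coordinate by coordinate, the integrals of F^2 and of F G both tend to that of G^2, so the
   expanded square tends to g - 2 g + g. *)
rewrite -[X in _ --> X](_ : \prod_i gg i - 2 * \prod_i gg i + \prod_i gg i = 0); last by ring.
apply: cvgD; last exact: cvg_cst.
apply: cvgB; first exact: cvg_prod_ord.
by apply: cvgM; [exact: cvg_cst|exact: cvg_prod_ord].
Qed.


(* The phase-space pairing with [dampedbox] reaches every Poisson-smoothed box,
   and these are dense. *)
Lemma weak_cvg (u : nat -> V -> C) (phi G : V -> C) (M K : R) :
  (forall n, cintegrable lebV (u n)) -> (forall n, l2 lebV (u n)) ->
  (forall n, nr lebV (u n) <= M) ->
  (forall n, fine (\int[lebV]_t (cabs (u n t))%:E)%E <= K) ->
  l2 lebV phi -> cmeas G -> (forall x, ccvg (fun n => FT0 (u n) x) (G x)) ->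
  (forall w, cintegrable lebV w -> l2 lebV w -> l2 lebV (FT0 w) ->
    cint lebV (fun s => phi s * FT0 w s) = cint lebV (fun x => w x * G x)) ->
  forall f, l2 lebV f -> ccvg (fun n => cip lebV f (u n)) (cip lebV f phi).
Proof.
move=> iu lu uM uK lphi mG cvG hphi.
(* The test functions on which the convergence holds. The aim is to show that [W] contains
   everything, by closing it under limits and linear combinations and finding a dense family inside
   it. *)
pose W g := l2 lebV g /\ ccvg (fun n => cip lebV (u n) g) (cip lebV phi g).
have M0 : 0 <= M := le_trans (nr_ge0 _ _) (uM 0%N).
(* The uniform L^2 bound on [u n] makes [W] closed: [B] bounds the norm of u n - phi, so replacing
   [g] by [g_ k] costs at most [B] times their distance, whatever [n]. *)
have W_lim (g_ : nat -> V -> C) g : (forall k, W (g_ k)) -> l2 lebV g ->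
    (fun k => nr lebV (fun t => g_ k t - g t)) @ \oo --> (0 : R) -> W g.
  move=> Wg lg cvg_; split => //; apply/ccvg_epsP => e e0.
  pose B := Num.sqrt (2 * M + 2 * nr lebV phi).
  have B0 : 0 <= B by exact: sqrtr_ge0.
  have e3 : 0 < e / (2 * (B + 1)) by rewrite divr_gt0// mulr_gt0// ltr_wpDl.
  have e4 : 0 < (e / (2 * (B + 1))) ^+ 2 by rewrite exprn_gt0.
  have /cvgrPdist_lt/(_ _ e4)[k _ hk] := cvg_.
  have := hk k (leqnn k); rewrite /= sub0r normrN ger0_norm ?nr_ge0// => {}hk.
  have [lgk /ccvg_epsP hW] := Wg k.
  have e2 : 0 < e / 2 by rewrite divr_gt0.
  have [N hN] := hW _ e2; exists N => n Nn.
  have lun := lu n.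
  have ldiff : l2 lebV (fun t => u n t - phi t) by exact: l2B.
  have E : cip lebV (u n) g - cip lebV phi g =
     (cip lebV (u n) (g_ k) - cip lebV phi (g_ k)) -
      cip lebV (fun t => u n t - phi t) (fun t => g_ k t - g t).
    by rewrite cipBr// !cipBl//; ring.
  rewrite E; apply: (le_lt_trans (cabsD _ _)); rewrite cabsN.
  have h2 : cabs (cip lebV (fun t => u n t - phi t) (fun t => g_ k t - g t)) <= e / 2.
    apply: (le_trans (cabs_cip_le ldiff (l2B lgk lg))).
    apply: (@le_trans _ _ (B * (e / (2 * (B + 1))))).
      apply: ler_pM; rewrite ?sqrtr_ge0//.
        rewrite /B ler_sqrt; last by rewrite addr_ge0// mulr_ge0// nr_ge0.
        have := nrD_le2 lun (l2N lphi); rewrite nrN; have := uM n; lra.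
      by rewrite -[X in _ <= X]ger0_norm ?(ltW e3)// -sqrtr_sqr ler_sqrt ?ltW.
    rewrite mulrA ler_pdivrMr ?mulr_gt0 ?ltr_wpDl//.
    by rewrite (_ : e / 2 * (2 * (B + 1)) = e * (B + 1)); [nra|field].
  have := hN n Nn; lra.
have W_add g1 g2 : W g1 -> W g2 -> W (fun t => g1 t + g2 t).
  move=> [l1 c1] [l2_ c2]; split; first exact: l2D.
  by rewrite cipDr//; under eq_fun do rewrite cipDr//; exact: ccvgD.
have W_scale c g : W g -> W (fun t => c * g t).
  move=> [l1 c1]; split; first exact: l2Z.
  rewrite cipZr//; under eq_fun do rewrite cipZr//.
  by apply: ccvgM => //; exact: ccvg_cst.
(* A Poisson box is the transform of an explicit integrable [w]. The multiplication formula turns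
   the pairing into one of [w] with the transforms of [u n], which converge pointwise and are
   bounded by [K], so dominated convergence applies. *)
have W_poisson n a b : W (fun t => (poissonbox n a b t)%:C).
  have [lp _] := poissonbox_cvg a b; split => //.
  have n0 : 0 < n.+1%:R^-1 :> R by rewrite invr_gt0.
  pose c : R := (2 * pi)^-1 ^+ d.
  pose w x := c%:C * dampedbox n.+1%:R^-1 a b x.
  have iw : cintegrable lebV w by apply: cintegrableZ; exact: cintegrable_dampedbox.
  have lw : l2 lebV w by apply: l2Z; exact: l2_dampedbox.
  have Ew : FT0 w = fun t => (poissonbox n a b t)%:C.
    apply/funext => s; rewrite poissonboxE rmorphM/= -FT0_dampedbox// /FT0 -cintZ.
      by congr cint; apply/funext => x; rewrite /w mulrCA.
    by apply: cintegrable_FT0; exact: cintegrable_dampedbox.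
  have conv v : cip lebV v (fun t => (poissonbox n a b t)%:C) =
     cint lebV (fun s => v s * FT0 w s).
    by congr cint; apply/funext => s; rewrite Ew conjc_real.
  rewrite conv hphi//; last by rewrite Ew.
  under eq_fun do rewrite conv FT0_mult//.
  have iwa := cintegrable_cabs iw.
  apply: (@cint_dominated _ _ _ _ _ _ (fun x => K * cabs (w x))).
  - move=> k; apply: cmeasM; first exact: cintegrable_cmeas iw.
    by apply: cmeas_FT0; exact: cintegrable_cmeas (iu k).
  - by apply: cmeasM => //; exact: cintegrable_cmeas iw.
  - by move=> x; apply: ccvgM => //; exact: ccvg_cst.
  - by under eq_fun do rewrite EFinM; exact: integrableZl.
  - move=> k x; rewrite cabsM mulrC ler_wpM2r ?cabs_ge0//.
    exact: (le_trans (cabs_FT0 x (iu k)) (uK k)).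
have W_box a b : W (fun t => (boxf a b t)%:C).
  have [lp cp] := poissonbox_cvg a b.
  by apply: (W_lim (fun n t => (poissonbox n a b t)%:C)) => //; exact: l2_boxf.
have W0 : W (fun=> 0).
  split; first exact: l20.
  have E v : cip lebV v (fun=> 0) = 0.
    by rewrite /cip -[RHS](cint0 lebV); congr cint; apply/funext => t; rewrite conjc0 mulr0.
  by rewrite E; under eq_fun do rewrite E; exact: ccvg_cst.
have W_step s : W (stepf s).
  rewrite /stepf; elim: s => [|p s IH].
    by under eq_fun do rewrite big_nil.
  by under eq_fun do rewrite big_cons; apply: W_add => //; exact: W_scale.
move=> f lf.
suff [_ h] : W f.
  rewrite (cipJ lphi)//; under eq_fun => n do rewrite (cipJ (lu n))//.
  exact: ccvgJ.
have hs n : exists s, nr lebV (fun t => f t - stepf s t) < n.+1%:R^-1.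
  by apply: step_dense => //; rewrite invr_gt0.
have [s hs'] := choice hs.
apply: (W_lim (fun n => stepf (s n))) => //.
apply: (@squeeze_cvgr _ _ _ _ (fun=> 0) (fun n => n.+1%:R^-1)).
- by apply: nearW => n; rewrite nr_ge0/= nr_subC ltW.
- exact: cvg_cst.
- exact: cvge_harmonic || exact: cvg_harmonic.
Qed.

(** [FT_L2] describes the transform only along approximating sequences in L^1 and L^2. The
    truncations of [phi] to cubes form such a sequence; each satisfies the multiplication formula,
    and both sides are inner products with fixed L^2 functions, hence pass to the limit. *)
Lemma FT_L2_pairing (phi g : V -> C) (w : V -> C) : FT_L2 phi g ->
  cintegrable lebV w -> l2 lebV w -> l2 lebV (FT0 w) ->
  cint lebV (fun s => phi s * FT0 w s) =
  cint lebV (fun x => w x * (((2 * pi) `^ (- (d%:R / 2)))^-1%:C * g x)).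
Proof.
move=> [/L2E lphi [/L2E lg h]] iw lw lFw.
set c0 : R := (2 * pi) `^ (- (d%:R / 2)).
have c00 : c0 != 0 by rewrite gt_eqF// powR_gt0// mulr_gt0// pi_gt0.
pose u n t := phi t * (cube n t)%:C.
have mu_ n : cmeas (u n).
  by apply: cmeasM; [case: lphi|apply: cmeasC; exact: measurable_boxf].
have lu n : l2 lebV (u n).
  apply: (proj1 (l2_le_fun (mu_ n) lphi _)) => t; rewrite sqmodM sqmodC boxf_sqr.
  by rewrite ler_piMr ?sqmod_ge0 ?boxf_le1.
have iu n : cintegrable lebV (u n).
  rewrite (_ : u n = fun t => phi t * conjc (cube n t)%:C).
    exact: (cip_integrable lphi (l2_boxf _ _)).
  by apply/funext => t; rewrite conjc_real.
have cu : (fun n => nr lebV (fun t => u n t - phi t)) @ \oo --> (0 : R).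
  apply: (@nr_cvg _ _ _ _ _ _ (fun t => sqmod (phi t))) => //.
  - by case: lphi.
  - apply: aeW => t; rewrite -[X in ccvg _ X]mulr1; apply: ccvgM; first exact: ccvg_cst.
    by split => /=; [exact: cvg_cube|exact: cvg_cst].
  - exact: l2_integrable.
  - move=> n t; rewrite /u -[X in _ - X]mulr1 -mulrBr sqmodM ler_piMr ?sqmod_ge0//.
    rewrite -(rmorph1 (real_complex R)) -rmorphB/= sqmodC.
    case: (boxf_01 (cst_tuple d (- n%:R)) (cst_tuple d n%:R) t);
    by rewrite /cube => ->; rewrite ?subrr ?expr0n ?sub0r ?sqrrN ?expr1n ?ler01.
have cL : L2cvg u phi.
  move=> e e0; have /cvgrPdist_lt/(_ _ e0)[N _ hN] := cu; exists N => k Nk.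
  have lk : l2 lebV (fun t => u k t - phi t) by exact: l2B.
  rewrite normsqE; last by case: lk.
  rewrite nsqE// lte_fin; have := hN k Nk.
  by rewrite /= sub0r normrN ger0_norm ?nr_ge0.
have FTE n : FT (u n) = fun x => c0%:C * FT0 (u n) x.
  by apply/funext => x; rewrite /FT CintE//; exact: cintegrable_FT0.
have hFT : L2cvg (fun k => FT (u k)) g.
  by apply: h => // k; split; [apply/L1E|apply/L2E].
have mFT n : cmeas (FT (u n)).
  by rewrite FTE; apply: cmeasM; [exact: cmeas_cst|exact: cmeas_FT0].
(* Square integrability of [FT (u k)] is obtained only from its finite distance to [g], which holds
   from some index [N] on; hence the shifted sequences below. *)
have ldiff : exists N, forall k, (N <= k)%N -> l2 lebV (fun t => FT (u k) t - g t).
  have [N hN] := hFT 1 ltr01; exists N => k Nk.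
  have mk : cmeas (fun t => FT (u k) t - g t) by apply: cmeasB => //; case: lg.
  by split => //; rewrite -normsqE//; apply: (lt_trans (hN k Nk)); rewrite ltry.
have [N hN] := ldiff.
have lFT k : l2 lebV (FT (u (N + k)%N)).
  have := l2D (hN _ (leq_addr k N)) lg; congr l2; apply/funext => t; ring.
have cFT : (fun k => nr lebV (fun t => FT (u (N + k)%N) t - g t)) @ \oo --> (0 : R).
  apply/cvgrPdist_lt => e e0; have [N' hN'] := hFT e e0; exists N' => //= k N'k.
  rewrite sub0r normrN ger0_norm ?nr_ge0// -lte_fin -nsqE; last exact/hN/leq_addr.
  rewrite -normsqE; last by case: (hN _ (leq_addr k N)).
  by apply: hN'; rewrite (leq_trans N'k)// leq_addl.
have lJ v : l2 lebV v -> l2 lebV (fun t => conjc (v t)).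
  move=> lv; apply: (proj1 (l2_le_fun _ lv _)); first by apply: cmeasJ; case: lv.
  by move=> t; rewrite sqmodJ.
have A1 : ccvg (fun k => cint lebV (fun s => u (N + k)%N s * FT0 w s))
    (cint lebV (fun s => phi s * FT0 w s)).
  have E v : cint lebV (fun s => v s * FT0 w s) = cip lebV v (fun s => conjc (FT0 w s)).
    by congr cint; apply/funext => s; rewrite conjcK.
  rewrite E; under eq_fun do rewrite E.
  apply: ccvg_cip_l => //; first exact: lJ.
  have := cu; rewrite -(cvg_shiftn N); apply: cvg_trans; apply: near_eq_cvg; apply: nearW => k /=.
  by rewrite addnC.
have A2 : ccvg (fun k => cint lebV (fun x => w x * FT0 (u (N + k)%N) x))
   (cint lebV (fun x => w x * (c0^-1%:C * g x))).
  have E v : cint lebV (fun x => w x * (c0^-1%:C * v x)) =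
     cip lebV v (fun x => conjc (c0^-1%:C * w x)).
    by congr cint; apply/funext => s; rewrite conjcK; ring.
  have E' k : cint lebV (fun x => w x * FT0 (u (N + k)%N) x) =
      cip lebV (FT (u (N + k)%N)) (fun x => conjc (c0^-1%:C * w x)).
    rewrite -E; congr cint; apply/funext => x; rewrite FTE [c0^-1%:C * _]mulrA -rmorphM/= mulVf//.
    by rewrite mul1r.
  rewrite E; under eq_fun do rewrite E'.
  by apply: ccvg_cip_l => //; apply: lJ; exact: l2Z.
apply: (ccvg_unique A1).
by under eq_fun do rewrite FT0_mult//; exact: A2.
Qed.

End fourier.

(** * The filter bank *)

Section sum_support.
(** Sums over the whole lattice are represented by sums over finite lists. Any two lists that agree
    on the support are interchangeable, which takes care of reindexing and of enlarging the
    range. *)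
Lemma big_supp (T : eqType) (M : nmodType) (s1 s2 : seq T) (F : T -> M) :
  uniq s1 -> uniq s2 -> (forall p, F p != 0 -> (p \in s1) = (p \in s2)) ->
  \sum_(p <- s1) F p = \sum_(p <- s2) F p.
Proof.
move=> u1 u2 h.
have E (s : seq T) : \sum_(p <- s) F p = \sum_(p <- [seq p <- s | F p != 0]) F p.
  rewrite big_filter [RHS]big_mkcond; apply: eq_bigr => p _.
  by case: eqVneq.
rewrite (E s1) (E s2); apply: perm_big; apply: uniq_perm; rewrite ?filter_uniq// => p.
by rewrite !mem_filter; case: eqVneq => //= Fp; exact: h.
Qed.

Lemma ler_sum_uniq (T : eqType) (R : numDomainType) (s1 s2 : seq T) (F : T -> R) :
  uniq s1 -> uniq s2 -> {subset s1 <= s2} -> (forall p, 0 <= F p) ->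
  \sum_(p <- s1) F p <= \sum_(p <- s2) F p.
Proof.
move=> u1 u2 s12 F0.
have -> : \sum_(p <- s1) F p = \sum_(p <- [seq p <- s2 | p \in s1]) F p.
  apply: perm_big; apply: uniq_perm; rewrite ?filter_uniq// => p.
  by rewrite mem_filter; case ps1: (p \in s1) => //=; rewrite s12.
rewrite big_filter [X in _ <= X](bigID (mem s1))/= lerDl.
by apply: sumr_ge0 => p _.
Qed.
End sum_support.

Section lam0.
Variable d : nat.
Local Notation Z := 'cV[int]_d.

Lemma mem_Lam0 N (n : Z) : n \in Lam0 d N <-> inLam0 N n.
Proof.
split=> [/mapP[f _ ->] i|h].
  rewrite mxE; have := ltn_ord (f i); move: (nat_of_ord (f i)) => k hf.
  by rewrite ler_norml; apply/andP; split; lia.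
have hb i : (absz (n i 0 + N%:Z)%R < N.*2.+1)%N by have := h i; lia.
apply/mapP; exists [ffun i => Ordinal (hb i)]; first by rewrite mem_enum.
apply/colP => i; rewrite mxE ffunE /=; have := h i; lia.
Qed.

Lemma Lam0_uniq N : uniq (Lam0 d N).
Proof.
rewrite map_inj_uniq ?enum_uniq// => f g /colP fg; apply/ffunP => i; apply/val_inj => /=.
by have := fg i; rewrite !mxE; lia.
Qed.

Lemma inLam0_le N N' (n : Z) : (N <= N')%N -> inLam0 N n -> inLam0 N' n.
Proof. by move=> NN h i; have := h i; lia. Qed.

Lemma inLam0D N N' (n n' : Z) : inLam0 N n -> inLam0 N' n' -> inLam0 (N + N') (n + n').
Proof.
move=> h h' i; rewrite mxE PoszD; apply: (le_trans (ler_normD _ _)).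
by apply: lerD; [exact: h|exact: h'].
Qed.

Lemma inLam0N N (n : Z) : inLam0 N n -> inLam0 N (- n).
Proof. by move=> h i; rewrite mxE normrN. Qed.

Lemma inLam0_ex (n : Z) : exists N, inLam0 N n.
Proof.
exists (\sum_(i < d) absz (n i 0%R))%N => i; rewrite (bigD1 i)//= PoszD abszE.
by rewrite lerDl.
Qed.

Lemma dotZD (q x y : Z) : dotZ q (x + y) = dotZ q x + dotZ q y.
Proof. by rewrite /dotZ -big_split; apply: eq_bigr => i _; rewrite mxE mulrDr. Qed.

Section inverse.
Variable A : 'M[int]_d.
Hypothesis hdet : `|\det A| = 2 :> int.

Lemma mulA_inj : injective (fun l : Z => A *m l).
Proof.
move=> l l' /= /(congr1 (mulmx (\adj A))); rewrite !mulmxA mul_adj_mx !mul_scalar_mx => /colP h.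
apply/colP => i; have := h i; rewrite !mxE; apply: mulfI.
by rewrite -normr_eq0 hdet.
Qed.

(** The adjugate recovers det A times [l] from A l with integer coefficients, and |det A| = 2 makes
    |l| no larger than that multiple. *)
Lemma preimage_bound S : exists N, forall l : Z, inLam0 S (A *m l) -> inLam0 N l.
Proof.
exists (absz (\sum_(i < d) \sum_(j < d) `|\adj A i j| * S%:Z)) => l h i.
have := congr1 (fun v : Z => v i 0) (mulmxA (\adj A) A l).
rewrite mul_adj_mx mul_scalar_mx [RHS]mxE => E.
have h2 : `|l i 0| <= `|\det A * l i 0|.
  by rewrite normrM hdet; have := normr_ge0 (l i 0); lia.
apply: (le_trans h2); rewrite -E mxE.
apply: (le_trans (ler_norm_sum _ _ _)).
have h3 : \sum_j `|\adj A i j * (A *m l) j 0| <= \sum_j `|\adj A i j| * S%:Z.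
  by apply: ler_sum => j _; rewrite normrM ler_wpM2l.
apply: (le_trans h3).
have nn i' : 0 <= \sum_j `|\adj A i' j| * S%:Z by apply: sumr_ge0 => j _; rewrite mulr_ge0.
rewrite abszE (ger0_norm (sumr_ge0 _ (fun i' _ => nn i'))).
by rewrite [X in _ <= X](bigD1 i)//= lerDl sumr_ge0.
Qed.
End inverse.
End lam0.

Section signs.
Variable R : realType.

Lemma sg_parity (z : int) : (-1 : R[i]) ^ z = if (2 %| z)%Z then 1 else -1.
Proof.
have N0 : (-1 : R[i]) != 0 by rewrite oppr_eq0 oner_neq0.
have P q : (-1 : R[i]) ^ (q * 2) = 1.
  by rewrite mulrC -exprz_exp -[X in (_ ^ X) ^ _]/(Posz 2) -exprnP sqrrN expr1n exp1rz.
case: ifPn => [/dvdzP[q ->]//|]; rewrite {2}(divz_eq z 2) expfzDr// P mul1r.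
move=> /negP zn0; have {}zn0 : (z %% 2)%Z <> 0 by move=> /dvdz_mod0P.
have : (z %% 2)%Z = 1 by have := modz_ge0 z (isT : 2 != 0 :> int); have := ltz_pmod z (isT : 0 < 2 :> int); lia.
by move=> ->; rewrite expr1z.
Qed.

End signs.

Section filter.
Variables (R : realType) (d : nat) (A : 'M[int]_d) (lA qA : 'cV[int]_d).
Variables (h : 'cV[int]_d -> R[i]) (N0 : nat).
Local Notation Z := 'cV[int]_d.
Local Notation C := R[i].
Hypothesis hdet : `|\det A| = 2 :> int.
Hypothesis hl1 : [set: 'cV[int]_d] = pcoset lA (latt A) `|` latt A.
Hypothesis hq1 : forall x, latt A x -> (2 %| dotZ qA x)%Z.
Hypothesis hq2 : forall x, pcoset lA (latt A) x -> ~~ (2 %| dotZ qA x)%Z.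
Hypothesis hm1 : forall m n, latt A m ->
     [set: 'cV[int]_d] = mcoset n (latt A) `|` pcoset (lA - m - n) (latt A)
     /\ mcoset n (latt A) `&` pcoset (lA - m - n) (latt A) = set0.
Hypothesis hm2 : forall m n, pcoset lA (latt A) m ->
     mcoset n (latt A) = pcoset (lA - m - n) (latt A).
Hypothesis hsupp : forall n, ~ inLam0 N0 n -> h n = 0.
Hypothesis horth : forall k, latt A k ->
     \sum_(n <- Lam0 d N0) h n * conjc (h (n + k)) = (k == 0)%:R.

(** The high-pass companion of the low-pass filter [h]: the conjugate mirror filter with alternating
    signs. *)
Definition gcoef (n : Z) : C := ((-1) ^ (dotZ qA n)) * conjc (h (lA - n)).

Lemma h_neq0 n : h n != 0 -> inLam0 N0 n.
Proof. by move=> hn; apply: contrapT => /hsupp /eqP; rewrite (negbTE hn). Qed.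

Lemma latt0 : latt A 0. Proof. by exists 0 => //; rewrite mulmx0. Qed.

Lemma conjc_sg z : conjc ((-1 : C) ^ z) = (-1) ^ z.
Proof. by rewrite sg_parity; case: ifP; rewrite ?rmorphN rmorph1. Qed.

Lemma coset_sum (F : Z -> C) (p : Z -> Z) (X : set Z) (s : seq Z) : uniq s -> injective p ->
  (forall l, X (p l)) -> (forall y, X y -> exists l, y = p l) ->
  (forall l, F (p l) != 0 -> l \in s) -> (forall y, F y != 0 -> inLam0 N0 y) ->
  \sum_(l <- s) F (p l) = \sum_(y <- Lam0 d N0 | `[< X y >]) F y.
Proof.
move=> us pinj Xp pX Fs FN.
rewrite -[RHS]big_filter -(big_map p xpredT F); apply: big_supp.
- by rewrite map_inj_uniq.
- by rewrite filter_uniq// Lam0_uniq.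
move=> y Fy; rewrite mem_filter.
have -> : y \in Lam0 d N0 by apply/mem_Lam0/FN.
rewrite andbT; apply/mapP/asboolP => [[l _ ->]//|/pX[l yl]].
by exists l => //; apply: Fs; rewrite -yl.
Qed.

(** Orthonormality of the columns of the two-channel filter matrix. With D = k - k', the low-pass
    terms run over the coset k' - A Z^d and the high-pass terms, up to the sign (-1)^(q.D), over lA
    - D - k' + A Z^d. If D lies in A Z^d, the sign is 1 and the two cosets partition the lattice, so
    the sum is the orthogonality relation at D. Otherwise the cosets coincide, the sign is -1 and
    the two contributions cancel. *)
Lemma filter_columns S : exists N1, forall N k k', (N1 <= N)%N -> inLam0 S k -> inLam0 S k' ->
  \sum_(l <- Lam0 d N) (conjc (h (k - A *m l)) * h (k' - A *m l) +
    conjc (gcoef (k - A *m l)) * gcoef (k' - A *m l)) = (k == k')%:R.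
Proof.
have [Nl hNl] := inLam0_ex lA.
(* A nonzero term forces A l into the cube of radius Nl + S + N0: the filter argument lies within
   N0, and the shifts by [lA] and by [k] or [k'] add at most Nl + S. *)
have [N1 hN1] := preimage_bound hdet (Nl + S + N0); exists N1 => N k k' NN Sk Sk'.
pose D := k - k'.
pose F p := h p * conjc (h (p + D)).
have FN y : F y != 0 -> inLam0 N0 y.
  by move=> Fy; apply: h_neq0; apply: contraNneq Fy => h0; rewrite /F h0 mul0r.
have Ainj := mulA_inj hdet.
have bd (l : Z) T : (T <= Nl + S + N0)%N -> inLam0 T (A *m l) -> l \in Lam0 d N.
  by move=> TT hl; apply/mem_Lam0/(inLam0_le NN)/hN1; exact: inLam0_le hl.
have S1 : \sum_(l <- Lam0 d N) F (k' - A *m l) =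
    \sum_(y <- Lam0 d N0 | `[< mcoset k' (latt A) y >]) F y.
  apply: (@coset_sum F (fun l => k' - A *m l) (mcoset k' (latt A))) => //.
  - exact: Lam0_uniq.
  - by move=> l l' /= /addrI /oppr_inj /Ainj.
  - by move=> l; exists (A *m l) => //; exists l.
  - by move=> y [_ [l _ <-] <-]; exists l.
  - move=> l Fl; apply: (@bd l (S + N0)%N); first by rewrite -addnA leq_addl.
    rewrite (_ : A *m l = k' + - (k' - A *m l)); last by rewrite opprB addrCA subrr addr0.
    by apply: inLam0D => //; apply: inLam0N; exact: FN.
have S2 : \sum_(l <- Lam0 d N) F (lA - k + A *m l) =
    \sum_(y <- Lam0 d N0 | `[< pcoset (lA - D - k') (latt A) y >]) F y.
  have E : lA - D - k' = lA - k by rewrite /D; apply/colP => i; rewrite !mxE; ring.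
  rewrite E; apply: (@coset_sum F (fun l => lA - k + A *m l) (pcoset (lA - k) (latt A))) => //.
  - exact: Lam0_uniq.
  - by move=> l l' /= /addrI /Ainj.
  - by move=> l; exists (A *m l) => //; exists l.
  - by move=> y [_ [l _ <-] <-]; exists l.
  - move=> l Fl; apply: (@bd l (Nl + S + N0)%N) => //.
    rewrite (_ : A *m l = (- lA + k) + (lA - k + A *m l)); last first.
      by apply/colP => i; rewrite !mxE; ring.
    by apply: inLam0D; [apply: inLam0D => //; exact: inLam0N|exact: FN].
(* The two exponents add up to q.D plus twice q.(k' - A l), so only the parity of q.D survives. *)
have sgE l : conjc (gcoef (k - A *m l)) * gcoef (k' - A *m l) =
    (-1) ^ (dotZ qA D) * F (lA - k + A *m l).
  rewrite /gcoef rmorphM/= conjcK conjc_sg /F.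
  have -> : lA - (k - A *m l) = lA - k + A *m l by apply/colP => i; rewrite !mxE; ring.
  have -> : lA - (k' - A *m l) = lA - k + A *m l + D.
    by apply/colP => i; rewrite /D !mxE; ring.
  rewrite mulrACA; congr (_ * _).
  have N0' : (-1 : C) != 0 by rewrite oppr_eq0 oner_neq0.
  rewrite -expfzDr// -dotZD.
  have -> : k - A *m l + (k' - A *m l) = D + (k' - A *m l) + (k' - A *m l).
    by apply/colP => i; rewrite /D !mxE; ring.
  set w := k' - A *m l; rewrite -addrA [dotZ qA (D + _)]dotZD [dotZ qA (w + w)]dotZD.
  rewrite expfzDr// [X in _ * X](_ : _ = 1) ?mulr1//.
  rewrite sg_parity ifT//; apply/dvdzP; exists (dotZ qA w).
  by rewrite mulr_natr mulr2n || lia.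
have hE l : conjc (h (k - A *m l)) * h (k' - A *m l) = F (k' - A *m l).
  by rewrite /F mulrC; congr (_ * conjc (h _)); apply/colP => i; rewrite /D !mxE; ring.
rewrite (eq_bigr (fun l => F (k' - A *m l) + (-1) ^ (dotZ qA D) * F (lA - k + A *m l))); last first.
  by move=> l _; rewrite hE sgE.
rewrite big_split/= -mulr_sumr S1 S2 sg_parity.
have [LD|LD] := pselect (latt A D).
  rewrite hq1// mul1r; have [e1 e2] := hm1 k' LD.
  have <- : (D == 0) = (k == k') by rewrite /D subr_eq0.
  rewrite -(horth LD) [RHS](bigID (fun y => `[< mcoset k' (latt A) y >]))/=.
  congr (_ + _); apply: eq_bigl => y; apply/asboolP/idP => [hy|/asboolPn hy].
    apply/asboolPn => hy'; have : (mcoset k' (latt A) `&` pcoset (lA - D - k') (latt A)) y by [].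
    by rewrite e2.
  by have : [set: Z] y by []; rewrite e1 => -[].
have LD' : pcoset lA (latt A) D by have : [set: Z] D by []; rewrite hl1 => -[].
rewrite (negbTE (hq2 LD')) (hm2 _ LD') mulN1r subrr.
have -> : k == k' = false.
  by apply/negbTE/eqP => kk; apply: LD; rewrite /D kk subrr; exact: latt0.
by [].
Qed.

(** A matrix with orthonormal columns preserves the sum of squares: expand the squares, sum over [l]
    first, and only the diagonal k = k' remains. Writing the high-pass index as lA - m lets [m]
    range over the support of [h]. *)
Lemma filter_identity (c : Z -> C) S : (forall n, ~ inLam0 S n -> c n = 0) ->
  exists N1, forall N, (N1 <= N)%N ->
  \sum_(l <- Lam0 d N)
    (sqmod (\sum_(n <- Lam0 d N0) conjc (h n) * c (A *m l + n)) +
     sqmod (\sum_(m <- Lam0 d N0) conjc (gcoef (lA - m)) * c (A *m l + (lA - m)))) =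
  \sum_(n <- Lam0 d S) sqmod (c n).
Proof.
move=> cS; have [N1 hN1] := filter_columns S; exists N1 => N NN.
have c_neq0 n : c n != 0 -> n \in Lam0 d S.
  by move=> cn; apply/mem_Lam0; apply: contrapT => /cS /eqP; rewrite (negbTE cn).
have U l : \sum_(n <- Lam0 d N0) conjc (h n) * c (A *m l + n) =
    \sum_(k <- Lam0 d S) conjc (h (k - A *m l)) * c k.
  rewrite (eq_bigr (fun n => (fun k => conjc (h (k - A *m l)) * c k) (A *m l + n))); last first.
    by move=> n _; rewrite addrC addKr || rewrite addrAC subrr add0r.
  rewrite -(big_map (fun n => A *m l + n) xpredT (fun k => conjc (h (k - A *m l)) * c k)).
  apply: big_supp; [by rewrite map_inj_uniq ?Lam0_uniq//; exact: addrI|exact: Lam0_uniq|].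
  move=> k; rewrite mulf_eq0 negb_or conjc_eq0 => /andP[h1 h2].
  rewrite c_neq0//; apply/mapP; exists (k - A *m l); first exact/mem_Lam0/h_neq0.
  by rewrite addrC subrK.
have V l : \sum_(m <- Lam0 d N0) conjc (gcoef (lA - m)) * c (A *m l + (lA - m)) =
    \sum_(k <- Lam0 d S) conjc (gcoef (k - A *m l)) * c k.
  rewrite (eq_bigr (fun m => (fun k => conjc (gcoef (k - A *m l)) * c k) (A *m l + (lA - m)))); last first.
    by move=> m _; rewrite [A *m l + _]addrC addrK.
  rewrite -(big_map (fun m => A *m l + (lA - m)) xpredT (fun k => conjc (gcoef (k - A *m l)) * c k)).
  apply: big_supp; [|exact: Lam0_uniq|].
    by rewrite map_inj_uniq ?Lam0_uniq// => m m' /addrI /addrI /oppr_inj.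
  move=> k; rewrite mulf_eq0 negb_or conjc_eq0 /gcoef mulf_eq0 negb_or conjc_eq0.
  move=> /andP[/andP[_ h1] h2]; rewrite c_neq0//; apply/mapP.
  exists (lA - (k - A *m l)); first exact/mem_Lam0/h_neq0.
  by apply/colP => i; rewrite !mxE; ring.
apply: (@complexI R); rewrite [LHS]rmorph_sum [RHS]rmorph_sum/=.
rewrite (eq_bigr (fun l => \sum_(k <- Lam0 d S) \sum_(k' <- Lam0 d S)
   c k * conjc (c k') * (conjc (h (k - A *m l)) * h (k' - A *m l) +
    conjc (gcoef (k - A *m l)) * gcoef (k' - A *m l)))); last first.
  move=> l _; rewrite U V rmorphD/= -!mul_conjc !rmorph_sum/= !mulr_suml -big_split.
  apply: eq_bigr => k _; rewrite !mulr_sumr -big_split; apply: eq_bigr => k' _.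
  by rewrite !rmorphM/= !conjcK mulrDr; congr (_ + _); rewrite mulrACA mulrC.
rewrite exchange_big/= [LHS]big_seq [RHS]big_seq; apply: eq_bigr => k kS.
rewrite exchange_big/= [LHS]big_seq.
rewrite (eq_bigr (fun k' => c k * conjc (c k') * (k == k')%:R)); last first.
  by move=> k' k'S; rewrite -mulr_sumr hN1//; exact/mem_Lam0.
rewrite -big_seq (bigD1_seq k)//= ?Lam0_uniq// eqxx mulr1 mul_conjc big1 ?addr0//.
by move=> k' kk'; rewrite eq_sym (negbTE kk') mulr0.
Qed.

End filter.

(** * Dilations and translations *)

Section dilations.
Variables (R : realType) (d : nat) (A : 'M[int]_d).
Hypothesis hdet : `|\det A| = 2 :> int.
Local Notation V := (d.-tuple R).
Local Notation C := R[i].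
Local Notation lebV := (lebT R d).
Local Notation Z := 'cV[int]_d.
Local Notation B := (mxR R A).
Implicit Types (K : int) (l : Z) (u f : V -> C).

Let unitB : B \in unitmx. Proof. exact: unit_mxR. Qed.

Definition dilmx K : 'M[R]_d :=
  match K with Posz k => B ^+ k | Negz k => invmx B ^+ k.+1 end.

Definition dilc K : R := Num.sqrt 2 ^ K.

Lemma sqrt2_gt0 : 0 < Num.sqrt 2 :> R. Proof. by rewrite sqrtr_gt0. Qed.

Lemma dilc_gt0 K : 0 < dilc K. Proof. by rewrite /dilc exprz_gt0// sqrt2_gt0. Qed.

Lemma dilcS K : dilc (K + 1) = dilc K * Num.sqrt 2.
Proof. by rewrite /dilc expfzDr ?expr1z// gt_eqF// sqrt2_gt0. Qed.

Lemma mulVB : invmx B * B = 1. Proof. exact: mulVmx. Qed.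
Lemma mulBV : B * invmx B = 1. Proof. exact: mulmxV. Qed.

Lemma dilmxS K : dilmx (K + 1) = B *m dilmx K.
Proof.
case: K => [k|[|k]] /=.
- by rewrite addn1 exprS.
- by rewrite expr1 expr0 mulmxV.
- by rewrite subn1 [in RHS]exprS mulmxE mulrA mulBV mul1r.
Qed.

Lemma expmxVK k : invmx B ^+ k *m B ^+ k = 1%:M.
Proof.
elim: k => [|k IH]; first by rewrite !expr0 mulmxE mulr1.
by rewrite exprSr exprS mulmxE mulrA -[_ * _ * B]mulrA mulVB mulr1 -mulmxE.
Qed.

Lemma expmxKV k : B ^+ k *m invmx B ^+ k = 1%:M.
Proof. exact: mulmx1C (expmxVK k). Qed.

Lemma dilmxN K : dilmx (- K) *m dilmx K = 1%:M.
Proof.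
case: K => [[|k]|k].
- by rewrite oppr0 /= !expr0 mulmxE mulr1.
- exact: expmxVK.
- by rewrite NegzE opprK; exact: expmxKV.
Qed.

Lemma unit_dilmx K : dilmx K \in unitmx.
Proof. by have /mulmx1_unit[] := dilmxN K. Qed.

Lemma det_expmx (M : 'M[R]_d) k : \det (M ^+ k) = \det M ^+ k.
Proof.
by elim: k => [|k IH]; [rewrite !expr0 det1|rewrite exprS -mulmxE det_mulmx IH -exprS].
Qed.

Lemma det_mxR : `|\det B| = 2.
Proof.
rewrite (det_map_mx (intr : {rmorphism int -> R})) -intr_norm hdet.
by [].
Qed.

Lemma det_dilmx K : `|\det (dilmx K)| = dilc K ^+ 2.
Proof.
case: K => k.
  rewrite /dilc /= det_expmx normrX det_mxR -exprnP -exprM mulnC exprM sqr_sqrtr//.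
rewrite /dilc /= det_expmx det_inv normrX normfV det_mxR NegzE -exprz_inv -exprnP.
by rewrite -[in RHS]exprM mulnC [in RHS]exprM [in RHS]exprVn sqr_sqrtr.
Qed.

Lemma DApowE K f t : DApow A K f t = (dilc K)%:C * f (actM (dilmx K) t).
Proof.
case: K => k /=.
  elim: k t => [|k IH] t; first by rewrite /dilc /= expr0 actM1 expr0z mul1r.
  rewrite [LHS]/= /DA IH mulrA -actM_mul exprSr -mulmxE; congr (_ * _).
  by rewrite /dilc -rmorphM/= -!exprnP exprS.
rewrite /dilc -[DAinv A _]/(iter k.+1 (DAinv A) f) NegzE -exprz_inv -exprnP.
move: (k.+1) => m; elim: m t => [|m IH] t; first by rewrite /= !expr0 actM1 mul1r.
rewrite iterS /DAinv IH mulrA -actM_mul [invmx B ^+ m.+1]exprSr -mulmxE; congr (_ * _).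
by rewrite -rmorphM/= exprS.
Qed.

Definition tr K l u (t : V) : C := (dilc K)%:C * u (subt (actM (dilmx K) t) (intv R l)).

Lemma DApow_Tr K l u : DApow A K (Tr l u) = tr K l u.
Proof. by apply/funext => t; rewrite DApowE. Qed.

Lemma DA_Tr n u : DA A (Tr n u) = tr 1 n u.
Proof. by rewrite -DApow_Tr. Qed.

Lemma subt_intv0 (t : V) : subt t (intv R 0) = t.
Proof. by apply: eq_from_tnth => i; rewrite tnth_subt tnth_intv mxE subr0. Qed.

Lemma tr00 u : tr 0 0 u = u.
Proof.
by apply/funext => t; rewrite /tr /dilc /= expr0z mul1r expr0 actM1 subt_intv0.
Qed.

Lemma actM_subt (M : 'M[R]_d) (x y : V) : actM M (subt x y) = subt (actM M x) (actM M y).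
Proof.
apply: eq_from_tnth => i; rewrite tnth_subt !tnth_actM -sumrB; apply: eq_bigr => j _.
by rewrite tnth_subt mulrBr.
Qed.

Lemma actM_addt (M : 'M[R]_d) (x y : V) : actM M (addt x y) = addt (actM M x) (actM M y).
Proof.
apply: eq_from_tnth => i; rewrite tnth_addt !tnth_actM -big_split; apply: eq_bigr => j _.
by rewrite tnth_addt mulrDr.
Qed.

Lemma actM_intv l : actM B (intv R l) = intv R (A *m l).
Proof.
apply: eq_from_tnth => i; rewrite tnth_actM tnth_intv mxE rmorph_sum/=.
by apply: eq_bigr => j _; rewrite tnth_intv mxE rmorphM.
Qed.

(** The commutation T_l D = D T_(A l), by which a two-scale equation becomes a recursion from level
    K + 1 to level K for inner products. *)
Lemma tr_tr1 K l n u : tr K l (tr 1 n u) = tr (K + 1) (A *m l + n) u.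
Proof.
apply/funext => t; rewrite /tr mulrA -rmorphM/= dilcS {2}/dilc expr1z; congr (_ * u _).
rewrite dilmxS actM_mul /= expr1 actM_subt actM_intv.
apply: eq_from_tnth => i; rewrite !tnth_subt !tnth_intv [(_ + n) i 0]mxE rmorphD/=.
by rewrite opprD addrA.
Qed.

Definition dilmap K l (t : V) : V := subt (actM (dilmx K) t) (intv R l).
Definition dilmapV K l (s : V) : V := actM (dilmx (- K)) (addt s (intv R l)).

Lemma dilmapK K l : cancel (dilmap K l) (dilmapV K l).
Proof.
move=> t; rewrite /dilmap /dilmapV (_ : addt _ _ = actM (dilmx K) t).
  by rewrite -actM_mul dilmxN actM1.
by apply: eq_from_tnth => i; rewrite tnth_addt tnth_subt subrK.
Qed.

Lemma dilmapE K l : dilmap K l = fun t => addt (actM (dilmx K) t) (intv R (- l)).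
Proof.
apply/funext => t; apply: eq_from_tnth => i.
by rewrite tnth_subt tnth_addt !tnth_intv mxE rmorphN.
Qed.

Lemma measurable_dilmap K l : measurable_fun setT (dilmap K l).
Proof. rewrite dilmapE; exact: measurableT_comp (measurable_addt _) (measurable_actM _). Qed.

Lemma measurable_dilmapV K l : measurable_fun setT (dilmapV K l).
Proof. exact: measurableT_comp (measurable_actM _) (measurable_addt _). Qed.

Lemma integral_dilmap K l (F : V -> \bar R) : measurable_fun setT F -> (forall t, 0 <= F t)%E ->
  (\int[lebV]_t F (dilmap K l t) = (dilc K ^- 2)%:E * \int[lebV]_t F t)%E.
Proof.
move=> mF F0; rewrite dilmapE.
rewrite (unitmx_cov (unit_dilmx K) (F := fun t => F (addt t (intv R (- l)))))//.
  by rewrite ge0_integral_addt// det_dilmx.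
by apply: measurableT_comp mF _; exact: measurable_addt.
Qed.

Lemma integral_dilmapV K l (F : V -> \bar R) : measurable_fun setT F -> (forall t, 0 <= F t)%E ->
  (\int[lebV]_t F (dilmapV K l t) = (dilc (- K) ^- 2)%:E * \int[lebV]_t F t)%E.
Proof.
move=> mF F0; rewrite /dilmapV.
rewrite (ge0_integral_addt (intv R l) (F := fun t => F (actM (dilmx (- K)) t)))//.
  by rewrite (unitmx_cov (unit_dilmx (- K)))// det_dilmx.
by apply: measurableT_comp mF _; exact: measurable_actM.
Qed.

Definition dil_l2 K l := @scaling_l2 _ _ _ _ _ _ (measurable_dilmap K l) (@integral_dilmap K l).
Definition dilV_l2 K l := @scaling_l2 _ _ _ _ _ _ (measurable_dilmapV K l) (@integral_dilmapV K l).
Definition dil_cint K l := @scaling_cint _ _ _ _ _ _ (measurable_dilmap K l) (@integral_dilmap K l).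
Definition dil_cintegrable K l :=
  @scaling_cintegrable _ _ _ _ _ _ (measurable_dilmap K l) (@integral_dilmap K l).
Definition dil_nr K l := @scaling_nr _ _ _ _ _ _ (@integral_dilmap K l).

Lemma l2_tr K l u : l2 lebV u -> l2 lebV (tr K l u).
Proof. by move=> lu; apply: l2Z; exact: dil_l2. Qed.

Lemma nr_tr K l u : l2 lebV u -> nr lebV (tr K l u) = nr lebV u.
Proof.
move=> lu; rewrite /tr nrZ; last exact: (@dil_l2 K l).
have /= -> := @dil_nr K l _ lu; rewrite sqmodC mulrA mulfV ?mul1r//.
by rewrite expf_neq0// gt_eqF// dilc_gt0.
Qed.

Lemma cintegrable_tr K l u : cintegrable lebV u -> cintegrable lebV (tr K l u).
Proof. by move=> iu; apply: cintegrableZ; exact: dil_cintegrable. Qed.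

Lemma cint_tr K l u : cintegrable lebV u -> cint lebV (tr K l u) = (dilc K)^-1%:C * cint lebV u.
Proof.
move=> iu; rewrite /tr cintZ; last exact: (@dil_cintegrable K l).
have /= -> := @dil_cint K l _ iu; rewrite mulrA -rmorphM/=; congr (_%:C * _).
by field; rewrite gt_eqF// dilc_gt0.
Qed.

Lemma cip_tr K l f u : l2 lebV f -> l2 lebV u ->
  cip lebV f (tr K l u) = (dilc K)^-1%:C * cip lebV (fun s => f (dilmapV K l s)) u.
Proof.
move=> lf lu; pose F s := f (dilmapV K l s) * conjc (u s).
have iF : cintegrable lebV F by apply: cip_integrable => //; exact: dilV_l2.
rewrite /cip -/F -(cint_tr K l iF); congr cint; apply/funext => t; rewrite /tr rmorphM/=.
rewrite /F -/(dilmap K l t) dilmapK mulrCA; congr (_ * _).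
by rewrite oppr0.
Qed.

(** The dilation and translation are moved by a change of variables onto the test function, which
    stays in L^2; weak convergence is thus inherited by every [tr K l]. *)
Lemma ccvg_tr K l (u : nat -> V -> C) (phi : V -> C) :
  (forall n, l2 lebV (u n)) -> l2 lebV phi ->
  (forall f, l2 lebV f -> ccvg (fun n => cip lebV f (u n)) (cip lebV f phi)) ->
  forall f, l2 lebV f -> ccvg (fun n => cip lebV f (tr K l (u n))) (cip lebV f (tr K l phi)).
Proof.
move=> lu lphi h f lf; rewrite cip_tr//.
rewrite (_ : (fun n => _) =
  fun n => (dilc K)^-1%:C * cip lebV (fun s => f (dilmapV K l s)) (u n)); last first.
  by apply/funext => n; rewrite cip_tr.
by apply: ccvgM; [exact: ccvg_cst|apply: h; exact: dilV_l2].
Qed.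

Lemma tr_sum (I : Type) (s : seq I) (c : I -> C) (F : I -> V -> C) K l :
  tr K l (fun t => \sum_(i <- s) c i * F i t) = fun t => \sum_(i <- s) c i * tr K l (F i) t.
Proof.
by apply/funext => t; rewrite /tr mulr_sumr; apply: eq_bigr => i _; rewrite mulrCA.
Qed.

Lemma cip_tr_sum (I : Type) (s : seq I) (c : I -> C) (n : I -> Z) f u K l :
  l2 lebV f -> l2 lebV u ->
  cip lebV f (tr K l (fun t => \sum_(i <- s) c i * DA A (Tr (n i) u) t)) =
  \sum_(i <- s) conjc (c i) * cip lebV f (tr (K + 1) (A *m l + n i) u).
Proof.
move=> lf lu; rewrite tr_sum cip_sumr//.
  by apply: eq_bigr => i _; rewrite DA_Tr tr_tr1 cipZr//; exact: l2_tr.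
by move=> i; rewrite DA_Tr; apply: l2Z; apply: l2_tr; exact: l2_tr.
Qed.

End dilations.

(** * Infinite products and the unit cube *)

Section infinite_products.
Variable R : realType.
Local Notation C := R[i].

Lemma cvg_geometric_increments (u : nat -> R) (K r : R) : 0 < r -> r < 1 ->
  (forall n, `|u n.+1 - u n| <= K * r ^+ n) -> cvgn u.
Proof.
move=> r0 r1 h.
have c : cvgn (series (telescope u)).
  apply: normed_cvg; apply: (@series_le_cvg _ _ (geometric K r)).
  - by move=> n /=; exact: normr_ge0.
  - by move=> n; exact: (le_trans (normr_ge0 _) (h n)).
  - exact: h.
  - by apply: is_cvg_geometric_series; rewrite ger0_norm ?ltW.
rewrite (_ : u = fun n => u 0%N + series (telescope u) n).
  by apply: is_cvgD => //; exact: is_cvg_cst.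
by apply/funext => n; exact: eq_sum_telescope.
Qed.

(** The partial products are bounded by an exponential of a geometric sum, so their increments are
    themselves geometric and summable. No factor has to be nonzero. *)
Lemma ccvg_prod (z : nat -> C) (E r : R) : 0 < r -> r < 1 -> 0 <= E ->
  (forall j, cabs (z j - 1) <= E * r ^+ j) ->
  exists l, ccvg (fun J => \prod_(1 <= j < J.+1) z j) l.
Proof.
move=> r0 r1 E0 hz; pose P J := \prod_(1 <= j < J.+1) z j; rewrite -/P.
have r1' : 1 - r != 0 by rewrite subr_eq0 gt_eqF.
have r1p : 0 < 1 - r by rewrite subr_gt0.
have PS J : P J.+1 = P J * z J.+1 by rewrite /P big_nat_recr.
have cz j : cabs (z j) <= 1 + E * r ^+ j.
  rewrite -[z j](subrK 1) addrC; apply: (le_trans (cabsD _ _)); rewrite lerD//.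
  by rewrite (_ : 1 = 1%:C)// cabsC normr1.
(* The exponent is E times the sum of r^j for 0 <= j <= J. The term j = 0 has no counterpart in the
   product; it only makes the empty product an easy base case. *)
have bnd J : cabs (P J) <= expR (E * (1 - r ^+ J.+1) / (1 - r)).
  elim: J => [|J IH].
    rewrite /P big_geq// (_ : 1 = 1%:C)// cabsC normr1 expr1 mulfK//.
    by apply: le_trans (expR_ge1Dx _); rewrite lerDl.
  rewrite PS cabsM.
  apply: (@le_trans _ _ (expR (E * (1 - r ^+ J.+1) / (1 - r)) * expR (E * r ^+ J.+1))).
    apply: ler_pM; rewrite ?cabs_ge0//; apply: (le_trans (cz _)); exact: expR_ge1Dx.
  rewrite -expRD le_eqVlt; apply/orP; left; apply/eqP; congr expR.
  by rewrite [r ^+ J.+2]exprS; move: (r ^+ J.+1) => q; field.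
have bnd' J : cabs (P J) <= expR (E / (1 - r)).
  apply: (le_trans (bnd J)); rewrite ler_expR ler_wpM2r ?invr_ge0 ?(ltW r1p)//.
  by rewrite ler_piMr// lerBlDr lerDl exprn_ge0// ltW.
have inc J : cabs (P J.+1 - P J) <= (expR (E / (1 - r)) * (E * r)) * r ^+ J.
  rewrite PS -[X in _ - X]mulr1 -mulrBr cabsM -mulrA -[E * r * _]mulrA -exprS.
  by apply: ler_pM; rewrite ?cabs_ge0.
exists (limC P); split; apply: (@cvg_geometric_increments _ _ r) => // J.
  by rewrite -cReB; apply: (le_trans (normr_cRe _)); exact: inc.
by rewrite -cImB; apply: (le_trans (normr_cIm _)); exact: inc.
Qed.

End infinite_products.

(** * Orthonormal families and Bessel's inequality *)

Section hilbert.
Context dT (T : measurableType dT) (R : realType) (mu : {measure set T -> \bar R}).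
Local Notation C := R[i].
Implicit Types f g : T -> C.

Lemma cabs_cint_le f (g : T -> R) : cintegrable mu f -> mu.-integrable setT (fun t => (g t)%:E) ->
  (forall t, cabs (f t) <= g t) -> cabs (cint mu f) <= fine (\int[mu]_t (g t)%:E)%E.
Proof.
move=> cf ig fg; apply: (le_trans (cabs_cint cf)).
have ic := cintegrable_cabs cf.
apply: fine_le; [exact: integrable_fin_num|exact: integrable_fin_num|].
by apply: le_integral => // t _; rewrite lee_fin.
Qed.

Lemma cip_pointwise0 f g : (forall t, f t != 0 -> g t != 0 -> False) -> cip mu f g = 0.
Proof.
move=> fg; rewrite /cip (_ : (fun t => _) = fun=> 0) ?cint0//.
apply/funext => t; have [->|f0] := eqVneq (f t) 0; first by rewrite mul0r.
have [->|g0] := eqVneq (g t) 0; first by rewrite conjc0 mulr0.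
by case: (fg t).
Qed.

Variables (I : eqType) (e : I -> T -> C).
Hypothesis le : forall i, l2 mu (e i).
Hypothesis oe : forall i j, cip mu (e i) (e j) = (i == j)%:R.

Lemma cip_orthonormal (s : seq I) (c : I -> C) i : uniq s -> i \in s ->
  cip mu (e i) (fun t => \sum_(j <- s) c j * e j t) = conjc (c i).
Proof.
move=> us is_; rewrite cip_sumr//; last by move=> j; exact: l2Z.
rewrite (bigD1_seq i)//= cipZr// oe eqxx mulr1 big1 ?addr0// => j ji.
by rewrite cipZr// oe eq_sym (negbTE ji) mulr0.
Qed.

Lemma nr_orthonormal (s : seq I) (c : I -> C) : uniq s ->
  nr mu (fun t => \sum_(j <- s) c j * e j t) = \sum_(j <- s) sqmod (c j).
Proof.
move=> us; set g := fun t => _.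
have lg : l2 mu g by apply: l2_sum => i; exact: l2Z.
apply: (@complexI R); rewrite -cip_self// {1}/g cip_suml//; last by move=> i; exact: l2Z.
rewrite rmorph_sum/= [LHS]big_seq [RHS]big_seq; apply: eq_bigr => i is_.
by rewrite cipZl// cip_orthonormal// mul_conjc.
Qed.

Lemma bessel (s : seq I) f : uniq s -> l2 mu f ->
  \sum_(i <- s) sqmod (cip mu f (e i)) <= nr mu f.
Proof.
move=> us lf; set S := \sum_(i <- s) _.
pose c i := cip mu f (e i); pose g t := \sum_(j <- s) c j * e j t.
have lg : l2 mu g by apply: l2_sum => i; exact: l2Z.
have fg : cip mu f g = S%:C.
  rewrite cip_sumr//; last by move=> j; exact: l2Z.
  by rewrite rmorph_sum/=; apply: eq_bigr => i _; rewrite cipZr// mulrC mul_conjc.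
have gg : cip mu g g = S%:C by rewrite cip_self// nr_orthonormal.
have E : nr mu (fun t => f t - g t) = nr mu f - S.
  apply: (@complexI R); rewrite -cip_self; last exact: l2B.
  rewrite cipBl//; last exact: l2B.
  rewrite !cipBr// gg fg cip_self// (cipJ lf lg) fg conjc_real subrr subr0.
  by rewrite rmorphB.
by rewrite -subr_ge0 -E nr_ge0.
Qed.

End hilbert.

Section unitcube.
Variables (R : realType) (d : nat).
Local Notation V := (d.-tuple R).
Local Notation C := R[i].
Local Notation lebV := (lebT R d).
Local Notation leb := (@lebesgue_measure R).

(** Half-open, so that the integer translates tile the space: each point lies in exactly one of
    them, the one indexed by [floorv]. *)
Definition unitcube (t : V) : R := \prod_i \1_(`[0, 1[%classic) (tnth t i).

Lemma unitcubeE t : unitcube t = [forall i, 0 <= tnth t i < 1]%:R.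
Proof.
case: (boolP [forall i, _]) => [/forallP h|/forallPn[i hi]]; rewrite /unitcube.
  by rewrite big1// => i _; rewrite indicE mem_set//= in_itv/= h.
rewrite (bigD1 i)//= indicE memNset ?mul0r//=.
by rewrite in_itv/=; exact/negP.
Qed.

Lemma integral_unitcube : (\int[lebV]_t (unitcube t)%:E = 1%:E)%E.
Proof.
rewrite (@integral_tuple_prod R d (fun=> \1_(`[0, 1[%classic)) (fun=> 1)) ?big1//.
move=> i; rewrite integral_indic//= setIT lebesgue_measure_itv/= lte_fin ltr01.
by rewrite -EFinB subr0.
Qed.

Lemma measurable_unitcube : measurable_fun setT unitcube.
Proof.
apply: (@measurable_tuple_prod R d (fun=> \1_(`[0, 1[%classic))) => i.
exact: measurable_indic.
Qed.

Lemma integrable_unitcube : lebV.-integrable setT (fun t => (unitcube t)%:E).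
Proof.
apply/integrableP; split; first by apply/measurable_EFinP; exact: measurable_unitcube.
rewrite (eq_integral (fun t => (unitcube t)%:E)) ?integral_unitcube ?ltry// => t _.
by rewrite /= ger0_norm// unitcubeE.
Qed.

Definition phi0 (t : V) : C := (unitcube t)%:C.

Lemma cintegrable_phi0 : cintegrable lebV phi0.
Proof.
apply: (@cintegrable_le _ _ _ _ _ unitcube); [|exact: integrable_unitcube|].
- by apply: cmeasC; exact: measurable_unitcube.
- by move=> t; rewrite cabsC ger0_norm// unitcubeE.
Qed.

Lemma sqmod_phi0 t : sqmod (phi0 t) = unitcube t.
Proof. by rewrite sqmodC unitcubeE; case: [forall i, _]; rewrite ?expr1n ?expr0n. Qed.

Lemma l2_phi0 : l2 lebV phi0.
Proof.
apply: (proj1 (@l2_le _ _ _ _ _ unitcube _ _ _)).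
- by apply: cmeasC; exact: measurable_unitcube.
- exact: integrable_unitcube.
- by move=> t; rewrite sqmod_phi0.
Qed.

Lemma nr_phi0 : nr lebV phi0 = 1.
Proof.
rewrite /nr /nsq (eq_integral (fun t => (unitcube t)%:E)) ?integral_unitcube// => t _.
by rewrite sqmod_phi0.
Qed.

Lemma cint_phi0 : cint lebV phi0 = 1.
Proof. by apply: complex_ext => /=; rewrite ?integral_unitcube// integral0. Qed.

Definition floorv (t : V) : 'cV[int]_d := \col_i Num.floor (tnth t i).

Lemma phi0_sub (y : V) (l : 'cV[int]_d) : phi0 (subt y (intv R l)) = (l == floorv y)%:R.
Proof.
rewrite /phi0 unitcubeE rmorph_nat; congr (_%:R); congr nat_of_bool.
apply/forallP/eqP => [h|-> i].
  apply/colP => i; rewrite mxE; apply/esym/eqP; rewrite floor_eq.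
  have := h i; rewrite tnth_subt tnth_intv => /andP[h1 h2].
  by rewrite rmorphD/= -subr_ge0 h1/= -ltrBlDl.
rewrite tnth_subt tnth_intv mxE subr_ge0 floor_le_tmp/= ltrBlDl.
by rewrite -[X in _ + X](mulr1z 1) -rmorphD/= floorD1_gt.
Qed.

Lemma FT0_phi0_sub1 (y : V) (rho : R) : (forall i, `|tnth y i| <= rho) ->
  cabs (FT0 phi0 y - 1) <= 2 * (d%:R * rho).
Proof.
move=> hy; rewrite -{1}cint_phi0 /FT0 -cintB; last exact: cintegrable_phi0.
  have := @cabs_cint_le _ _ _ lebV (fun s => expi (- dotR y s) * phi0 s - phi0 s)
    (fun s => (2 * (d%:R * rho)) * unitcube s).
  rewrite (_ : (\int[lebV]_t (2 * (d%:R * rho) * unitcube t)%:E =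
    (2 * (d%:R * rho))%:E)%E); last first.
    under eq_integral do rewrite EFinM.
    by rewrite integralZl ?integral_unitcube ?mule1//; exact: integrable_unitcube.
  apply.
  - by apply: cintegrableB; [apply: cintegrable_FT0|]; exact: cintegrable_phi0.
  - under eq_fun do rewrite EFinM.
    by apply: integrableZl => //; exact: integrable_unitcube.
  move=> s; rewrite -[X in _ - X]mul1r -mulrBl cabsM cabsC unitcubeE.
  case: (boolP [forall i, _]) => [/forallP hs|_]; last by rewrite normr0 !mulr0.
  rewrite normr1 !mulr1; apply: (le_trans (cabs_expi_sub1 _)).
  rewrite ler_pM2l// normrN /dotR; apply: (le_trans (ler_norm_sum _ _ _)).
  apply: (@le_trans _ _ (\sum_(i < d) rho)); last by rewrite sumr_const card_ord mulr_natl.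
  apply: ler_sum => i _; rewrite normrM -[rho]mulr1; apply: ler_pM => //.
  by have /andP[h1 h2] := hs i; rewrite ger0_norm// ltW.
by apply: cintegrable_FT0; exact: cintegrable_phi0.
Qed.

End unitcube.

(** * Oscillation of step functions *)

Section sums.
Variable R : realType.

Lemma cvg_sumr (I : Type) (s : seq I) (F : I -> nat -> R) (l : I -> R) :
  (forall i, F i @ \oo --> l i) ->
  (fun n => \sum_(i <- s) F i n) @ \oo --> \sum_(i <- s) l i.
Proof.
move=> hF; elim: s => [|i s IH].
  rewrite big_nil (_ : (fun n => _) = fun=> 0); first exact: cvg_cst.
  by apply/funext => n; rewrite big_nil.
rewrite big_cons (_ : (fun n => _) = fun n => F i n + \sum_(j <- s) F j n); first exact: cvgD.
by apply/funext => n; rewrite big_cons.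
Qed.

Lemma cvg0_small (u : nat -> R) : u @ \oo --> (0 : R) -> forall e, 0 < e ->
  exists N, forall n, (N <= n)%N -> u n < e.
Proof.
move=> hu e e0; have [N _ hN] := cvgr0_norm_lt _ hu _ e0.
by exists N => n Nn; apply: le_lt_trans (ler_norm _) (hN n Nn).
Qed.

(** The generalised sum is a supremum over finite sets, so the Parseval identity splits into a bound
    for all finite lists and the existence of nearly optimal ones. *)
Lemma esum_eq (T : choiceType) (F : T -> R) (B : R) :
  (forall s, uniq s -> \sum_(p <- s) F p <= B) ->
  (forall e, 0 < e -> exists2 s, uniq s & B - e <= \sum_(p <- s) F p) ->
  esum [set: T] (fun p => (F p)%:E) = B%:E.
Proof.
move=> ub lb; apply/eqP; rewrite eq_le; apply/andP; split.
  apply: ge_ereal_sup => _ [X [fX _] <-].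
  rewrite fsbig_finite// sumEFin lee_fin; apply: ub; exact: finmap.fset_uniq.
apply/lee_addgt0Pr => e e0; have [s us hs] := lb e e0.
rewrite -leeBlDr// -EFinB; apply: esum_ge; exists [set` s].
  by split => //; exact: finite_seq.
by rewrite -fsbig_seq// sumEFin lee_fin.
Qed.
End sums.

Section edges.
Variables (R : realType) (d : nat).
Local Notation V := (d.-tuple R).
Local Notation C := R[i].
Local Notation lebV := (lebT R d).
Implicit Types a b t x : V.

Definition shiftt a (e : R) : V := [tuple tnth a i + e | i < d].

Lemma tnth_shiftt a e i : tnth (shiftt a e) i = tnth a i + e.
Proof. by rewrite tnth_mktuple. Qed.

(* Dominates the oscillation of the box indicator over the cube of radius [e] around the point. *)
Definition edge (e : R) a b x : R :=
  boxf (shiftt a (- e)) (shiftt b e) x - boxf (shiftt a e) (shiftt b (- e)) x.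

Lemma edge_osc e a b t x : 0 <= e -> (forall i, `|tnth t i - tnth x i| <= e) ->
  `|boxf a b t - boxf a b x| <= edge e a b x.
Proof.
move=> e0 tx; rewrite /edge.
have [/forallP ho|/forallPn[i hi]] :=
    boolP [forall i, tnth (shiftt a (- e)) i <= tnth x i <= tnth (shiftt b e) i]; last first.
  rewrite (boxf_out hi); move: hi (tx i); rewrite !tnth_shiftt ler_norml => hi /andP[h1 h2].
  have o1 : ~~ (tnth a i <= tnth t i <= tnth b i).
    by apply: contra hi => /andP[h3 h4]; apply/andP; split; lra.
  have o2 : ~~ (tnth a i <= tnth x i <= tnth b i).
    by apply: contra hi => /andP[h3 h4]; apply/andP; split; lra.
  have o3 : ~~ (tnth (shiftt a e) i <= tnth x i <= tnth (shiftt b (- e)) i).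
    by rewrite !tnth_shiftt; apply: contra hi => /andP[h3 h4]; apply/andP; split; lra.
  by rewrite (boxf_out o1) (boxf_out o2) (boxf_out o3) subrr normr0.
rewrite (boxf_in ho).
have [/forallP hi|/forallPn[i hi]] :=
    boolP [forall i, tnth (shiftt a e) i <= tnth x i <= tnth (shiftt b (- e)) i].
  rewrite (boxf_in hi) !boxf_in ?subrr ?normr0// => i.
    by have := hi i; rewrite !tnth_shiftt => /andP[h3 h4]; apply/andP; split; lra.
  have := hi i; have := tx i; rewrite !tnth_shiftt ler_norml => /andP[h1 h2] /andP[h3 h4].
  by apply/andP; split; lra.
rewrite (boxf_out hi) subr0.
by case: (boxf_01 a b t) => ->; case: (boxf_01 a b x) => ->;
  rewrite ?subrr ?normr0 ?subr0 ?normr1 ?sub0r ?normrN1.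
Qed.

Lemma edge_ge0 e a b x : 0 <= e -> 0 <= edge e a b x.
Proof.
by move=> e0; apply: le_trans (@edge_osc e a b x x e0 _) => // i; rewrite subrr normr0.
Qed.

Lemma edge_le1 e a b x : edge e a b x <= 1.
Proof. by rewrite /edge lerBlDr (le_trans (boxf_le1 _ _ _))// lerDl boxf_ge0. Qed.

Definition evol (e : R) a b : R :=
  \prod_i Num.max 0 (tnth b i - tnth a i + 2 * e) -
  \prod_i Num.max 0 (tnth b i - tnth a i - 2 * e).

Lemma integral_edge e a b : lebV.-integrable setT (fun t => (edge e a b t)%:E) /\
  (\int[lebV]_t (edge e a b t)%:E = (evol e a b)%:E)%E.
Proof.
have i1 := integrable_boxf (shiftt a (- e)) (shiftt b e).
have i2 := integrable_boxf (shiftt a e) (shiftt b (- e)).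
split.
  by under eq_fun do rewrite /edge EFinB; exact: integrableB.
under eq_integral do rewrite /edge EFinB.
rewrite integralB// !integral_boxf -EFinB /evol; congr (_ - _)%:E; apply: eq_bigr => i _;
  by rewrite !tnth_shiftt; congr Num.max; ring.
Qed.

Lemma cvg_evol (e : nat -> R) a b : e @ \oo --> (0 : R) -> (fun n => evol (e n) a b) @ \oo --> (0 : R).
Proof.
move=> he.
have hm (c g : R) : (fun n => Num.max 0 (c + g * e n)) @ \oo --> Num.max 0 c.
  have hc : (fun n => c + g * e n) @ \oo --> c.
    rewrite -[X in _ --> X]addr0 -[X in _ --> _ + X](mulr0 g).
    by apply: cvgD; [exact: cvg_cst|apply: cvgM => //; exact: cvg_cst].
  rewrite (_ : (fun n => _) = fun n => (0 + (c + g * e n) + `|0 - (c + g * e n)|) / 2); last first.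
    by apply/funext => n; rewrite Num.Theory.maxr_absE.
  rewrite Num.Theory.maxr_absE; apply: cvgM; last exact: cvg_cst.
  apply: cvgD; first by apply: cvgD => //; exact: cvg_cst.
  by apply: cvg_norm; apply: cvgB => //; exact: cvg_cst.
rewrite -[X in _ --> X](subrr (\prod_i Num.max 0 (tnth b i - tnth a i))).
apply: cvgB; apply: cvg_prod_ord => i; first exact: hm.
by have := hm (tnth b i - tnth a i) (- 2); under eq_fun do rewrite mulNr.
Qed.

Definition osc (s : seq (C * (V * V))) (e : R) (x : V) : R :=
  \sum_(p <- s) cabs p.1 * edge e p.2.1 p.2.2 x.

Lemma osc_bound s e t x : 0 <= e -> (forall i, `|tnth t i - tnth x i| <= e) ->
  cabs (stepf s t - stepf s x) <= osc s e x.
Proof.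
move=> e0 tx; rewrite /stepf /osc -sumrB; apply: (le_trans (cabs_sum _ _)).
apply: ler_sum => p _; rewrite -mulrBr cabsM -rmorphB/= cabsC.
by rewrite ler_wpM2l ?cabs_ge0//; exact: edge_osc.
Qed.

Lemma osc_ge0 s e x : 0 <= e -> 0 <= osc s e x.
Proof. by move=> e0; apply: sumr_ge0 => p _; rewrite mulr_ge0 ?cabs_ge0 ?edge_ge0. Qed.

Lemma osc_le s e x : osc s e x <= \sum_(p <- s) cabs p.1.
Proof. by apply: ler_sum => p _; rewrite ler_piMr ?cabs_ge0 ?edge_le1. Qed.

Lemma integral_osc s e : lebV.-integrable setT (fun t => (osc s e t)%:E) /\
  (\int[lebV]_t (osc s e t)%:E = (\sum_(p <- s) cabs p.1 * evol e p.2.1 p.2.2)%:E)%E.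
Proof.
elim: s => [|p s [IH1 IH2]].
  have -> : (fun t => (osc [::] e t)%:E) = fun=> 0%:E.
    by apply/funext => t; rewrite /osc big_nil.
  by rewrite big_nil integral0; split => //; exact: integrable0.
have [i1 v1] := integral_edge e p.2.1 p.2.2.
have -> : (fun t => (osc (p :: s) e t)%:E) =
    fun t => ((cabs p.1)%:E * (edge e p.2.1 p.2.2 t)%:E + (osc s e t)%:E)%E.
  by apply/funext => t; rewrite /osc big_cons EFinD EFinM.
have i2 : lebV.-integrable setT (fun t => ((cabs p.1)%:E * (edge e p.2.1 p.2.2 t)%:E)%E).
  exact: integrableZl.
split; first exact: integrableD.
by rewrite integralD// integralZl// v1 IH2 big_cons EFinD.
Qed.

Lemma cvg_osc s (e : nat -> R) : e @ \oo --> (0 : R) ->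
  (fun n => fine (\int[lebV]_t (osc s (e n) t)%:E)%E) @ \oo --> (0 : R).
Proof.
move=> he.
rewrite (_ : (fun n => _) = fun n => \sum_(p <- s) cabs p.1 * evol (e n) p.2.1 p.2.2); last first.
  by apply/funext => n; rewrite (integral_osc s (e n)).2.
rewrite [X in _ --> X](_ : _ = \sum_(p <- s) cabs p.1 * 0); last first.
  by rewrite big1// => p _; rewrite mulr0.
apply: cvg_sumr => p; apply: cvgM; [exact: cvg_cst|exact: cvg_evol].
Qed.

Lemma stepf_bsupp s : exists2 rho : R, 0 <= rho &
  forall t, stepf s t != 0 -> forall i, `|tnth t i| <= rho.
Proof.
elim: s => [|p s [rho r0 hr]].
  by exists 0 => // t; rewrite /stepf big_nil eqxx.
pose m := \sum_i (`|tnth p.2.1 i| + `|tnth p.2.2 i|).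
have m0 : 0 <= m by apply: sumr_ge0 => i _; rewrite addr_ge0.
exists (rho + m); first by rewrite addr_ge0.
move=> t; rewrite /stepf big_cons -/(stepf s t) => ht i.
have mi : `|tnth p.2.1 i| + `|tnth p.2.2 i| <= m.
  by rewrite /m (bigD1 i)//= lerDl sumr_ge0// => j _; rewrite addr_ge0.
have [st|st] := eqVneq (stepf s t) 0; last first.
  by apply: (le_trans (hr t st i)); rewrite lerDl.
have /boxf_neq0/(_ i)/andP[h1 h2] : boxf p.2.1 p.2.2 t != 0.
  by apply: contraNneq ht => ->; rewrite mulr0 add0r st.
apply: (@le_trans _ _ m); last by rewrite lerDr.
apply: le_trans mi; rewrite ler_norml; apply/andP; split.
  by have := ler_norm (- tnth p.2.1 i); rewrite normrN; have := normr_ge0 (tnth p.2.2 i); lra.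
by have := ler_norm (tnth p.2.2 i); have := normr_ge0 (tnth p.2.1 i); lra.
Qed.

(* The singleton is the degenerate box, of volume zero in positive dimension. *)
Lemma ae_neq_point (a : V) : (0 < d)%N -> {ae lebV, forall t, t <> a}.
Proof.
case: d a => // k a _; exists (boxf a a @^-1` [set 1]); split.
- rewrite -[X in measurable X]setTI; apply: measurable_boxf => //.
- have <- : (\int[lebT R k.+1]_t (\1_(boxf a a @^-1` [set 1%R]) t)%:E =
      lebT R k.+1 (boxf a a @^-1` [set 1%R]))%E.
    rewrite integral_indic ?setIT// -[X in measurable X]setTI.
    by apply: measurable_boxf.
  rewrite (eq_integral (fun t : k.+1.-tuple R => (boxf a a t)%:E)); last first.
    move=> t _; rewrite indicE; case: (boxf_01 a a t) => bt; rewrite bt.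
      by rewrite memNset//= bt => /eqP; rewrite eq_sym oner_eq0.
    by rewrite mem_set.
  by rewrite integral_boxf big_ord_recl subrr maxxx mul0r.
- move=> t /= /contrapT ->; apply: boxf_in => i; by rewrite lexx.
Qed.

End edges.

(** * Cascade iterates and the energy splitting *)

Section cascade.
Variables (R : realType) (d : nat) (A : 'M[int]_d) (lA qA : 'cV[int]_d).
Variables (h : 'cV[int]_d -> R[i]) (N0 : nat).
Local Notation V := (d.-tuple R).
Local Notation C := R[i].
Local Notation lebV := (lebT R d).
Local Notation Z := 'cV[int]_d.
Local Notation B := (mxR R A).
Hypothesis hexp : expansive A.
Hypothesis hdet : `|\det A| = 2 :> int.
Hypothesis hl1 : [set: 'cV[int]_d] = pcoset lA (latt A) `|` latt A.
Hypothesis hq1 : forall x, latt A x -> (2 %| dotZ qA x)%Z.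
Hypothesis hq2 : forall x, pcoset lA (latt A) x -> ~~ (2 %| dotZ qA x)%Z.
Hypothesis hm1 : forall m n, latt A m ->
     [set: 'cV[int]_d] = mcoset n (latt A) `|` pcoset (lA - m - n) (latt A)
     /\ mcoset n (latt A) `&` pcoset (lA - m - n) (latt A) = set0.
Hypothesis hm2 : forall m n, pcoset lA (latt A) m ->
     mcoset n (latt A) = pcoset (lA - m - n) (latt A).
Hypothesis hsupp : forall n, ~ inLam0 N0 n -> h n = 0.
Hypothesis horth : forall k, latt A k ->
     \sum_(n <- Lam0 d N0) h n * conjc (h (n + k)) = (k == 0)%:R.
Hypothesis hsum : \sum_(n <- Lam0 d N0) h n = (Num.sqrt 2)%:C.

Fixpoint casc (J : nat) : V -> C :=
  match J with
  | 0 => @phi0 R d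
  | J'.+1 => fun t => \sum_(n <- Lam0 d N0) h n * DA A (Tr n (casc J')) t
  end.

Lemma l2_casc J : l2 lebV (casc J).
Proof.
elim: J => [|J IH]; first exact: l2_phi0.
by apply: l2_sum => n; rewrite DA_Tr; apply: l2Z; exact: l2_tr.
Qed.

Lemma cintegrable_casc J : cintegrable lebV (casc J).
Proof.
elim: J => [|J IH]; first exact: cintegrable_phi0.
by apply: cintegrable_sum => n; rewrite DA_Tr; apply: cintegrableZ; exact: cintegrable_tr.
Qed.

Lemma cint_casc J : cint lebV (casc J) = 1.
Proof.
elim: J => [|J IH]; first exact: cint_phi0.
have ic n : cintegrable lebV (tr A 1 n (casc J)) := cintegrable_tr hdet 1 n (cintegrable_casc J).
rewrite /= cint_sum; last by move=> n; rewrite DA_Tr; exact: cintegrableZ.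
rewrite (eq_bigr (fun n => h n * (Num.sqrt 2)^-1%:C)); last first.
  move=> n _; rewrite DA_Tr cintZ// cint_tr//; last exact: cintegrable_casc.
  by rewrite IH mulr1 /dilc expr1z.
rewrite -mulr_suml hsum -rmorphM/= mulfV// gt_eqF//; exact: sqrt2_gt0.
Qed.

Lemma big_neq0 (I : eqType) (s : seq I) (F : I -> C) :
  \sum_(i <- s) F i != 0 -> exists2 i, i \in s & F i != 0.
Proof.
move=> h0; apply: contrapT => hn; move/negP: h0; apply; apply/eqP.
rewrite big_seq big1// => i is_; apply/eqP; apply: contrapT => /negP Fi.
by apply: hn; exists i.
Qed.

Lemma tnth_intv_Lam0 N (n : Z) : inLam0 N n -> forall j, `|tnth (intv R n) j| <= N%:R.
Proof. by move=> hn j; rewrite tnth_intv -intr_norm -[N%:R]/(N%:Z%:~R) ler_int; exact: hn. Qed.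

(** A point t of the support of the next iterate is A^(-1) (s + n) with s in the previous support.
    As A^(-1) may expand some directions, bounding t alone does not propagate; the induction bounds
    A^(-m) t by a multiple of r^m for all m simultaneously. *)
Lemma casc_bounded : exists2 D : R, 0 <= D &
  forall J t, casc J t != 0 -> forall i, `|tnth t i| <= D.
Proof.
have [c [r [c0 r0 r1 hc]]] := expansive_actM_decay R hexp hdet.
have r1p : 0 < 1 - r by rewrite subr_gt0.
(* Chosen so that D (1 - r) = c (1 + N0). This yields both c <= D, for the unit cube, and D r + c r
   N0 <= D, for the induction step. *)
pose D := c * (1 + N0%:R) / (1 - r).
have D0 : 0 <= D by rewrite divr_ge0 ?(ltW r1p)// mulr_ge0// addr_ge0.
have DE : D * (1 - r) = c * (1 + N0%:R) by rewrite /D mulfVK// gt_eqF.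
have cN : 0 <= c * N0%:R by rewrite mulr_ge0.
have D1 : c <= D by move: DE; rewrite mulrDr mulr1; nra.
have D2 : D * r + c * r * N0%:R <= D by move: DE; rewrite mulrDr mulr1; nra.
suff H J t : casc J t != 0 -> forall m i, `|tnth (actM (invmx B ^+ m) t) i| <= D * r ^+ m.
  by exists D => // J t ct i; have := H J t ct 0%N i; rewrite !expr0 actM1 mulr1.
have rm m : 0 <= r ^+ m by rewrite exprn_ge0// ltW.
elim: J t => [|J IH] t ct m i.
  apply: (le_trans ((hc m t 1 _).1 i)); last by rewrite mulr1 ler_wpM2r.
  move=> j; move: ct; rewrite /= /phi0 unitcubeE.
  case: (boolP [forall i, _]) => [/forallP ht _|]; last by rewrite eqxx.
  by have /andP[h1 h2] := ht j; rewrite ger0_norm// ltW.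
have [n nN Fn] := big_neq0 ct.
have {Fn} cn : casc J (subt (actM B t) (intv R n)) != 0.
  by apply: contraNneq Fn => c0'; rewrite /DA /Tr -/casc c0' !mulr0.
set s := subt _ _ in cn.
have -> : actM (invmx B ^+ m) t =
    addt (actM (invmx B ^+ m.+1) s) (actM (invmx B ^+ m.+1) (intv R n)).
  rewrite -actM_addt (_ : addt _ _ = actM B t); last first.
    by apply: eq_from_tnth => j; rewrite tnth_addt tnth_subt subrK.
  rewrite -actM_mul exprSr mulmxE -mulrA mulVB ?mulr1//.
rewrite tnth_addt; apply: (le_trans (ler_normD _ _)).
have h1 := IH _ cn m.+1 i.
have h2 := (hc m.+1 (intv R n) N0%:R (tnth_intv_Lam0 ((mem_Lam0 _ _).1 nN))).1 i.
apply: (le_trans (lerD h1 h2)); rewrite exprS.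
rewrite (_ : D * _ + _ = (D * r + c * r * N0%:R) * r ^+ m); last by ring.
by rewrite ler_wpM2r.
Qed.

Definition coef (f : V -> C) (K : int) (J : nat) (l : Z) : C := cip lebV f (tr A K l (casc J)).

Definition bsupp (f : V -> C) (rho : R) := forall t, f t != 0 -> forall i, `|tnth t i| <= rho.

Lemma coef_supp_bound f (D b rho : R) K :
  (forall J t, casc J t != 0 -> forall i, `|tnth t i| <= D) -> bsupp f rho ->
  (forall t : V, (forall i, `|tnth t i| <= rho) -> forall i, `|tnth (actM (dilmx R A K) t) i| <= b) ->
  forall J l, ~ inLam0 (Num.truncn (D + b)).+1 l -> coef f K J l = 0.
Proof.
move=> hD hf hb J l hl; apply: cip_pointwise0 => t ft; rewrite /tr mulf_eq0 negb_or => /andP[_ ct].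
apply: hl => i; rewrite -(ler_int R) intr_norm -[l i 0]opprK mulrNz normrN.
have h1 := hb _ (hf _ ft) i; have h2 := hD _ _ ct i.
apply: (@le_trans _ _ (D + b)); last by rewrite ltW// truncnS_gt.
move: h2; rewrite tnth_subt tnth_intv mulrNz normrN => h2.
rewrite -[X in `|X|](subKr (tnth (actM (dilmx R A K) t) i)).
by apply: (le_trans (ler_normB _ _)); rewrite addrC lerD.
Qed.

Lemma coef_supp f rho K : bsupp f rho -> exists N, forall J l, ~ inLam0 N l -> coef f K J l = 0.
Proof.
move=> hf; have [D D0 hD] := casc_bounded.
pose c := \sum_i \sum_j `|dilmx R A K i j|.
have cM i j : `|dilmx R A K i j| <= c.
  rewrite /c (bigD1 i)//= (bigD1 j)//= -addrA lerDl addr_ge0// sumr_ge0// => i' _.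
  by rewrite sumr_ge0.
have c0 : 0 <= c by apply: sumr_ge0 => i _; apply: sumr_ge0.
eexists; apply: (coef_supp_bound hD hf (b := d%:R * c * rho)) => t ht i.
exact: norm_actM_le.
Qed.

(** The powers of A^(-1) are bounded, so one radius serves all negative levels. The energy there is
    then a sum over a fixed finite set, and termwise limits suffice. *)
Lemma coef_supp_neg f rho : 0 <= rho -> bsupp f rho ->
  exists N, forall M J l, ~ inLam0 N l -> coef f (- Posz M) J l = 0.
Proof.
move=> rho0 hf; have [D D0 hD] := casc_bounded.
have [c [r [c0 r0 r1 hc]]] := expansive_actM_decay R hexp hdet.
exists (Num.truncn (D + c * rho)).+1 => M; apply: (coef_supp_bound hD hf) => t ht i.
have -> : dilmx R A (- Posz M) = invmx B ^+ M by case: M => [|M] //=; rewrite !expr0.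
apply: (le_trans ((hc M t rho ht).1 i)); rewrite ler_wpM2r// ler_piMr// exprn_ile1 ?ltW//.
Qed.

Lemma cip_cubes K l l' : cip lebV (tr A K l (@phi0 R d)) (tr A K l' (@phi0 R d)) = (l == l')%:R.
Proof.
have [<-|ll'] := eqVneq l l'.
  by rewrite cip_self; [rewrite nr_tr// ?nr_phi0//; exact: l2_phi0|apply: l2_tr => //; exact: l2_phi0].
apply: cip_pointwise0 => t; rewrite /tr !phi0_sub !mulf_eq0 !negb_or => /andP[_ h1] /andP[_ h2].
have e (x w : Z) : (x == w)%:R != 0 :> C -> x = w  by rewrite pnatr_eq0 eqb0 negbK => /eqP.
by move/negP: ll'; apply; rewrite (e _ _ h1) (e _ _ h2).
Qed.

Lemma coefS f K J l : l2 lebV f ->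
  coef f K J.+1 l = \sum_(n <- Lam0 d N0) conjc (h n) * coef f (K + 1) J (A *m l + n).
Proof. by move=> lf; rewrite /coef /= (cip_tr_sum hdet)//; exact: l2_casc. Qed.

Lemma seq_inLam0 (s : seq Z) : exists N, forall l, l \in s -> inLam0 N l.
Proof.
elim: s => [|l s [N hN]]; first by exists 0%N.
have [N' hN'] := inLam0_ex l; exists (maxn N N') => x; rewrite inE => /orP[/eqP->|/hN].
  by apply: inLam0_le hN'; exact: leq_maxr.
by apply: inLam0_le; exact: leq_maxl.
Qed.

(** At J = 0 this is Bessel's inequality for the dilated cubes. The filter identity, with its
    wavelet half discarded, trades one step of [J] for one level of [K], hence the induction with
    [K] arbitrary. *)
Lemma coef_energy_le f rho : l2 lebV f -> bsupp f rho -> forall J K (s : seq Z), uniq s ->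
  \sum_(l <- s) sqmod (coef f K J l) <= nr lebV f.
Proof.
move=> lf hf; elim=> [|J IH] K s us.
  apply: (bessel (e := fun l => tr A K l (@phi0 R d))) => //.
  - by move=> l; apply: l2_tr => //; exact: l2_phi0.
  - exact: cip_cubes.
have [S hS] := coef_supp (K + 1) hf.
have [N1 hN1] := filter_identity hdet hl1 hq1 hq2 hm1 hm2 hsupp horth (hS J).
have [N2 hN2] := seq_inLam0 s.
apply: (@le_trans _ _ (\sum_(l <- Lam0 d (maxn N1 N2)) sqmod (coef f K J.+1 l))).
  apply: ler_sum_uniq => //; first exact: Lam0_uniq.
    by move=> l /hN2 hl; apply/mem_Lam0; apply: inLam0_le hl; exact: leq_maxr.
  by move=> l; exact: sqmod_ge0.
apply: le_trans (IH (K + 1) (Lam0 d S) (Lam0_uniq d S)).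
rewrite -(hN1 (maxn N1 N2) (leq_maxl _ _)); apply: ler_sum => l _.
by rewrite coefS// lerDl sqmod_ge0.
Qed.

(** The energy bound applied to the iterate itself: its single coefficient at level 0 is its squared
    norm, so the square of that norm is at most the norm. *)
Lemma nr_casc_le1 J : nr lebV (casc J) <= 1.
Proof.
have [D D0 hD] := casc_bounded; have lc := l2_casc J.
have := coef_energy_le lc (hD J) J 0 (s := [:: 0]) isT.
rewrite big_seq1 /coef tr00 cip_self// sqmodC expr2 -[X in _ <= X]mulr1 => le1.
have := nr_ge0 lebV (casc J); rewrite le_eqVlt => /orP[/eqP<-//|n0].
by move: le1; rewrite ler_pM2l.
Qed.

(** Inside the common support box |z| <= 1 + |z|^2, so the volume of the box plus the L^2 bound
    controls the L^1 norm. *)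
Lemma int_cabs_casc : exists K : R, 0 <= K /\
  forall J, fine (\int[lebV]_t (cabs (casc J t))%:E)%E <= K.
Proof.
have [D D0 hD] := casc_bounded.
pose a : V := cst_tuple d (- D); pose b : V := cst_tuple d D.
pose v := \prod_i Num.max 0 (tnth b i - tnth a i).
have v0 : 0 <= v by apply: prodr_ge0 => i _; rewrite le_max lexx.
exists (v + 1); split; first by rewrite addr_ge0.
move=> J; have lc := l2_casc J.
have i1 := integrable_boxf a b; have i2 := l2_integrable lc.
have ib : lebV.-integrable setT (fun t => (boxf a b t + sqmod (casc J t))%:E).
  by under eq_fun do rewrite EFinD; exact: integrableD.
apply: (@le_trans _ _ (fine (\int[lebV]_t (boxf a b t + sqmod (casc J t))%:E)%E)).
  have ic := cintegrable_cabs (cintegrable_casc J).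
  apply: fine_le; [exact: integrable_fin_num|exact: integrable_fin_num|].
  apply: le_integral => // t _; rewrite lee_fin -cabs_sqr.
  have [->|ct] := eqVneq (casc J t) 0.
    by rewrite cabs0 expr0n addr0 boxf_ge0.
  rewrite boxf_in; last by move=> i; rewrite !tnth_mktuple -ler_norml; exact: (hD J).
  have := cabs_ge0 (casc J t); nra.
under eq_integral do rewrite EFinD.
rewrite integralD// integral_boxf -/v -/(nsq lebV (casc J)) nsqE// -EFinD/= lerD2l.
exact: nr_casc_le1.
Qed.

Lemma dotR_addt (x y z : V) : dotR x (addt y z) = dotR x y + dotR x z.
Proof. by rewrite /dotR -big_split; apply: eq_bigr => i _; rewrite tnth_addt mulrDr. Qed.

Lemma dotR_actM (M : 'M[R]_d) (x t : V) : dotR x (actM M t) = dotR (actM M^T x) t.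
Proof.
rewrite /dotR (eq_bigr (fun i => \sum_j tnth x i * (M i j * tnth t j))); last first.
  by move=> i _; rewrite tnth_actM mulr_sumr.
rewrite exchange_big; apply: eq_bigr => j _; rewrite tnth_actM mulr_suml.
by apply: eq_bigr => i _; rewrite mxE mulrCA mulrA.
Qed.

Lemma FT0_cascS J x : FT0 (casc J.+1) x =
  m0 N0 h (actM (ATinv R A) x) * FT0 (casc J) (actM (ATinv R A) x).
Proof.
set y := actM (ATinv R A) x; have ic := cintegrable_casc J.
pose F n s := expi (- dotR y (addt s (intv R n))) * casc J s.
have FE n : F n = fun s => expi (- dotR y (intv R n)) * (expi (- dotR y s) * casc J s).
  by apply/funext => s; rewrite /F dotR_addt opprD addrC expiD mulrA.
have iF n : cintegrable lebV (F n).
  by rewrite FE; apply: cintegrableZ; exact: cintegrable_FT0.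
(* With y the image of x under the inverse transpose, x . s = y . A s, so the exponential becomes a
   function of the dilated and translated variable. *)
have trF n s : expi (- dotR x s) * tr A 1 n (casc J) s = tr A 1 n (F n) s.
  rewrite /tr mulrCA /F; congr (_ * (expi (- _) * _)).
  rewrite (_ : addt _ _ = actM B s); last first.
    by apply: eq_from_tnth => j; rewrite tnth_addt tnth_subt /= expr1 subrK.
  by rewrite dotR_actM /y -actM_mul mulmxV ?actM1// unitmx_tr; exact: unit_mxR.
have -> : FT0 (casc J.+1) x = cint lebV (fun s => \sum_(n <- Lam0 d N0) h n * tr A 1 n (F n) s).
  rewrite /FT0; congr cint; apply/funext => s; rewrite /= mulr_sumr; apply: eq_bigr => n _.
  by rewrite DA_Tr mulrCA trF.
rewrite cint_sum; last by move=> n; apply: cintegrableZ; exact: cintegrable_tr.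
rewrite /m0 -mulrA mulr_suml mulr_sumr; apply: eq_bigr => n _.
rewrite cintZ; last exact: cintegrable_tr.
rewrite cint_tr// FE cintZ; last exact: cintegrable_FT0.
by rewrite /dilc expr1z -/(FT0 (casc J) y) dotRC; ring.
Qed.

Lemma FT0_casc J x : FT0 (casc J) x =
  gpart N0 A h x J * FT0 (@phi0 R d) (actM (ATinv R A ^+ J) x).
Proof.
elim: J x => [|J IH] x; first by rewrite /gpart big_geq// mul1r expr0 actM1.
have gS : gpart N0 A h x J.+1 = m0 N0 h (actM (ATinv R A) x) * gpart N0 A h (actM (ATinv R A) x) J.
  rewrite /gpart big_ltn// big_add1/= expr1; congr (_ * _); apply: eq_bigr => j _.
  by rewrite -actM_mul exprSr mulmxE.
by rewrite FT0_cascS IH gS mulrA -actM_mul exprSr mulmxE.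
Qed.

(** The normalisation [hsum] makes the symbol equal to 1 at the origin, and [E] adds up the
    Lipschitz constants of its exponentials. *)
Lemma m0_sub1 : exists2 E : R, 0 <= E & forall (y : V) rho, (forall i, `|tnth y i| <= rho) ->
  cabs (m0 N0 h y - 1) <= E * rho.
Proof.
have s0 := @sqrt2_gt0 R.
pose E := (Num.sqrt 2)^-1 * \sum_(n <- Lam0 d N0) cabs (h n) * (2 * (\sum_i `|tnth (intv R n) i|)).
exists E.
  rewrite /E mulr_ge0 ?invr_ge0 ?(ltW s0)// sumr_ge0// => n _.
  by rewrite !mulr_ge0 ?cabs_ge0// sumr_ge0.
move=> y rho hy.
have -> : m0 N0 h y - 1 =
    (Num.sqrt 2)^-1%:C * \sum_(n <- Lam0 d N0) h n * (expi (- dotR (intv R n) y) - 1).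
  rewrite /m0; under [in RHS]eq_bigr do rewrite mulrBr mulr1.
  by rewrite sumrB hsum mulrBr -rmorphM/= mulVf// gt_eqF.
rewrite cabsM cabsC ger0_norm ?invr_ge0 ?(ltW s0)// /E -mulrA ler_wpM2l ?invr_ge0 ?(ltW s0)//.
apply: (le_trans (cabs_sum _ _)); rewrite mulr_suml; apply: ler_sum => n _.
rewrite cabsM -mulrA ler_wpM2l ?cabs_ge0//; apply: (le_trans (cabs_expi_sub1 _)).
rewrite -mulrA ler_pM2l// normrN /dotR; apply: (le_trans (ler_norm_sum _ _ _)).
by rewrite mulr_suml; apply: ler_sum => i _; rewrite normrM ler_wpM2l.
Qed.

(** The factors of the product differ from 1 by a geometric amount because the inverse transpose
    powers contract x. The remaining factor, the transform of the cube, is taken at points tending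
    to the origin, where it equals the volume 1. *)
Lemma ccvg_FT0_casc x : ccvg (fun J => FT0 (casc J) x) (limC (gpart N0 A h x)).
Proof.
have [E E0 hE] := m0_sub1.
have [c [r [c0 r0 r1 hc]]] := expansive_actM_decay R hexp hdet.
pose rho := \sum_i `|tnth x i|.
have hx j : `|tnth x j| <= rho by rewrite /rho (bigD1 j)//= lerDl sumr_ge0.
have rho0 : 0 <= rho by apply: sumr_ge0.
have [l hl] : exists l, ccvg (gpart N0 A h x) l.
  apply: (@ccvg_prod _ (fun j => m0 N0 h (actM (ATinv R A ^+ j) x)) (E * (c * rho)) r) => //.
    by rewrite !mulr_ge0.
  by move=> j; rewrite -!mulrA [rho * _]mulrC [c * _]mulrA; apply: hE; exact: (hc j x rho hx).2.
rewrite (ccvg_limC hl) -[l]mulr1 (_ : (fun J => _) = fun J => gpart N0 A h x J *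
  FT0 (@phi0 R d) (actM (ATinv R A ^+ J) x)); last by apply/funext => J; exact: FT0_casc.
apply: ccvgM hl _; apply: (@ccvg_le _ _ _ (geometric (2 * (d%:R * (c * rho))) r)).
  move=> J; apply: (le_trans (FT0_phi0_sub1 (hc J x rho hx).2)).
  by rewrite /geometric/= le_eqVlt; apply/orP; left; apply/eqP; ring.
by apply: cvg_geometric; rewrite ger0_norm// ltW.
Qed.

Lemma weak_casc phi : FT_L2 phi (gA N0 A h) ->
  forall f, l2 lebV f -> ccvg (fun J => cip lebV f (casc J)) (cip lebV f phi).
Proof.
move=> hphi; have [/L2E lphi [lg _]] := hphi; have [K [K0 hK]] := int_cabs_casc.
apply: (@weak_cvg _ _ casc phi
  (fun x => ((2 * pi) `^ (- (d%:R / 2)))^-1%:C * gA N0 A h x) 1 K) => //.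
- exact: cintegrable_casc.
- exact: l2_casc.
- exact: nr_casc_le1.
- by apply: cmeasM; [exact: cmeas_cst|case: lg].
- move=> x; rewrite /gA mulrA -rmorphM/= mulVf ?mul1r; first exact: ccvg_FT0_casc.
  by rewrite gt_eqF// powR_gt0// mulr_gt0// pi_gt0.
- by move=> w iw lw lFw; exact: FT_L2_pairing.
Qed.

Lemma sum_cubes f K J N x : (forall l, ~ inLam0 N l -> coef f K J l = 0) ->
  \sum_(l <- Lam0 d N) coef f K J l * tr A K l (@phi0 R d) x =
  (dilc R K)%:C * coef f K J (floorv (actM (dilmx R A K) x)).
Proof.
move=> hN; set w := floorv _.
rewrite (eq_bigr (fun l => (dilc R K)%:C * (coef f K J l * (l == w)%:R))); last first.
  by move=> l _; rewrite /tr phi0_sub mulrCA.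
rewrite -mulr_sumr; congr (_ * _).
have [wN|wN] := boolP (w \in Lam0 d N).
  rewrite (bigD1_seq w)//= ?Lam0_uniq// eqxx mulr1 big1 ?addr0// => l lw.
  by rewrite (negbTE lw) mulr0.
rewrite hN; last by move=> /mem_Lam0; rewrite (negbTE wN).
rewrite big_seq big1// => l lN; case: eqVneq => [lw|_]; last by rewrite mulr0.
by move: wN; rewrite -lw lN.
Qed.

Lemma frac_floorv (y : V) i : `|tnth (subt y (intv R (floorv y))) i| <= 1.
Proof.
have := phi0_sub y (floorv y); rewrite eqxx /phi0 unitcubeE.
case: (boolP [forall i, _]) => [/forallP/(_ i)/andP[h1 h2] _|_ /eqP].
  by rewrite ger0_norm// ltW.
by rewrite eq_sym oner_eq0.
Qed.

(** The scaled coefficient at the cube containing x averages the step function against a kernel of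
    integral 1 concentrated near x. The error is at most the oscillation over that neighbourhood
    times the L^1 norm of the kernel, and both the L^1 bound and the support radius are uniform in
    [J]. *)
Lemma cascade_error s : exists Kc : R, 0 <= Kc /\ exists e : nat -> R,
  [/\ e @ \oo --> (0 : R), forall k, 0 <= e k &
  forall (k : nat) J x, cabs ((dilc R k)%:C * coef (stepf s) k J (floorv (actM (dilmx R A k) x)) - stepf s x)
    <= Kc * osc s (e k) x].
Proof.
have [Kc [Kc0 hKc]] := int_cabs_casc; exists Kc; split => //.
have [D D0 hD] := casc_bounded.
have [c [r [c0 r0 r1 hc]]] := expansive_actM_decay R hexp hdet.
have r0' := ltW r0.
(* The radius of the neighbourhood: [D] for the support of the iterate plus 1 for the fractional
   part of the dilated point, contracted by A^(-k). *)
exists (geometric (c * (D + 1)) r); split.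
- by apply: cvg_geometric; rewrite ger0_norm.
- by move=> k; rewrite /geometric/= mulr_ge0 ?exprn_ge0// mulr_ge0// addr_ge0.
move=> k J x; set e := geometric _ _ _.
have e0 : 0 <= e by rewrite /e /geometric/= mulr_ge0 ?exprn_ge0// mulr_ge0// addr_ge0.
set w := floorv _; set f := stepf s.
have lf : l2 lebV f by exact: l2_stepf.
have dk := dilc_gt0 R k.
have it : cintegrable lebV (tr A k w (casc J)) := cintegrable_tr hdet k w (cintegrable_casc J).
(* The averaging kernel. The extra factor [dilc] turns the L^2 normalisation of [tr] into an L^1
   one, and [cint_casc] makes its integral 1. *)
pose rh t := (dilc R k)%:C * conjc (tr A k w (casc J) t).
have irh : cintegrable lebV rh by apply: cintegrableZ; exact: cintegrableJ.
have rh1 : cint lebV rh = 1.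
  rewrite /rh cintZ; last exact: cintegrableJ.
  rewrite cintJ// cint_tr//; last exact: cintegrable_casc.
  by rewrite cint_casc mulr1 conjc_real -rmorphM/= mulfV// gt_eqF.
have ifr : cintegrable lebV (fun t => f t * rh t).
  rewrite (_ : (fun t => _) = fun t => (dilc R k)%:C * (f t * conjc (tr A k w (casc J) t))); last first.
    by apply/funext => t; rewrite /rh mulrCA.
  by apply: cintegrableZ; apply: cip_integrable => //; apply: l2_tr => //; exact: l2_casc.
have -> : (dilc R k)%:C * coef f k J w - f x = cint lebV (fun t => (f t - f x) * rh t).
  under [in RHS]eq_fun do rewrite mulrBl.
  rewrite cintB//; last exact: cintegrableZ.
  rewrite cintZ// rh1 mulr1; congr (_ - _).
  rewrite /coef /cip -cintZ; last by apply: cip_integrable => //; apply: l2_tr => //; exact: l2_casc.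
  by congr cint; apply/funext => t; rewrite /rh mulrCA.
have icr := cintegrable_cabs irh.
have := @cabs_cint_le _ _ _ lebV (fun t => (f t - f x) * rh t) (fun t => osc s e x * cabs (rh t)).
have E : (\int[lebV]_t (osc s e x * cabs (rh t))%:E =
    (osc s e x)%:E * \int[lebV]_t (cabs (casc J t))%:E)%E.
  under eq_integral do rewrite EFinM.
  rewrite integralZl//; congr (_ * _)%E.
  transitivity (\int[lebV]_t ((dilc R k ^+ 2)%:E * (cabs (casc J (dilmap A k w t)))%:E))%E.
    apply: eq_integral => t _; rewrite -EFinM /rh cabsM cabsJ /tr cabsM cabsC.
    by rewrite ger0_norm ?(ltW dk)// mulrA -expr2.
  have ic := cintegrable_cabs (cintegrable_casc J).
  have mc : measurable_fun setT (fun t => (cabs (casc J t))%:E) := measurable_int _ ic.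
  rewrite ge0_integralZl//.
  - rewrite (integral_dilmap hdet k w mc) => [|t]; last by rewrite lee_fin cabs_ge0.
    by rewrite muleA -EFinM mulfV ?mul1e// expf_neq0// gt_eqF.
  - by apply: measurableT_comp mc _; exact: measurable_dilmap.
  - by move=> t _; rewrite lee_fin cabs_ge0.
  - by rewrite lee_fin sqr_ge0.
rewrite E => H; apply: le_trans (H _ _ _) _.
- under eq_fun do rewrite mulrBl; apply: cintegrableB => //; exact: cintegrableZ.
- by under eq_fun do rewrite EFinM; exact: integrableZl.
- move=> t; rewrite cabsM; have [->|rt] := eqVneq (rh t) 0; first by rewrite cabs0 !mulr0.
  rewrite ler_wpM2r ?cabs_ge0//; apply: osc_bound => // i.
  have ct : casc J (dilmap A k w t) != 0.
    by apply: contraNneq rt => ct; rewrite /rh /tr -/(dilmap A k w t) ct mulr0 conjc0 mulr0.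
  have hs j : `|tnth (subt (dilmap A k w t) (dilmap A k w x)) j| <= D + 1.
    rewrite tnth_subt; apply: (le_trans (ler_normB _ _)); apply: lerD; first exact: hD ct j.
    exact: frac_floorv.
  have -> : tnth t i - tnth x i =
      tnth (actM (invmx B ^+ k) (subt (dilmap A k w t) (dilmap A k w x))) i.
    rewrite -tnth_subt; congr tnth.
    have -> : subt (dilmap A k w t) (dilmap A k w x) = actM (dilmx R A k) (subt t x).
      by rewrite actM_subt; apply: eq_from_tnth => j; rewrite !tnth_subt; ring.
    by rewrite -actM_mul expmxVK// actM1.
  apply: (le_trans ((hc k _ _ hs).1 i)).
  by rewrite /e /geometric/= le_eqVlt; apply/orP; left; apply/eqP; ring.
have ic := cintegrable_cabs (cintegrable_casc J).
rewrite fineM ?integrable_fin_num// mulrC /= ler_wpM2r ?osc_ge0//.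
Qed.

(** The function [g] carries the coefficients of the iterate on the orthonormal cubes, so its
    squared norm is exactly the energy, while [cascade_error] keeps it close to the step function.
    The threshold on [k] is independent of [J], which leaves [J] free to tend to infinity at a fixed
    level. *)
Lemma step_energy_ge s eps eta : 0 < eps -> 0 < eta -> exists K0 : nat, forall k, (K0 <= k)%N ->
  exists N1, forall N J, (N1 <= N)%N ->
  nr lebV (stepf s) <= (1 + eps) * \sum_(l <- Lam0 d N) sqmod (coef (stepf s) k J l) +
    (1 + eps^-1) * eta.
Proof.
move=> eps0 eta0; have [Kc [Kc0 [e [he e0 herr]]]] := cascade_error s.
set f := stepf s; have lf : l2 lebV f by exact: l2_stepf.
pose Gm := \sum_(p <- s) cabs p.1.
have Gm0 : 0 <= Gm by apply: sumr_ge0 => p _; exact: cabs_ge0.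
(* Since the oscillation is at most [Gm], the squared error is at most Kc^2 Gm times the
   oscillation, whose integral tends to 0. *)
pose v k := (Kc ^+ 2 * Gm) * fine (\int[lebV]_t (osc s (e k) t)%:E)%E.
have cv : v @ \oo --> (0 : R).
  rewrite -[X in _ --> X](mulr0 (Kc ^+ 2 * Gm)); apply: cvgM; first exact: cvg_cst.
  exact: cvg_osc.
have [K0 hK0] := cvg0_small cv eta0; exists K0 => k Kk.
have [rho _ hf] := stepf_bsupp s.
have [N1 hN1] := coef_supp k hf; exists N1 => N J NN.
pose g t := \sum_(l <- Lam0 d N) coef f k J l * tr A k l (@phi0 R d) t.
have le l : l2 lebV (tr A k l (@phi0 R d)) by apply: l2_tr => //; exact: l2_phi0.
have lg : l2 lebV g by apply: l2_sum => l; exact: l2Z.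
have gE x : g x = (dilc R k)%:C * coef f k J (floorv (actM (dilmx R A k) x)).
  by apply: sum_cubes => l hl; apply: hN1; apply: contra_not hl => hl; exact: inLam0_le hl.
have ng : nr lebV g = \sum_(l <- Lam0 d N) sqmod (coef f k J l).
  by apply: nr_orthonormal => //; [exact: cip_cubes|exact: Lam0_uniq].
have nfg : nr lebV (fun t => f t - g t) <= eta.
  have [io _] := integral_osc s (e k).
  have i1 : lebV.-integrable setT (fun t => ((Kc ^+ 2 * Gm) * osc s (e k) t)%:E).
    by under eq_fun do rewrite EFinM; exact: integrableZl.
  have i2 t : sqmod (f t - g t) <= (Kc ^+ 2 * Gm) * osc s (e k) t.
    rewrite -sqmodN opprB gE; apply: (le_trans (sqmod_le_cabs (herr k J t))).
    rewrite exprMn -mulrA ler_wpM2l ?sqr_ge0// expr2 ler_wpM2r ?osc_ge0//; exact: osc_le.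
  have [_] := l2_le (l2B lf lg).1 i1 i2.
  move=> /le_trans; apply; under eq_integral do rewrite EFinM.
  rewrite integralZl// fineM ?integrable_fin_num//; exact: ltW (hK0 k Kk).
rewrite -ng (_ : f = fun t => g t + (f t - g t)); last by apply/funext => t; rewrite addrC subrK.
apply: (le_trans (nrD_le eps0 lg (l2B lf lg))); rewrite lerD2l ler_wpM2l//.
by rewrite addr_ge0// invr_ge0 ltW.
Qed.

(** * Coefficients of the scaling function and of the wavelet *)

Section limit.
Variable phi : V -> C.
Hypothesis hphi : FT_L2 phi (gA N0 A h).

Definition lcoef f K l : C := cip lebV f (tr A K l phi).
Definition wcoef f K l : C := cip lebV f (tr A K l (psiA N0 A lA qA h phi)).

Lemma l2_phi : l2 lebV phi. Proof. by have [/L2E] := hphi. Qed.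

Lemma psiAE : psiA N0 A lA qA h phi = fun t =>
  \sum_(m <- Lam0 d N0) gcoef lA qA h (lA - m) * DA A (Tr (lA - m) phi) t.
Proof. by apply/funext => t; rewrite /psiA big_map. Qed.

Lemma l2_psi : l2 lebV (psiA N0 A lA qA h phi).
Proof.
by rewrite psiAE; apply: l2_sum => m; rewrite DA_Tr; apply: l2Z; apply: l2_tr => //; exact: l2_phi.
Qed.

Lemma wcoefE f K l : l2 lebV f -> wcoef f K l =
  \sum_(m <- Lam0 d N0) conjc (gcoef lA qA h (lA - m)) * lcoef f (K + 1) (A *m l + (lA - m)).
Proof. by move=> lf; rewrite /wcoef psiAE (cip_tr_sum hdet)//; exact: l2_phi. Qed.

Lemma ccvg_coef f K l : l2 lebV f -> ccvg (fun J => coef f K J l) (lcoef f K l).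
Proof.
move=> lf; apply: ccvg_tr => //; [exact: l2_casc|exact: l2_phi|exact: weak_casc].
Qed.

(** The limit of the recursion [coefS], whose two sides are the same sequence shifted by one. The
    two-scale relation of [phi] is thus obtained in weak form, directly on inner products. *)
Lemma lcoef_refine f K l : l2 lebV f ->
  lcoef f K l = \sum_(n <- Lam0 d N0) conjc (h n) * lcoef f (K + 1) (A *m l + n).
Proof.
move=> lf; apply: (ccvg_unique (ccvg_shift (ccvg_coef K l lf))).
rewrite (_ : (fun J => _) = fun J => \sum_(n <- Lam0 d N0) conjc (h n) *
  coef f (K + 1) J (A *m l + n)); last by apply/funext => J; rewrite coefS.
by apply: ccvg_sum => n; apply: ccvgM; [exact: ccvg_cst|exact: ccvg_coef].
Qed.

Lemma lcoef_eq0 f K l : l2 lebV f -> (forall J, coef f K J l = 0) -> lcoef f K l = 0.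
Proof.
move=> lf h0; apply: (ccvg_unique (ccvg_coef K l lf)).
by rewrite (_ : (fun J => _) = fun=> 0); [exact: ccvg_cst|apply/funext].
Qed.

(** Coefficients that vanish for all iterates vanish in the limit. This stands in for compact
    support of [phi], which is never established pointwise. *)
Lemma lcoef_supp f rho K : l2 lebV f -> bsupp f rho ->
  exists N, forall l, ~ inLam0 N l -> lcoef f K l = 0.
Proof.
move=> lf hf; have [N hN] := coef_supp K hf.
by exists N => l hl; apply: lcoef_eq0 => // J; exact: hN.
Qed.

Lemma cvg_coef_energy f K (s : seq Z) : l2 lebV f ->
  (fun J => \sum_(l <- s) sqmod (coef f K J l)) @ \oo --> \sum_(l <- s) sqmod (lcoef f K l).
Proof.
move=> lf; apply: (@cvg_sumr _ _ s (fun l J => sqmod (coef f K J l))) => l.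
by apply: ccvg_sqmod; exact: ccvg_coef.
Qed.

Lemma lcoef_energy_le f rho K (s : seq Z) : l2 lebV f -> bsupp f rho -> uniq s ->
  \sum_(l <- s) sqmod (lcoef f K l) <= nr lebV f.
Proof.
move=> lf hf us; have ce := @cvg_coef_energy f K s lf; apply: (cvgr_to_le ce).
by apply: nearW => J; exact: (coef_energy_le lf hf).
Qed.

Lemma level_identity f rho K : l2 lebV f -> bsupp f rho -> exists N1, forall N, (N1 <= N)%N ->
  \sum_(l <- Lam0 d N) sqmod (lcoef f K l) + \sum_(l <- Lam0 d N) sqmod (wcoef f K l) =
  \sum_(l <- Lam0 d N) sqmod (lcoef f (K + 1) l).
Proof.
move=> lf hf; have [S hS] := lcoef_supp (K + 1) lf hf.
have [N1 hN1] := filter_identity hdet hl1 hq1 hq2 hm1 hm2 hsupp horth hS.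
exists (maxn N1 S) => N; rewrite geq_max => /andP[NN1 NS].
rewrite -big_split (eq_bigr (fun l =>
    (sqmod (\sum_(n <- Lam0 d N0) conjc (h n) * lcoef f (K + 1) (A *m l + n)) +
     sqmod (\sum_(m <- Lam0 d N0) conjc (gcoef lA qA h (lA - m)) *
       lcoef f (K + 1) (A *m l + (lA - m)))))); last first.
  by move=> l _; rewrite lcoef_refine// wcoefE.
rewrite hN1//; apply: big_supp; [exact: Lam0_uniq|exact: Lam0_uniq|].
move=> l hl; have lS : inLam0 S l.
  by apply: contrapT => /hS h0; move: hl; rewrite h0 sqmod0 eqxx.
by apply/idP/idP => _; apply/mem_Lam0 => //; exact: inLam0_le lS.
Qed.

Lemma telescoped_levels f rho K n : l2 lebV f -> bsupp f rho ->
  exists N1, forall N, (N1 <= N)%N ->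
  \sum_(l <- Lam0 d N) sqmod (lcoef f K l) +
    \sum_(j <- iota 0 n) \sum_(l <- Lam0 d N) sqmod (wcoef f (K + Posz j) l) =
  \sum_(l <- Lam0 d N) sqmod (lcoef f (K + Posz n) l).
Proof.
move=> lf hf; elim: n => [|n [N1 IH]].
  by exists 0%N => N _; rewrite big_nil addr0 addr0.
have [N2 h2] := level_identity (K + Posz n) lf hf.
exists (maxn N1 N2) => N; rewrite geq_max => /andP[NN1 NN2].
have -> : iota 0 n.+1 = iota 0 n ++ [:: n] by rewrite -[n.+1]addn1 iotaD.
have -> : K + Posz n.+1 = K + Posz n + 1 by lia.
by rewrite big_cat/= big_seq1 addrA IH// h2.
Qed.

(** The levels are - M, ..., M - 1, so that telescoping leaves precisely the scaling energies at M
    and at - M. *)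
Definition scale_box (M N : nat) : seq (int * Z) :=
  [seq (- Posz M + Posz j, l) | j <- iota 0 (M + M), l <- Lam0 d N].

Lemma scale_box_uniq M N : uniq (scale_box M N).
Proof.
apply: allpairs_uniq; [exact: iota_uniq|exact: Lam0_uniq|].
by move=> [j l] [j' l'] _ _ /= [/addrI [->] ->].
Qed.

Lemma mem_scale_box M N K l : (`|K| < M)%N -> inLam0 N l -> (K, l) \in scale_box M N.
Proof.
move=> KM lN; apply/allpairsP; exists (absz (K + Posz M), l) => /=; split.
- by rewrite mem_iota; lia.
- exact/mem_Lam0.
- by congr pair; lia.
Qed.

Lemma scale_box_sum f rho M : l2 lebV f -> bsupp f rho -> exists N1, forall N, (N1 <= N)%N ->
  \sum_(p <- scale_box M N) sqmod (wcoef f p.1 p.2) =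
  \sum_(l <- Lam0 d N) sqmod (lcoef f (Posz M) l) - \sum_(l <- Lam0 d N) sqmod (lcoef f (- Posz M) l).
Proof.
move=> lf hf; have [N1 h1] := telescoped_levels (- Posz M) (M + M) lf hf; exists N1 => N NN.
rewrite /scale_box big_allpairs_dep/=; apply/eqP; rewrite eq_sym subr_eq addrC; apply/eqP.
by rewrite h1// PoszD addrA addNr add0r.
Qed.

Lemma bsupp_upper f rho (s : seq (int * Z)) : l2 lebV f -> bsupp f rho -> uniq s ->
  \sum_(p <- s) sqmod (wcoef f p.1 p.2) <= nr lebV f.
Proof.
move=> lf hf us.
pose M := (\sum_(p <- s) `|p.1|).+1%N.
have [N1 h1] := scale_box_sum M lf hf.
have [N2 h2] := seq_inLam0 [seq p.2 | p <- s].
apply: (@le_trans _ _ (\sum_(p <- scale_box M (maxn N1 N2)) sqmod (wcoef f p.1 p.2))).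
  apply: ler_sum_uniq => //; first exact: scale_box_uniq.
    move=> [K l] Kls; apply: mem_scale_box.
      rewrite /M ltnS (big_rem (K, l))//=; exact: leq_addr.
    apply: (@inLam0_le _ N2); first exact: leq_maxr.
    by apply: h2; apply/mapP; exists (K, l).
  by move=> p; exact: sqmod_ge0.
rewrite h1 ?leq_maxl//; apply: (@le_trans _ _
  (\sum_(l <- Lam0 d (maxn N1 N2)) sqmod (lcoef f (Posz M) l))).
  by rewrite lerBlDr lerDl sumr_ge0// => l _; exact: sqmod_ge0.
by apply: lcoef_energy_le hf _ => //; exact: Lam0_uniq.
Qed.

(** A determinant of size 0 is 1, not of modulus 2. Positive dimension is what makes points null
    sets. *)
Lemma dim_gt0 : (0 < d)%N.
Proof. by case: d A hdet => // A'; rewrite det_mx00 normr1. Qed.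

(** For t in the bounded support of f, the point A^(-M) t - l lies in a box around - l of radius
    [e M] tending to 0. Only the part [u M] of [phi] inside this box contributes; its norm tends to
    0 by dominated convergence, and Cauchy-Schwarz concludes. *)
Lemma cvg_lcoef_neg f rho l : l2 lebV f -> 0 <= rho -> bsupp f rho ->
  (fun M => sqmod (lcoef f (- Posz M) l)) @ \oo --> (0 : R).
Proof.
move=> lf rho0 hf; have lphi := l2_phi.
have [c [r [c0 r0 r1 hc]]] := expansive_actM_decay R hexp hdet.
have r0' := ltW r0.
pose e := geometric (c * rho) r; pose a : V := intv R (- l).
have ce : e @ \oo --> (0 : R) by apply: cvg_geometric; rewrite ger0_norm.
pose u M t := phi t * (boxf (shiftt a (- e M)) (shiftt a (e M)) t)%:C.
have mu_ M : cmeas (u M) by apply: cmeasM; [case: lphi|apply: cmeasC; exact: measurable_boxf].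
have lu M : l2 lebV (u M).
  apply: (proj1 (l2_le_fun (mu_ M) lphi _)) => t; rewrite sqmodM sqmodC boxf_sqr.
  by rewrite ler_piMr ?sqmod_ge0 ?boxf_le1.
have cu : (fun M => nr lebV (u M)) @ \oo --> (0 : R).
  have := @nr_cvg _ _ _ lebV u (fun=> 0) (fun t => sqmod (phi t)) mu_ (@cmeas_cst _ _ _ 0).
  rewrite (_ : (fun n => nr lebV (fun t => u n t - 0)) = fun M => nr lebV (u M)); last first.
    by apply/funext => M; congr nr; apply/funext => t; rewrite subr0.
  apply.
  - apply: filterS (ae_neq_point a dim_gt0) => t ta; apply/ccvg_epsP => eps eps0.
    have [i hi] : exists i, tnth t i != tnth a i.
      apply: contrapT => hn; apply: ta; apply: eq_from_tnth => i; apply/eqP.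
      by apply: contrapT => /negP hi; apply: hn; exists i.
    have ti : 0 < `|tnth t i - tnth a i| by rewrite normr_gt0 subr_eq0.
    have [N hN] := cvg0_small ce ti.
    exists N => n Nn; rewrite subr0 /u (@boxf_out _ _ _ _ _ i) ?mulr0 ?cabs0//.
    rewrite !tnth_shiftt; apply/negP => /andP[b1 b2]; have := hN n Nn.
    by rewrite ltNge ler_norml; move/negP; apply; apply/andP; split; lra.
  - exact: l2_integrable.
  - move=> n t; rewrite subr0 sqmodM sqmodC boxf_sqr.
    by rewrite ler_piMr ?sqmod_ge0 ?boxf_le1.
have le M : sqmod (lcoef f (- Posz M) l) <= nr lebV f * nr lebV (u M).
  have -> : lcoef f (- Posz M) l = cip lebV f (tr A (- Posz M) l (u M)).
    rewrite /lcoef /cip; congr cint; apply/funext => t.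
    have [->|ft] := eqVneq (f t) 0; first by rewrite !mul0r.
    congr (_ * conjc _); rewrite /tr /u boxf_in ?mulr1// => i.
    rewrite !tnth_shiftt tnth_subt !tnth_intv mxE mulrNz.
    have -> : dilmx R A (- Posz M) = invmx B ^+ M by case: M => [|M] //=; rewrite !expr0.
    have := (hc M t rho (hf t ft)).1 i.
    rewrite (_ : c * r ^+ M * rho = e M); last by rewrite /e /geometric/=; ring.
    by rewrite ler_norml => /andP[h1 h2]; apply/andP; split; lra.
  apply: (le_trans (cauchy_schwarz lf (l2_tr hdet _ _ (lu M)))).
  by rewrite nr_tr.
apply: (@squeeze_cvgr _ _ _ _ (fun=> 0) (fun M => nr lebV f * nr lebV (u M))).
- by apply: nearW => M; rewrite sqmod_ge0 le.
- exact: cvg_cst.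
- by rewrite -[X in _ --> X](mulr0 (nr lebV f)); apply: cvgM => //; exact: cvg_cst.
Qed.

Lemma neg_energy f rho e : l2 lebV f -> 0 <= rho -> bsupp f rho -> 0 < e ->
  exists M0, forall M N, (M0 <= M)%N ->
  \sum_(l <- Lam0 d N) sqmod (lcoef f (- Posz M) l) <= e.
Proof.
move=> lf rho0 hf e0; have [S hS] := coef_supp_neg rho0 hf.
have cv : (fun M => \sum_(l <- Lam0 d S) sqmod (lcoef f (- Posz M) l)) @ \oo --> (0 : R).
  rewrite [X in _ --> X](_ : _ = \sum_(l <- Lam0 d S) 0); last by rewrite big1.
  apply: (@cvg_sumr _ _ _ (fun l M => sqmod (lcoef f (- Posz M) l)) (fun=> 0)) => l.
  exact: cvg_lcoef_neg hf.
have [M0 hM0] := cvg0_small cv e0; exists M0 => M N MM; apply: le_trans (ltW (hM0 M MM)).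
rewrite (_ : \sum_(l <- Lam0 d N) _ =
  \sum_(l <- [seq l <- Lam0 d N | l \in Lam0 d S]) sqmod (lcoef f (- Posz M) l)).
  apply: ler_sum_uniq; rewrite ?filter_uniq ?Lam0_uniq//.
    by move=> l; rewrite mem_filter => /andP[].
  by move=> l; exact: sqmod_ge0.
rewrite big_filter [RHS]big_mkcond; apply: eq_bigr => l _; case: ifPn => // lS.
rewrite lcoef_eq0 ?sqmod0// => J; apply: hS => /mem_Lam0; by rewrite (negbTE lS).
Qed.

Lemma step_lower s e : 0 < e -> exists2 q : seq (int * Z), uniq q &
  nr lebV (stepf s) - e <= \sum_(p <- q) sqmod (wcoef (stepf s) p.1 p.2).
Proof.
move=> e0; set f := stepf s; have lf : l2 lebV f by exact: l2_stepf.
have [rho rho0 hf] := stepf_bsupp s.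
have n0 := nr_ge0 lebV f.
(* The error budget is e/4 for [eps] times the energy, e/4 for the term with [eta], and e/2 for the
   energy at level - M. Adding 1 to the norm avoids a zero denominator. *)
pose eps := e / (4 * (nr lebV f + 1)).
have eps0 : 0 < eps by rewrite divr_gt0// mulr_gt0// ltr_wpDl.
have q0 : 0 < 1 + eps^-1 by rewrite addr_gt0// invr_gt0.
pose eta := e / (4 * (1 + eps^-1)).
have eta0 : 0 < eta by rewrite divr_gt0// mulr_gt0.
have [K0 hK0] := step_energy_ge s eps0 eta0.
have e2 : 0 < e / 2 by rewrite divr_gt0.
have [M0 hM0] := neg_energy lf rho0 hf e2.
pose M := maxn K0 M0.
have [N1 h1] := hK0 M (leq_maxl _ _).
have [N2 h2] := scale_box_sum M lf hf.
pose N := maxn N1 N2.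
exists (scale_box M N); first exact: scale_box_uniq.
rewrite h2 ?leq_maxr//.
set E := \sum_(l <- _) sqmod (lcoef f (Posz M) l).
(* The estimate for the iterates is uniform in [J] with the level and the index list fixed, so it
   survives the passage to [phi]. *)
have hE : nr lebV f <= (1 + eps) * E + (1 + eps^-1) * eta.
  have cE : (fun J => (1 + eps) * \sum_(l <- Lam0 d N) sqmod (coef f M J l) +
      (1 + eps^-1) * eta) @ \oo --> (1 + eps) * E + (1 + eps^-1) * eta.
    apply: cvgD; last exact: cvg_cst.
    by apply: cvgM; [exact: cvg_cst|exact: cvg_coef_energy].
  apply: (cvgr_to_ge cE); apply: nearW => J; apply: h1; exact: leq_maxl.
have E1 : E <= nr lebV f by apply: lcoef_energy_le hf _ => //; exact: Lam0_uniq.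
have E0 : 0 <= E by apply: sumr_ge0 => l _; exact: sqmod_ge0.
have hM := hM0 M N (leq_maxr _ _).
have x1 : (1 + eps^-1) * eta = e / 4 
  by rewrite /eta; move: (1 + eps^-1) q0 => T q0; field; rewrite gt_eqF.
have x2 : eps * E <= e / 4.
  apply: (@le_trans _ _ (eps * (nr lebV f + 1))).
    by rewrite ler_wpM2l ?(ltW eps0)// (le_trans E1)// lerDl.
  rewrite /eps le_eqVlt; apply/orP; left; apply/eqP; field.
  by rewrite gt_eqF// ltr_wpDl.
move: hE; rewrite x1 mulrDl mul1r; lra.
Qed.

(** For a fixed finite list both sides are continuous in L^2, so the bound extends from step
    functions, which have bounded support. The weight [e] in the comparison of norms is held fixed
    during the limit and removed afterwards. *)
Lemma frame_upper f (s : seq (int * Z)) : l2 lebV f -> uniq s ->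
  \sum_(p <- s) sqmod (wcoef f p.1 p.2) <= nr lebV f.
Proof.
move=> lf us.
have [g hg] : {g : nat -> seq (C * (V * V)) &
    forall n, nr lebV (fun t => stepf (g n) t - f t) < n.+1%:R^-1}.
  apply: (@choice _ _ (fun n q => nr lebV (fun t => stepf q t - f t) < n.+1%:R^-1)) => n.
  have n0 : 0 < n.+1%:R^-1 :> R by rewrite invr_gt0.
  by have [q hq] := step_dense lf n0; exists q; rewrite nr_subC.
have lg n : l2 lebV (stepf (g n)) by exact: l2_stepf.
have cg : (fun n => nr lebV (fun t => stepf (g n) t - f t)) @ \oo --> (0 : R).
  apply: (@squeeze_cvgr _ _ _ _ (fun=> 0) (fun n => n.+1%:R^-1)).
  - by apply: nearW => n; rewrite nr_ge0 ltW.
  - exact: cvg_cst.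
  - exact: cvg_harmonic.
have cw : (fun n => \sum_(p <- s) sqmod (wcoef (stepf (g n)) p.1 p.2)) @ \oo -->
    \sum_(p <- s) sqmod (wcoef f p.1 p.2).
  apply: (@cvg_sumr _ _ s (fun p n => sqmod (wcoef (stepf (g n)) p.1 p.2))) => p.
  by apply: ccvg_sqmod; apply: ccvg_cip_l => //; apply: l2_tr => //; exact: l2_psi.
have key e : 0 < e -> \sum_(p <- s) sqmod (wcoef f p.1 p.2) <= (1 + e) * nr lebV f.
  move=> e0.
  have cb : (fun n => (1 + e) * nr lebV f + (1 + e^-1) *
      nr lebV (fun t => stepf (g n) t - f t)) @ \oo --> (1 + e) * nr lebV f + (1 + e^-1) * 0.
    by apply: cvgD; [exact: cvg_cst|apply: cvgM => //; exact: cvg_cst].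
  rewrite -[X in _ <= X]addr0 -[X in _ <= _ + X](mulr0 (1 + e^-1)).
  apply: (ler_cvg_to cw cb); apply: nearW => n.
  have [rho _ hr] := stepf_bsupp (g n).
  apply: (le_trans (bsupp_upper (lg n) hr us)).
  have E : stepf (g n) = fun t => f t + (stepf (g n) t - f t).
    by apply/funext => t; rewrite addrC subrK.
  by rewrite {1}E; apply: nrD_le => //; exact: l2B.
apply/ler_addgt0Pr => e e0; have n0 := nr_ge0 lebV f.
have n1 : 0 < nr lebV f + 1 by rewrite ltr_wpDl.
have e1 : 0 < e / (nr lebV f + 1) by rewrite divr_gt0.
apply: (le_trans (key _ e1)); rewrite mulrDl mul1r lerD2l.
by rewrite mulrAC ler_pdivrMr// ler_wpM2l ?(ltW e0)// lerDl.
Qed.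

(** A nearly optimal list for a close step function g also serves f: on that list the coefficients
    of g - f have small energy by [frame_upper]. *)
Lemma frame_lower f e : l2 lebV f -> 0 < e -> exists2 q : seq (int * Z), uniq q &
  nr lebV f - e <= \sum_(p <- q) sqmod (wcoef f p.1 p.2).
Proof.
move=> lf e0; set n := nr lebV f.
have n0 : 0 <= n by exact: nr_ge0.
have n1 : 0 < n + 1 by rewrite ltr_wpDl.
(* With eps <= 1, eps n <= e/8 and T eta = e/16, expanding the two comparisons leaves at most three
   errors of size e/8 and five of size e/16, which together stay below e. *)
pose eps := Num.min 1 (e / (8 * (n + 1))).
have eps0 : 0 < eps by rewrite lt_min ltr01/= divr_gt0// mulr_gt0.
have eps1 : eps <= 1 by rewrite ge_min lexx.
have epsn : eps * n <= e / 8.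
  apply: (@le_trans _ _ (e / (8 * (n + 1)) * (n + 1))).
    apply: ler_pM; rewrite ?(ltW eps0)//; last by rewrite lerDl.
    by rewrite ge_min lexx orbT.
  by rewrite le_eqVlt; apply/orP; left; apply/eqP; field; rewrite gt_eqF.
pose T := 1 + eps^-1; have T1 : 1 <= T by rewrite lerDl invr_ge0 ltW.
have T0 : 0 < T := lt_le_trans ltr01 T1.
pose eta := e / (16 * T).
have eta0 : 0 < eta by rewrite divr_gt0// mulr_gt0.
have Teta : T * eta = e / 16 by rewrite /eta; field; rewrite gt_eqF.
have eta1 : eta <= e / 16 by rewrite -Teta ler_peMl// ltW.
have [s hs] := step_dense lf eta0; set g := stepf s in hs.
have lg : l2 lebV g by exact: l2_stepf.
have [q uq hq] := step_lower s eta0; exists q => //; rewrite -/g in hq.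
set Sf := \sum_(p <- q) _; set Sg := \sum_(p <- q) _ in hq.
have lgf : l2 lebV (fun t => g t - f t) by exact: l2B.
have SfS : Sf <= n by exact: frame_upper.
have Sf0 : 0 <= Sf by apply: sumr_ge0 => p _; exact: sqmod_ge0.
have h1 : n <= (1 + eps) * nr lebV g + T * eta.
  rewrite /n (_ : f = fun t => g t + (f t - g t)); last by apply/funext => t; rewrite addrC subrK.
  apply: (le_trans (nrD_le eps0 lg (l2B lf lg))); rewrite lerD2l ler_wpM2l ?(ltW T0)//.
  exact: ltW.
have h2 : Sg <= (1 + eps) * Sf + T * eta.
  apply: (@le_trans _ _ ((1 + eps) * Sf + T * \sum_(p <- q) sqmod (wcoef (fun t => g t - f t) p.1 p.2))).
    rewrite /Sg /Sf !mulr_sumr -big_split; apply: ler_sum => p _ /=.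
    have -> : wcoef g p.1 p.2 = wcoef f p.1 p.2 + wcoef (fun t => g t - f t) p.1 p.2.
      rewrite /wcoef cipBl//; first by rewrite addrC subrK.
      by apply: l2_tr => //; exact: l2_psi.
    exact: sqmodD_le.
  rewrite lerD2l ler_wpM2l ?(ltW T0)//; apply: (le_trans (frame_upper lgf uq)).
  by rewrite nr_subC ltW.
have h3 : (1 + eps) * nr lebV g <= (1 + eps) * ((1 + eps) * Sf + T * eta + eta).
  by rewrite ler_wpM2l ?addr_ge0 ?(ltW eps0)//; lra.
have p1 : eps * Sf <= e / 8 by apply: le_trans epsn; rewrite ler_wpM2l ?(ltW eps0).
have p2 : eps * (eps * Sf) <= e / 8.
  by apply: le_trans p1; rewrite ler_piMl// mulr_ge0// ltW.
have p3 : eps * eta <= e / 16 by apply: le_trans eta1; rewrite ler_piMl// ltW.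
have p4 : eps * (T * eta) <= e / 16 by rewrite -Teta ler_piMl// mulr_ge0// ltW.
have h4 : (1 + eps) * ((1 + eps) * Sf + T * eta + eta) =
  Sf + 2 * (eps * Sf) + eps * (eps * Sf) + T * eta + eta + eps * (T * eta) + eps * eta by ring.
by move: h1 h3; rewrite h4 Teta in p4 *; lra.
Qed.

Theorem parseval f : L2 f -> frame_sum A (psiA N0 A lA qA h phi) f = normsq f.
Proof.
move=> Lf; have /L2E lf := Lf; have [mf _] := Lf.
rewrite (normsqE mf) (nsqE lf) /frame_sum.
rewrite (eq_esum (b := fun p => (sqmod (wcoef f p.1 p.2))%:E)); last first.
  move=> p _; rewrite DApow_Tr ipE//; apply: l2_tr => //; exact: l2_psi.
apply: (@esum_eq R _ (fun p : int * Z => sqmod (wcoef f p.1 p.2))).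
  by move=> s us; exact: frame_upper.
by move=> e e0; exact: frame_lower.
Qed.

End limit.
End cascade.

Theorem theorem9p4 (R : realType) (d : nat) (A : 'M[int]_d)
  (lA qA : 'cV[int]_d) (h : 'cV[int]_d -> R[i]) (N0 : nat)
  (phi : d.-tuple R -> R[i])
  (* A : expansive integral matrix, |det A| = 2, A Z^d = A^T Z^d *)
  (hexp : expansive A)
  (hdet : `|\det A| = 2 :> int)
  (hlat : latt A = latt A^T)
  (* Z^d = (l_A + A Z^d) disjoint-union A Z^d *)
  (hl1 : [set: 'cV[int]_d] = pcoset lA (latt A) `|` latt A)
  (hl2 : pcoset lA (latt A) `&` latt A = set0)
  (* q_A o A Z^d in 2Z,  q_A o (l_A + A Z^d) in 2Z + 1 *)
  (hq1 : forall x, latt A x -> (2 %| dotZ qA x)%Z)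
  (hq2 : forall x, pcoset lA (latt A) x -> ~~ (2 %| dotZ qA x)%Z)
  (* m in A Z^d :  Z^d = (n - A Z^d) disjoint-union (l_A - m - n + A Z^d) *)
  (hm1 : forall m n, latt A m ->
     [set: 'cV[int]_d] = mcoset n (latt A) `|` pcoset (lA - m - n) (latt A)
     /\ mcoset n (latt A) `&` pcoset (lA - m - n) (latt A) = set0)
  (* m in l_A + A Z^d :  n - A Z^d = l_A - m - n + A Z^d *)
  (hm2 : forall m n, pcoset lA (latt A) m ->
     mcoset n (latt A) = pcoset (lA - m - n) (latt A))
  (* the filter coefficients *)
  (hsupp : forall n, ~ inLam0 N0 n -> h n = 0)
  (horth : forall k, latt A k ->
     \sum_(n <- Lam0 d N0) h n * conjc (h (n + k)) = (k == 0)%:R)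
  (hsum : \sum_(n <- Lam0 d N0) h n = (Num.sqrt 2)%:C)
  (* phi = F^{-1} g, i.e. F phi = g in L^2(R^d) *)
  (hphi : FT_L2 phi (gA N0 A h)) :
  forall f : d.-tuple R -> R[i], L2 f ->
    frame_sum A (psiA N0 A lA qA h phi) f = normsq f.
Proof. exact: (parseval hexp hdet hl1 hq1 hq2 hm1 hm2 hsupp horth hsum hphi). Qed.
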